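(* The group $\mathfrak{G}$ uniformizing the equation $y^2=x^5-x$ in Burnside's parametrization $x=\chi(\tau)$, $y=\varphi(\tau)$ is a free subgroup of rank $9$ and of index $2$ in $\Gamma(4)$. It is generated by the following nine elements: $$T_0=V_0V_0=\begin{pmatrix}1&8\\0&1\end{pmatrix},$$ $$T_1=V_0V_1=\begin{pmatrix}15&-4\\4&-1\end{pmatrix},\quad T_2=V_0V_2=\begin{pmatrix}19&-24\\4&-5\end{pmatrix},\quad T_3=V_0V_3=\begin{pmatrix}23&-52\\4&-9\end{pmatrix},\quad T_4=V_0V_4=\begin{pmatrix}27&-88\\4&-13\end{pmatrix},$$ $$T_5=V_0V_1^{-1}=\begin{pmatrix}17&4\\4&1\end{pmatrix},\quad T_6=V_0V_2^{-1}=\begin{pmatrix}21&-16\\4&-3\end{pmatrix},\quad T_7=V_0V_3^{-1}=\begin{pmatrix}25&-44\\4&-7\end{pmatrix},\quad T_8=V_0V_4^{-1}=\begin{pmatrix}29&-80\\4&-11\end{pmatrix}.$$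
   Context: Matrices are understood up to sign, as elements of $\Gamma(1)=\mathrm{PSL}_2(\mathbb{Z})$ acting on the upper half-plane $\mathbb{H}$ by Möbius transformations (equalities such as $V_0V_k^{-1}=T_{k+4}$ hold up to sign). $\Gamma(4)$ is the (image in $\mathrm{PSL}_2(\mathbb{Z})$ of the) principal congruence subgroup of level 4; it is generated by the five matrices $$V_0=\begin{pmatrix}1&4\\0&1\end{pmatrix},\;V_1=\begin{pmatrix}1&0\\-4&1\end{pmatrix},\;V_2=\begin{pmatrix}3&-4\\4&-5\end{pmatrix},\;V_3=\begin{pmatrix}7&-16\\4&-9\end{pmatrix},\;V_4=\begin{pmatrix}11&-36\\4&-13\end{pmatrix}.$$ Burnside's parametrization of $y^2=x^5-x$: $$\chi(\tau)=-\frac{\vartheta_4(\tau/2)}{\vartheta_3(\tau/2)},$$ where $\vartheta_3(\tau)=1+2\sum_{k\ge1}e^{k^2\pi i\tau}$ and $\vartheta_4(\tau)=1+2\sum_{k\ge1}(-1)^ke^{k^2\pi i\tau}$, and $\varphi$ is the single-valued holomorphic function on $\mathbb{H}$ (unique up to sign) with $\varphi(\tau)^2=\chi(\tau)^5-\chi(\tau)$; up to sign $\varphi(\tau)=4\,\eta^3(\tau)/\vartheta_3^3(\tau/2)$, where $\eta(\tau)=e^{\pi i\tau/12}\prod_{k\ge1}(1-e^{2k\pi i\tau})$. The automorphism group of a function $f$ on $\mathbb{H}$ is the group of Möbius transformations $\gamma$ of $\mathbb{H}$ with $f\circ\gamma=f$. The automorphism group of $\chi$ is $\mathfrak{G}_x=\Gamma(4)$.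 The group $\mathfrak{G}$ uniformizing the equation is $\mathfrak{G}=\mathfrak{G}_x\cap\mathfrak{G}_y$, the intersection of the automorphism groups of $\chi$ and $\varphi$. *)

(* Defs.v *)
From Stdlib Require Import Reals ZArith List.
From Coquelicot Require Import Coquelicot.
Import ListNotations.
Open Scope R_scope.

(** * PSL_2(R): 2x2 real matrices of determinant 1, up to sign

    A subgroup of PSL_2(R) is given by its full preimage in SL_2(R), i.e. by
    a predicate on matrices that is stable under [A |-> -A]; equality of
    elements of PSL_2(R) is [psl_eq]. *)

Record mat := Mat { m11 : R; m12 : R; m21 : R; m22 : R }.

Definition det (A : mat) : R := m11 A * m22 A - m12 A * m21 A.

Definition mone : mat := Mat 1 0 0 1.

Definition mopp (A : mat) : mat :=
  Mat (- m11 A) (- m12 A) (- m21 A) (- m22 A).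

Definition mmul (A B : mat) : mat :=
  Mat (m11 A * m11 B + m12 A * m21 B) (m11 A * m12 B + m12 A * m22 B)
      (m21 A * m11 B + m22 A * m21 B) (m21 A * m12 B + m22 A * m22 B).

(* The adjugate, which is the inverse of a matrix of determinant 1. *)
Definition minv (A : mat) : mat := Mat (m22 A) (- m12 A) (- m21 A) (m11 A).

Definition psl_eq (A B : mat) : Prop := A = B \/ A = mopp B.

Definition zmat (a b c d : Z) : mat := Mat (IZR a) (IZR b) (IZR c) (IZR d).

(* The image in PSL_2(Z) of the principal congruence subgroup of level N. *)
Definition Gamma (N : Z) (A : mat) : Prop :=
  exists a b c d : Z,
    (a * d - b * c = 1)%Z /\
    ((N | a - 1) /\ (N | b) /\ (N | c) /\ (N | d - 1))%Z /\
    psl_eq A (zmat a b c d).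

(** * Group-theoretic notions in PSL_2(R) *)

(* The subgroup of PSL_2(R) generated by the members of a list. *)
Inductive generated (l : list mat) : mat -> Prop :=
| gen_one : generated l mone
| gen_mem : forall A, In A l -> generated l A
| gen_mul : forall A B,
    generated l A -> generated l B -> generated l (mmul A B)
| gen_inv : forall A, generated l A -> generated l (minv A)
| gen_sign : forall A B, psl_eq A B -> generated l A -> generated l B.

Definition generates (l : list mat) (G : mat -> Prop) : Prop :=
  forall A, G A <-> generated l A.

(* [r] is a complete list of representatives, without repetition, of the left
   cosets of [H] in [G]. *)
Definition left_transversal (G H : mat -> Prop) (r : list mat) : Prop :=
  (forall A, In A r -> G A) /\
  (forall A, G A -> exists B, In B r /\ H (mmul (minv B) A)) /\
  (forall i j, (i < length r)%nat -> (j < length r)%nat ->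
     H (mmul (minv (nth i r mone)) (nth j r mone)) -> i = j).

Definition subgroup_of_index (n : nat) (H G : mat -> Prop) : Prop :=
  (forall A, H A -> G A) /\
  exists r : list mat, length r = n /\ left_transversal G H r.

(* Words in the members of a list: the letter [(i, true)] stands for the
   [i]-th member and [(i, false)] for its inverse. *)
Definition word := list (nat * bool).

Definition eval_letter (l : list mat) (x : nat * bool) : mat :=
  let A := nth (fst x) l mone in if snd x then A else minv A.

Definition eval_word (l : list mat) (w : word) : mat :=
  fold_right (fun x A => mmul (eval_letter l x) A) mone w.

Fixpoint reduced (w : word) : Prop :=
  match w with
  | x :: (y :: _) as w' => y <> (fst x, negb (snd x)) /\ reduced w'
  | _ => True
  end.

Definition free_basis (l : list mat) (G : mat -> Prop) : Prop :=
  generates l G /\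
  forall w : word,
    w <> [] -> (forall x, In x w -> (fst x < length l)%nat) -> reduced w ->
    ~ psl_eq (eval_word l w) mone.

Definition free_of_rank (n : nat) (G : mat -> Prop) : Prop :=
  exists l : list mat, length l = n /\ free_basis l G.

(** * Functions on the upper half-plane

    Functions on the half-plane are total functions on [C], of which only the
    values at points of positive imaginary part matter. *)

Definition upper (tau : C) : Prop := 0 < Im tau.

Definition moebius (A : mat) (tau : C) : C :=
  ((RtoC (m11 A) * tau + RtoC (m12 A)) /
   (RtoC (m21 A) * tau + RtoC (m22 A)))%C.

Definition Aut (f : C -> C) (A : mat) : Prop :=
  det A = 1 /\ forall tau, upper tau -> f (moebius A tau) = f tau.

Definition holomorphic_on_upper (f : C -> C) : Prop :=
  forall tau, upper tau -> ex_derive (K := C_AbsRing) f tau.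

(** * Burnside's parametrization of y^2 = x^5 - x *)

Definition Cexp (z : C) : C := (exp (Re z) * cos (Im z), exp (Re z) * sin (Im z)).

Definition CSeries (a : nat -> C) : C :=
  (Series (fun n => Re (a n)), Series (fun n => Im (a n))).

(* [q_term k tau] is e^(k^2 pi i tau). *)
Definition q_term (k : nat) (tau : C) : C :=
  Cexp (RtoC (INR k ^ 2 * PI) * Ci * tau)%C.

Definition theta3 (tau : C) : C :=
  (1 + 2 * CSeries (fun n => q_term (S n) tau))%C.

Definition theta4 (tau : C) : C :=
  (1 + 2 * CSeries (fun n => RtoC ((-1) ^ S n) * q_term (S n) tau))%C.

Definition chi (tau : C) : C := (- (theta4 (tau / 2) / theta3 (tau / 2)))%C.

(* Holds of exactly two functions on the half-plane, which differ by sign. *)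
Definition is_burnside_phi (phi : C -> C) : Prop :=
  holomorphic_on_upper phi /\
  forall tau, upper tau -> (phi tau ^ 2 = chi tau ^ 5 - chi tau)%C.

Definition uniformizing_group (phi : C -> C) (A : mat) : Prop :=
  Aut chi A /\ Aut phi A.

Definition V0 : mat := zmat 1 4 0 1.
Definition V1 : mat := zmat 1 0 (-4) 1.
Definition V2 : mat := zmat 3 (-4) 4 (-5).
Definition V3 : mat := zmat 7 (-16) 4 (-9).
Definition V4 : mat := zmat 11 (-36) 4 (-13).

(* T_0, ..., T_8 *)
Definition T_gens : list mat :=
  [ mmul V0 V0;
    mmul V0 V1; mmul V0 V2; mmul V0 V3; mmul V0 V4;
    mmul V0 (minv V1); mmul V0 (minv V2); mmul V0 (minv V3); mmul V0 (minv V4) ].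

Definition T_matrices : list mat :=
  [ zmat 1 8 0 1;
    zmat 15 (-4) 4 (-1); zmat 19 (-24) 4 (-5);
    zmat 23 (-52) 4 (-9); zmat 27 (-88) 4 (-13);
    zmat 17 4 4 1; zmat 21 (-16) 4 (-3);
    zmat 25 (-44) 4 (-7); zmat 29 (-80) 4 (-11) ].

(* Main.v *)
(** Write [A], [B] for Jacobi's theta_2, theta_3 at [2 tau] and [u = A / B]; then
    [chi = (u - 1) / (u + 1)], translation by 1 acts on [u] by [u -> i u], and
    [tau -> -1 / tau] acts by [u -> (1 - u) / (1 + u)]. The latter is a Poisson
    summation, proved by discrete Fourier analysis: [g z = Theta z (-1 / tau)] is
    1-periodic and quasi-periodic under [tau / 2], so, averaging over the [N]-th
    parts of a period, its Fourier coefficients are asymptotic to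
    [c exp (pi i m^2 tau / 2)], which identifies [(g 0, g (1/2))] with the theta
    constants at [tau / 2] up to a common factor.

    The form [D = A B (B^4 - A^4)] vanishes nowhere, since it does not for
    [Im tau >= 3/4] and its vanishing is invariant under the modular group. As
    [Psi = phi (A + B)^3] has square [8 D], [Psi (tau + 1) = k Psi tau] for a constant
    [k] with [k^2 = i], so [V0] changes the sign of [phi], and so do the other [V_j],
    which are conjugate to [V0] in the modular group. Hence exactly the words of
    even length in the [V_j] fix [phi], and these are generated by the [T_j].

    A real matrix fixing [chi] preserves Klein's invariant; Euclid's algorithm on
    its first column either brings it to upper triangular form, where the
    asymptotics at the cusp show that it is integral, or makes the lower left
    entry arbitrarily small, and then a fixed value of the invariant would be
    attained arbitrarily high in the cusp. Integral matrices are decomposed into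
    the [V_j] by descent along the isometric circles, and the freeness of the
    [T_j] is ping-pong on 18 disjoint intervals of the real line. *)

Require Import Defs.
From Stdlib Require Import Reals ZArith List.
From Coquelicot Require Import Coquelicot.
From Stdlib Require Import Lra Lia Psatz Ranalysis5.
Import ListNotations.
Open Scope R_scope.

(** * The complex exponential *)

(** Averages over [N]-th parts of a period replace integrals. Their limits are never shown to exist:
    only the differences from the Gaussian pattern tend to 0, so the inversion formula carries an
    anonymous factor [c]. It also cannot divide by theta constants, because their non-vanishing is
    deduced from it afterwards. This does no harm, as later uses are homogeneous in [thA] and [thB].

    [phi] composed with the inversion or with translation by 1 is [phi] times a constant and a
    function of [uq] alone. A map that preserves [uq] and changes the sign of [phi] therefore keeps
    both properties under conjugation.

    [Aut] ranges over real matrices, so integrality has to be proved. After that, one descent serves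
    both [Gamma 4] and [Aut chi]: it asks only which lower left entries and which translations
    occur.

    The rank 9 is Schreier's count: the products [V0 X] over the ten letters [X], without the
    trivial one. The 18 ping-pong intervals are cut out by the 17 half-integers from -1/2 to 15/2, a
    stretch of length 8 because [T_0] is translation by 8. *)

Lemma C_ext (z w : C) : Re z = Re w -> Im z = Im w -> z = w.
Proof. destruct z, w; simpl; congruence. Qed.

Lemma Cmult_integral (z w : C) : (z * w)%C = 0%C -> z = 0%C \/ w = 0%C.
Proof.
  intros H. destruct (Ceq_dec z 0) as [|Hz]; [now left|].
  destruct (Ceq_dec w 0) as [|Hw]; [now right|].
  now elim (Cmult_neq_0 z w Hz Hw).
Qed.

Lemma Cexp_plus (z w : C) : Cexp (z + w) = (Cexp z * Cexp w)%C.
Proof.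
  destruct z as [a b], w as [c d]; unfold Cexp, Cplus, Cmult; simpl.
  rewrite exp_plus, cos_plus, sin_plus. apply C_ext; simpl; ring.
Qed.

Lemma Cexp_0 : Cexp 0 = 1%C.
Proof. apply C_ext; simpl; rewrite exp_0, ?cos_0, ?sin_0; ring. Qed.

Lemma Cmod_Cexp (z : C) : Cmod (Cexp z) = exp (Re z).
Proof.
  unfold Cmod, Cexp; simpl fst; simpl snd.
  replace ((exp (Re z) * cos (Im z)) ^ 2 + (exp (Re z) * sin (Im z)) ^ 2)
    with (exp (Re z) ^ 2 * (Rsqr (sin (Im z)) + Rsqr (cos (Im z)))) by (unfold Rsqr; ring).
  rewrite sin2_cos2, Rmult_1_r. apply sqrt_pow2, Rlt_le, exp_pos.
Qed.

Lemma Cexp_neq0 (z : C) : Cexp z <> 0%C.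
Proof.
  intros H. generalize (Cmod_Cexp z). rewrite H, Cmod_0.
  generalize (exp_pos (Re z)). lra.
Qed.

Lemma Cexp_opp (z : C) : (Cexp (- z) * Cexp z)%C = 1%C.
Proof.
  rewrite <- Cexp_plus. replace (- z + z)%C with (RtoC 0) by ring. apply Cexp_0.
Qed.

Lemma cos_sin_2PI_Z (n : Z) : cos (2 * PI * IZR n) = 1 /\ sin (2 * PI * IZR n) = 0.
Proof.
  split.
  - replace (2 * PI * IZR n) with (2 * (IZR n * PI)) by ring.
    rewrite cos_2a_sin. rewrite (sin_eq_0_1 (IZR n * PI)) by (exists n; ring). ring.
  - apply sin_eq_0_1. exists (2 * n)%Z. rewrite mult_IZR. ring.
Qed.

Lemma Cexp_2PIi_Z (n : Z) : Cexp (2 * PI * Ci * IZR n)%C = 1%C.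
Proof.
  destruct (cos_sin_2PI_Z n) as [Hc Hs].
  unfold Cexp.
  replace (Re (2 * PI * Ci * IZR n)%C) with 0 by (simpl; ring).
  replace (Im (2 * PI * Ci * IZR n)%C) with (2 * PI * IZR n) by (simpl; ring).
  rewrite Hc, Hs, exp_0. apply C_ext; simpl; ring.
Qed.

Lemma Cexp_2PIi_eq1 (x : R) : Cexp (2 * PI * Ci * x)%C = 1%C -> exists n : Z, x = IZR n.
Proof.
  unfold Cexp.
  replace (Re (2 * PI * Ci * x)%C) with 0 by (simpl; ring).
  replace (Im (2 * PI * Ci * x)%C) with (2 * (PI * x)) by (simpl; ring).
  intros H. apply (f_equal Re) in H. simpl in H.
  rewrite exp_0, cos_2a_sin in H.
  assert (H1 : sin (PI * x) = 0) by nra.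
  destruct (sin_eq_0_0 _ H1) as [n Hn]. exists n.
  apply (Rmult_eq_reg_l PI); [lra | apply PI_neq0].
Qed.

Lemma Cmod_le_Rabs (z : C) : Cmod z <= Rabs (Re z) + Rabs (Im z).
Proof.
  destruct z as [a b]; simpl.
  replace (a, b) with (RtoC a + Ci * RtoC b)%C by (apply C_ext; simpl; ring).
  eapply Rle_trans. apply Cmod_triangle.
  rewrite Cmod_mult, Cmod_Ci, !Cmod_R. lra.
Qed.

Lemma Im_le_Cmod (z : C) : Rabs (Im z) <= Cmod z.
Proof. eapply Rle_trans; [apply Rmax_r | apply Rmax_Cmod]. Qed.

Lemma exp_le_compat (x y : R) : x <= y -> exp x <= exp y.
Proof. intros [H|H]; [left; now apply exp_increasing | subst; apply Rle_refl]. Qed.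

Lemma exp_ge_1_plus (x : R) : 1 + x <= exp x.
Proof.
  destruct (Req_dec x 0) as [->|Hx]; [rewrite exp_0; lra | left; now apply exp_ineq1].
Qed.

Lemma exp_minus_1_bound (a : R) : Rabs (exp a - 1) <= Rabs a * exp (Rabs a).
Proof.
  generalize (exp_ge_1_plus a) (exp_ge_1_plus (- a)) (exp_pos a) (exp_ge_1_plus (Rabs a)).
  rewrite exp_Ropp. intros H1 H2 H3 H4.
  assert (H5 : exp a - 1 <= a * exp a).
  { apply Rmult_le_compat_r with (r := exp a) in H2; [|lra].
    rewrite Rinv_l in H2; nra. }
  destruct (Rle_dec 0 a).
  - rewrite !Rabs_pos_eq in * by lra. lra.
  - rewrite (Rabs_left a) in * by lra. rewrite Rabs_left1; [|].
    + nra.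
    + assert (exp a <= exp 0) by (apply exp_le_compat; lra). rewrite exp_0 in H. lra.
Qed.

Lemma exp_taylor1_bound (a : R) : Rabs (exp a - 1 - a) <= a ^ 2 * exp (Rabs a).
Proof.
  generalize (exp_ge_1_plus a) (exp_ge_1_plus (- a)) (exp_pos a) (exp_ge_1_plus (Rabs a)).
  rewrite exp_Ropp. intros H1 H2 H3 H4.
  assert (H5 : exp a - 1 <= a * exp a).
  { apply Rmult_le_compat_r with (r := exp a) in H2; [|lra].
    rewrite Rinv_l in H2; nra. }
  rewrite Rabs_pos_eq by lra.
  destruct (Rle_dec 0 a).
  - rewrite !Rabs_pos_eq in * by lra. nra.
  - rewrite (Rabs_left a) in * by lra.
    assert (exp a - 1 - a <= (-a) * (1 - exp a)) by nra.
    assert (1 - exp a <= - a) by lra. nra.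
Qed.

Lemma cos_bound2 (b : R) : Rabs (cos b - 1) <= b ^ 2 / 2.
Proof.
  replace b with (2 * (b / 2)) at 1 by field. rewrite cos_2a_sin.
  assert (H : (sin (b / 2)) ^ 2 <= (b / 2) ^ 2).
  { assert (H : Rabs (sin (b/2)) <= Rabs (b/2)).
    { assert (P : forall x, 0 <= x -> Rabs (sin x) <= x).
      { intros x [Hx|Hx].
        - generalize (sin_lt_x x Hx) (sin_lt_x). intros H _.
          apply Rabs_le; split; [|lra].
          destruct (Rle_dec x 1).
          + assert (0 <= sin x); [|lra]. generalize PI2_1; intros. apply sin_ge_0; lra.
          + generalize (SIN_bound x). lra.
        - subst. rewrite sin_0, Rabs_R0. lra. }
      destruct (Rle_dec 0 (b/2)) as [h|h].
      - rewrite (Rabs_pos_eq (b/2)) by lra. auto.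
      - rewrite (Rabs_left (b/2)) by lra. rewrite <- Rabs_Ropp, <- sin_neg. apply P; lra. }
    rewrite <- (pow2_abs (sin _)), <- (pow2_abs (b/2)).
    apply pow_incr. split; [apply Rabs_pos | exact H]. }
  apply Rabs_le. nra.
Qed.

Lemma sin_bound2 (b : R) : Rabs (sin b - b) <= 2 * b ^ 2.
Proof.
  assert (P : forall x, 0 <= x -> Rabs (sin x - x) <= 2 * x ^ 2).
  { intros x [Hx|Hx].
    - generalize (sin_lt_x x Hx). intros H. apply Rabs_le; split; [|nra].
      destruct (Rle_dec x 1).
      + generalize (pre_sin_bound x 0). simpl. unfold sin_approx; simpl.
        unfold sin_term; simpl. intros Q. destruct Q as [Q _]; try lra.
        replace (-1 * 1 * (x * (x * (x * 1)) / (6))) with (- x ^ 3 / 6) in Q by field.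
        nra.
      + generalize (SIN_bound x). nra.
    - subst. rewrite sin_0, Rminus_0_r, Rabs_R0. lra. }
  destruct (Rle_dec 0 b); [now apply P; lra|].
  replace (b ^ 2) with ((- b) ^ 2) by ring.
  rewrite <- Rabs_Ropp. replace (- (sin b - b)) with (sin (- b) - - b) by (rewrite sin_neg; ring).
  apply P. lra.
Qed.

(** Real and imaginary parts are estimated separately. The four errors contribute 1/2, 1, 2 and 1,
    so 6 is a rounded constant. *)
Lemma Cexp_taylor1_bound (z : C) :
  Cmod (Cexp z - 1 - z) <= 6 * Cmod z ^ 2 * exp (Cmod z).
Proof.
  destruct z as [a b].
  generalize (re_le_Cmod (a, b)) (Im_le_Cmod (a, b)). simpl Re; simpl Im.
  set (r := Cmod (a, b)). intros Ha Hb.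
  eapply Rle_trans. apply Cmod_le_Rabs. simpl.
  assert (E : exp (Rabs a) <= exp r) by (apply exp_le_compat, Ha).
  assert (E' : exp a <= exp r) by (apply exp_le_compat; generalize (Rle_abs a); lra).
  assert (a2 : a ^ 2 <= r ^ 2) by (rewrite <- (pow2_abs a); apply pow_incr; split; [apply Rabs_pos | auto]).
  assert (b2 : b ^ 2 <= r ^ 2) by (rewrite <- (pow2_abs b); apply pow_incr; split; [apply Rabs_pos | auto]).
  assert (r2 : 0 <= r ^ 2) by apply pow2_ge_0.
  pose proof (exp_pos a) as P1. pose proof (exp_pos r) as P2. pose proof (Rabs_pos a). pose proof (Rabs_pos b).
  replace (exp a * cos b + - (1) + - a) with (exp a * (cos b - 1) + (exp a - 1 - a)) by ring.
  replace (exp a * sin b + - 0 + - b) with (exp a * (sin b - b) + b * (exp a - 1)) by ring.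
  assert (B1 : Rabs (exp a * (cos b - 1)) <= exp r * (r ^ 2 / 2)).
  { rewrite Rabs_mult, (Rabs_pos_eq (exp a)) by lra. generalize (cos_bound2 b) (Rabs_pos (cos b - 1)).
    intros. apply Rmult_le_compat; lra. }
  assert (B2 : Rabs (exp a - 1 - a) <= r ^ 2 * exp r).
  { eapply Rle_trans. apply exp_taylor1_bound. apply Rmult_le_compat; auto using pow2_ge_0.
    apply Rlt_le, exp_pos. }
  assert (B3 : Rabs (exp a * (sin b - b)) <= exp r * (2 * r ^ 2)).
  { rewrite Rabs_mult, (Rabs_pos_eq (exp a)) by lra. generalize (sin_bound2 b) (Rabs_pos (sin b - b)).
    intros. apply Rmult_le_compat; lra. }
  assert (B4 : Rabs (b * (exp a - 1)) <= r * (r * exp r)).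
  { rewrite Rabs_mult. generalize (exp_minus_1_bound a) (Rabs_pos (exp a - 1)). intros.
    apply Rmult_le_compat; auto. eapply Rle_trans; [eassumption|].
    apply Rmult_le_compat; auto. apply Rlt_le, exp_pos. }
  generalize (Rabs_triang (exp a * (cos b - 1)) (exp a - 1 - a))
    (Rabs_triang (exp a * (sin b - b)) (b * (exp a - 1))).
  intros. nra.
Qed.

Lemma Cexp_minus_1_bound (z : C) : Cmod (Cexp z - 1) <= 7 * Cmod z * (1 + Cmod z) * exp (Cmod z).
Proof.
  replace (Cexp z - 1)%C with ((Cexp z - 1 - z) + z)%C by ring.
  eapply Rle_trans. apply Cmod_triangle.
  generalize (Cexp_taylor1_bound z) (exp_ge_1_plus (Cmod z)) (Cmod_ge_0 z). nra.
Qed.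

(** Completing the square; the 1 added to [b] buys the factor [exp (- |x|)], the decay that [zdom]
    asks for. *)
Lemma gauss_majorant (a b c : R) : 0 < a -> exists M, 0 < M /\ forall x,
  exp (- a * x ^ 2 + b * Rabs x + c) <= M * exp (- Rabs x).
Proof.
  intros Ha. exists (exp (c + (b + 1) ^ 2 / (4 * a))). split; [apply exp_pos|].
  intros x. rewrite <- exp_plus. apply exp_le_compat.
  rewrite <- (pow2_abs x). set (y := Rabs x).
  assert (0 <= a * (y - (b + 1) / (2 * a)) ^ 2) by (apply Rmult_le_pos; [lra | apply pow2_ge_0]).
  assert (a * (y - (b + 1) / (2 * a)) ^ 2 = a * y ^ 2 - (b + 1) * y + (b + 1) ^ 2 / (4 * a)) by (field; lra).
  lra.
Qed.

(** * Limits of complex sequences and sums over the integers *)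

Fixpoint csum (f : nat -> C) (n : nat) : C :=
  match n with O => 0 | S n => csum f n + f n end.

Lemma csum_ext (f g : nat -> C) n :
  (forall k, (k < n)%nat -> f k = g k) -> csum f n = csum g n.
Proof.
  induction n as [|n IH]; intros H; simpl; [reflexivity|].
  rewrite IH, H by (intros; try apply H; lia). reflexivity.
Qed.

Lemma csum_plus (f g : nat -> C) n :
  csum (fun k => f k + g k)%C n = (csum f n + csum g n)%C.
Proof. induction n as [|n IH]; simpl; [ring|]. rewrite IH. ring. Qed.

Lemma csum_scal (c : C) (f : nat -> C) n :
  csum (fun k => c * f k)%C n = (c * csum f n)%C.
Proof. induction n as [|n IH]; simpl; [ring|]. rewrite IH. ring. Qed.

Lemma csum_0 n : csum (fun _ => 0%C) n = 0%C.
Proof. induction n as [|n IH]; simpl; [reflexivity|]. rewrite IH. ring. Qed.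

Lemma csum_swap (f : nat -> nat -> C) n m :
  csum (fun k => csum (f k) m) n = csum (fun l => csum (fun k => f k l) n) m.
Proof.
  induction n as [|n IH]; simpl; [now rewrite csum_0|].
  rewrite IH, <- csum_plus. reflexivity.
Qed.

Lemma csum_bound (f : nat -> C) (K : R) n :
  (forall k, (k < n)%nat -> Cmod (f k) <= K) -> Cmod (csum f n) <= INR n * K.
Proof.
  induction n as [|n IH]; intros H; [simpl; rewrite Cmod_0; lra|].
  rewrite S_INR. simpl csum. eapply Rle_trans. apply Cmod_triangle.
  specialize (H n ltac:(lia)) as H1. assert (H2 := IH ltac:(intros; apply H; lia)). lra.
Qed.

Lemma csum_telescope (f : nat -> C) n :
  csum (fun k => f (S k) - f k)%C n = (f n - f O)%C.
Proof. induction n as [|n IH]; simpl; [ring|]. rewrite IH. ring. Qed.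

Lemma csum_S_l (f : nat -> C) n : csum f (S n) = (f O + csum (fun k => f (S k)) n)%C.
Proof. induction n as [|n IH]; [simpl; ring|]. simpl in *. rewrite IH. ring. Qed.

Lemma csum_single (f : nat -> C) n j :
  (j < n)%nat -> (forall k, (k < n)%nat -> k <> j -> f k = 0%C) -> csum f n = f j.
Proof.
  induction n as [|n IH]; intros Hj H; [lia|]. simpl.
  destruct (Nat.eq_dec j n) as [->|Hn].
  - rewrite (csum_ext f (fun _ => 0%C)), csum_0 by (intros; apply H; lia). ring.
  - rewrite IH, (H n) by (intros; try apply H; lia). ring.
Qed.

Definition clim (s : nat -> C) (l : C) : Prop :=
  forall eps, 0 < eps -> exists N, forall n, (N <= n)%nat -> Cmod (s n - l) < eps.

Lemma clim_ext (s t : nat -> C) l : (forall n, s n = t n) -> clim s l -> clim t l.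
Proof.
  intros E H eps He. destruct (H eps He) as [N HN]. exists N. intros n Hn.
  rewrite <- E. auto.
Qed.

Lemma clim_const (l : C) : clim (fun _ => l) l.
Proof.
  intros eps He. exists O. intros n _. replace (l - l)%C with (RtoC 0) by ring.
  now rewrite Cmod_0.
Qed.

Lemma clim_plus s t a b : clim s a -> clim t b -> clim (fun n => s n + t n)%C (a + b).
Proof.
  intros Hs Ht eps He.
  destruct (Hs (eps / 2) ltac:(lra)) as [N HN], (Ht (eps / 2) ltac:(lra)) as [M HM].
  exists (N + M)%nat. intros n Hn.
  replace (s n + t n - (a + b))%C with ((s n - a) + (t n - b))%C by ring.
  eapply Rle_lt_trans. apply Cmod_triangle.
  specialize (HN n ltac:(lia)). specialize (HM n ltac:(lia)). lra.
Qed.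

Lemma clim_scal c s a : clim s a -> clim (fun n => c * s n)%C (c * a).
Proof.
  intros Hs eps He. pose proof (Cmod_ge_0 c) as Hc.
  destruct (Hs (eps / (Cmod c + 1))) as [N HN].
  { apply Rdiv_lt_0_compat; lra. }
  exists N. intros n Hn. specialize (HN n Hn).
  replace (c * s n - c * a)%C with (c * (s n - a))%C by ring.
  rewrite Cmod_mult.
  assert (Cmod (s n - a) * (Cmod c + 1) < eps).
  { apply Rmult_lt_reg_r with (/ (Cmod c + 1)). apply Rinv_0_lt_compat; lra.
    rewrite Rmult_assoc, Rinv_r by lra. rewrite Rmult_1_r. exact HN. }
  generalize (Cmod_ge_0 (s n - a)). nra.
Qed.

Lemma clim_unique s a b : clim s a -> clim s b -> a = b.
Proof.
  intros Ha Hb. destruct (Ceq_dec a b) as [|H]; [assumption|exfalso].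
  assert (H0 : 0 < Cmod (a - b)).
  { apply Cmod_gt_0. intros H1. apply H. replace a with (a - b + b)%C by ring. rewrite H1. ring. }
  destruct (Ha (Cmod (a - b) / 2) ltac:(lra)) as [N HN], (Hb (Cmod (a - b) / 2) ltac:(lra)) as [M HM].
  specialize (HN (N + M)%nat ltac:(lia)). specialize (HM (N + M)%nat ltac:(lia)).
  assert (T : Cmod (a - b) <= Cmod (s (N + M)%nat - a) + Cmod (s (N + M)%nat - b)).
  { replace (a - b)%C with (- (s (N + M)%nat - a) + (s (N + M)%nat - b))%C by ring.
    eapply Rle_trans. apply Cmod_triangle. rewrite Cmod_opp. lra. }
  lra.
Qed.

Lemma clim_const_eq a b : clim (fun _ => a) b -> a = b.
Proof. exact (clim_unique _ a b (clim_const a)). Qed.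

Lemma clim_subseq s l (p : nat -> nat) :
  (forall n, (n <= p n)%nat) -> clim s l -> clim (fun n => s (p n)) l.
Proof.
  intros Hp H eps He. destruct (H eps He) as [N HN]. exists N. intros n Hn.
  apply HN. specialize (Hp n). lia.
Qed.

Lemma clim_bound s l B : clim s l -> (forall n, Cmod (s n) <= B) -> Cmod l <= B.
Proof.
  intros H HB. apply Rnot_lt_le. intros Hlt.
  destruct (H (Cmod l - B) ltac:(lra)) as [N HN]. specialize (HN N (le_n N)).
  assert (Cmod l <= Cmod (s N) + Cmod (s N - l)).
  { replace l with (s N + - (s N - l))%C at 1 by ring.
    eapply Rle_trans. apply Cmod_triangle. rewrite Cmod_opp. lra. }
  specialize (HB N). lra.
Qed.

Lemma clim_0_inv_n s (K : R) :
  (forall n, (0 < n)%nat -> Cmod (s n) <= K / INR n) -> clim s 0.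
Proof.
  intros H eps He.
  destruct (INR_unbounded (K / eps)) as [N HN].
  exists (S N). intros n Hn. replace (s n - 0)%C with (s n) by ring.
  eapply Rle_lt_trans. apply H; lia.
  assert (INR N <= INR n) by (apply le_INR; lia).
  assert (0 < INR n) by (apply lt_0_INR; lia).
  apply Rmult_lt_reg_r with (INR n); [assumption|]. unfold Rdiv.
  rewrite Rmult_assoc, Rinv_l by lra.
  assert (K / eps * eps < INR n * eps) by (apply Rmult_lt_compat_r; lra).
  replace (K / eps * eps) with K in H2 by (field; lra). lra.
Qed.

Lemma clim_0_le s t : (forall n, Cmod (s n) <= Cmod (t n)) -> clim t 0 -> clim s 0.
Proof.
  intros H Ht eps He. destruct (Ht eps He) as [N HN]. exists N. intros n Hn.
  specialize (HN n Hn). replace (s n - 0)%C with (s n) by ring.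
  replace (t n - 0)%C with (t n) in HN by ring. eapply Rle_lt_trans; eauto.
Qed.

Lemma Re_csum f n : Re (csum f (S n)) = sum_n (fun k => Re (f k)) n.
Proof.
  induction n as [|n IH]; [rewrite sum_O; apply Rplus_0_l|].
  rewrite sum_Sn, <- IH. reflexivity.
Qed.

Lemma Im_csum f n : Im (csum f (S n)) = sum_n (fun k => Im (f k)) n.
Proof.
  induction n as [|n IH]; [rewrite sum_O; apply Rplus_0_l|].
  rewrite sum_Sn, <- IH. reflexivity.
Qed.

Lemma CSeries_lim (a : nat -> C) (K : R) :
  (forall n, Cmod (a n) <= K * (/ 2) ^ n) -> clim (csum a) (CSeries a).
Proof.
  intros H.
  assert (G : ex_series (fun n => K * (/ 2) ^ n)).
  { apply (ex_series_scal (K := R_AbsRing) (V := R_NormedModule) K (fun n => (/ 2) ^ n)). apply ex_series_geom. rewrite Rabs_pos_eq; lra. }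
  assert (HR : ex_series (fun n => Re (a n))).
  { apply (ex_series_le (K := R_AbsRing) (V := R_CompleteNormedModule) _ (fun n => K * (/ 2) ^ n)); [|exact G].
    intros n. eapply Rle_trans; [apply re_le_Cmod | apply H]. }
  assert (HI : ex_series (fun n => Im (a n))).
  { apply (ex_series_le (K := R_AbsRing) (V := R_CompleteNormedModule) _ (fun n => K * (/ 2) ^ n)); [|exact G].
    intros n. eapply Rle_trans; [apply Im_le_Cmod | apply H]. }
  apply Series_correct in HR. apply Series_correct in HI.
  change (is_lim_seq (sum_n (fun n => Re (a n))) (Series (fun n => Re (a n)))) in HR.
  change (is_lim_seq (sum_n (fun n => Im (a n))) (Series (fun n => Im (a n)))) in HI.
  apply is_lim_seq_spec in HR. apply is_lim_seq_spec in HI.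
  intros eps He.
  assert (He2 : 0 < eps / 2) by lra.
  destruct (HR (mkposreal _ He2)) as [N HN]. destruct (HI (mkposreal _ He2)) as [M HM].
  exists (S (N + M)). intros [|n] Hn; [lia|].
  eapply Rle_lt_trans. apply Cmod_le_Rabs.
  specialize (HN n ltac:(lia)). specialize (HM n ltac:(lia)). simpl in HN, HM.
  replace (Re (csum a (S n) - CSeries a)) with (sum_n (fun k => Re (a k)) n - Series (fun k => Re (a k)))
    by (rewrite <- Re_csum; simpl; ring).
  replace (Im (csum a (S n) - CSeries a)) with (sum_n (fun k => Im (a k)) n - Series (fun k => Im (a k)))
    by (rewrite <- Im_csum; simpl; ring).
  lra.
Qed.

Lemma csum_geom_bound (a : nat -> C) (K : R) :
  (forall n, Cmod (a n) <= K * (/ 2) ^ n) -> forall n, Cmod (csum a n) <= 2 * K.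
Proof.
  intros H.
  assert (HK : 0 <= K) by (generalize (H O) (Cmod_ge_0 (a O)); simpl; lra).
  assert (G : forall n, Cmod (csum a n) <= 2 * K * (1 - (/ 2) ^ n)).
  { induction n as [|n IH]; simpl csum; [rewrite Cmod_0; simpl; lra|].
    eapply Rle_trans. apply Cmod_triangle. specialize (H n). simpl pow. lra. }
  intros n. eapply Rle_trans. apply G.
  assert (0 < (/ 2) ^ n) by (apply pow_lt; lra). nra.
Qed.

(** * Sums over the integers with exponentially decaying terms *)

(** Pairing [n] with [- n - 1] uses every integer once with no exception at 0. It is also the
    reflection that preserves the theta series at 1/2. *)
Definition zfold (f : Z -> C) (n : nat) : C :=
  (f (Z.of_nat n) + f (- Z.of_nat n - 1)%Z)%C.

Definition zsum (f : Z -> C) : C := CSeries (zfold f).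

Definition zdom (f : Z -> C) (K : R) : Prop :=
  forall n, Cmod (f n) <= K * exp (- Rabs (IZR n)).

Lemma zdom_nonneg f K : zdom f K -> 0 <= K.
Proof.
  intros H. generalize (H 0%Z) (Cmod_ge_0 (f 0%Z)). rewrite Rabs_R0, Ropp_0, exp_0. lra.
Qed.

Lemma exp_opp_INR n : exp (- INR n) <= (/ 2) ^ n.
Proof.
  induction n as [|n IH]; [simpl; rewrite Ropp_0, exp_0; lra|].
  rewrite S_INR, Ropp_plus_distr, exp_plus. simpl pow.
  rewrite (Rmult_comm (/2)). apply Rmult_le_compat; try (apply Rlt_le, exp_pos); auto.
  rewrite exp_Ropp. apply Rinv_le_contravar; [lra|]. generalize (exp_ge_1_plus 1). lra.
Qed.

Lemma zdom_zfold f K : zdom f K -> forall n, Cmod (zfold f n) <= 2 * K * (/ 2) ^ n.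
Proof.
  intros H n. unfold zfold.
  pose proof (zdom_nonneg f K H) as HK.
  eapply Rle_trans. apply Cmod_triangle.
  assert (H1 := H (Z.of_nat n)). assert (H2 := H (- Z.of_nat n - 1)%Z).
  rewrite minus_IZR, opp_IZR, <- INR_IZR_INZ in H2. rewrite <- INR_IZR_INZ in H1.
  generalize (pos_INR n). intros Hn.
  rewrite Rabs_pos_eq in H1 by lra. rewrite Rabs_left in H2 by lra.
  assert (exp (- - (- INR n - 1)) <= exp (- INR n)) by (apply exp_le_compat; lra).
  generalize (exp_opp_INR n). intros. nra.
Qed.

Lemma zsum_lim f K : zdom f K -> clim (csum (zfold f)) (zsum f).
Proof. intros H. apply CSeries_lim with (2 * K). now apply zdom_zfold. Qed.

Lemma zsum_bound f K : zdom f K -> Cmod (zsum f) <= 4 * K.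
Proof.
  intros H. apply clim_bound with (csum (zfold f)). now apply zsum_lim with K.
  intros n. replace (4 * K) with (2 * (2 * K)) by ring.
  apply csum_geom_bound. now apply zdom_zfold.
Qed.

Lemma CSeries_ext a b : (forall n, a n = b n) -> CSeries a = CSeries b.
Proof. intros H. unfold CSeries. f_equal; apply Series_ext; intros n; now rewrite H. Qed.

Lemma zsum_ext f g : (forall n, f n = g n) -> zsum f = zsum g.
Proof. intros H. apply CSeries_ext. intros n. unfold zfold. now rewrite !H. Qed.

Lemma zdom_ext f g K : (forall n, f n = g n) -> zdom f K -> zdom g K.
Proof. intros H Hf n. rewrite <- H. apply Hf. Qed.

Lemma zdom_plus f g K L : zdom f K -> zdom g L -> zdom (fun n => f n + g n)%C (K + L).
Proof.
  intros Hf Hg n. eapply Rle_trans. apply Cmod_triangle. specialize (Hf n). specialize (Hg n). lra.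
Qed.

Lemma zdom_scal c f K : zdom f K -> zdom (fun n => c * f n)%C (Cmod c * K).
Proof.
  intros Hf n. rewrite Cmod_mult, Rmult_assoc. apply Rmult_le_compat_l; [apply Cmod_ge_0 | apply Hf].
Qed.

Lemma zsum_plus f g K L : zdom f K -> zdom g L ->
  zsum (fun n => f n + g n)%C = (zsum f + zsum g)%C.
Proof.
  intros Hf Hg. apply (clim_unique (csum (zfold (fun n => f n + g n)%C))).
  - eapply zsum_lim, zdom_plus; eauto.
  - eapply clim_ext; [|apply clim_plus; eapply zsum_lim; eauto].
    intros n. simpl. rewrite <- csum_plus. apply csum_ext. intros. unfold zfold. ring.
Qed.

Lemma zsum_scal c f K : zdom f K -> zsum (fun n => c * f n)%C = (c * zsum f)%C.
Proof.
  intros Hf. apply (clim_unique (csum (zfold (fun n => c * f n)%C))).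
  - eapply zsum_lim, zdom_scal; eauto.
  - eapply clim_ext; [|apply clim_scal; eapply zsum_lim; eauto].
    intros n. simpl. rewrite <- csum_scal. apply csum_ext. intros. unfold zfold. ring.
Qed.

Lemma zdom_shift f K : zdom f K -> zdom (fun n => f (n + 1)%Z) (K * exp 1).
Proof.
  intros H n. eapply Rle_trans. apply H.
  pose proof (zdom_nonneg f K H) as HK.
  rewrite Rmult_assoc, <- exp_plus. apply Rmult_le_compat_l; [assumption|]. apply exp_le_compat.
  rewrite plus_IZR. assert (T := Rabs_triang (IZR n + 1) (- (1))). rewrite Rabs_Ropp, Rabs_R1 in T.
  replace (IZR n + 1 + - (1)) with (IZR n) in T by ring. lra.
Qed.

Lemma zdom_to_0 f K (p : nat -> Z) : zdom f K -> (forall n, (Z.of_nat n <= Z.abs (p n))%Z) ->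
  clim (fun n => f (p n)) 0.
Proof.
  intros H Hp. apply clim_0_inv_n with K. intros n Hn.
  pose proof (zdom_nonneg f K H) as HK.
  eapply Rle_trans. apply H. unfold Rdiv. apply Rmult_le_compat_l; [assumption|].
  rewrite exp_Ropp. apply Rinv_le_contravar. apply lt_0_INR; lia.
  rewrite <- abs_IZR. specialize (Hp n). apply IZR_le in Hp. rewrite <- INR_IZR_INZ in Hp.
  generalize (exp_ge_1_plus (IZR (Z.abs (p n)))). lra.
Qed.

(** The partial sums run over the window from [- n] to [n - 1]. Shifting it changes the sum by
    [f n - f (- n)], which tends to 0. *)
Lemma zsum_shift f K : zdom f K -> zsum (fun n => f (n + 1)%Z) = zsum f.
Proof.
  intros Hf. apply (clim_unique (csum (zfold (fun n => f (n + 1)%Z)))).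
  - eapply zsum_lim, zdom_shift; eauto.
  - replace (zsum f) with (zsum f + (0 + (- (1)) * 0))%C by ring.
    eapply clim_ext; [|apply clim_plus; [eapply zsum_lim; eauto|]; apply clim_plus;
       [|apply clim_scal]; [apply (zdom_to_0 f K (fun n => Z.of_nat n))|apply (zdom_to_0 f K (fun n => (- Z.of_nat n)%Z))]; eauto; intros; lia].
    intros n. simpl. induction n as [|n IH].
    + simpl. ring.
    + simpl csum. rewrite <- IH. unfold zfold.
      replace (Z.of_nat (S n)) with (Z.of_nat n + 1)%Z by lia.
      replace (- Z.of_nat n - 1 + 1)%Z with (- Z.of_nat n)%Z by lia.
      replace (- Z.of_nat n - 1)%Z with (- (Z.of_nat n + 1))%Z by lia. ring.
Qed.

(** The window from [- 2 n] to [2 n - 1] splits exactly into the numbers [2 k] and [2 k + 1] with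
    [k] from [- n] to [n - 1]. *)
Lemma zsum_parity f K K0 K1 : zdom f K ->
  zdom (fun n => f (2 * n)%Z) K0 -> zdom (fun n => f (2 * n + 1)%Z) K1 ->
  zsum f = (zsum (fun n => f (2 * n)%Z) + zsum (fun n => f (2 * n + 1)%Z))%C.
Proof.
  intros H H0 H1.
  apply (clim_unique (fun n => csum (zfold f) (2 * n)%nat)).
  - apply (clim_subseq (csum (zfold f)) _ (fun n => (2 * n)%nat)); [intros; lia|]. eapply zsum_lim; eauto.
  - eapply clim_ext; [|apply clim_plus; eapply zsum_lim; eauto].
    induction n as [|n IH]; [simpl; ring|].
    replace (2 * S n)%nat with (S (S (2 * n)))%nat by lia. cbn [csum]. rewrite <- IH.
    unfold zfold.
    replace (Z.of_nat (S (2 * n))) with (2 * Z.of_nat n + 1)%Z by lia.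
    replace (Z.of_nat (2 * n)) with (2 * Z.of_nat n)%Z by lia.
    replace (- (2 * Z.of_nat n) - 1)%Z with (2 * (- Z.of_nat n - 1) + 1)%Z by lia.
    replace (- (2 * Z.of_nat n + 1) - 1)%Z with (2 * (- Z.of_nat n - 1))%Z by lia. ring.
Qed.

Lemma zsum_even f K : zdom f K -> (forall n, f (- n)%Z = f n) ->
  zsum f = (f 0%Z + 2 * CSeries (fun n => f (Z.of_nat (S n))))%C.
Proof.
  intros H He.
  pose proof (zdom_nonneg f K H) as HK.
  apply (clim_unique (csum (zfold f))); [eapply zsum_lim; eauto|].
  (* The window from [- n] to [n - 1] lacks [f n]; the added null term is the limit of this
     correction. *)
  replace (f 0%Z + 2 * CSeries (fun n => f (Z.of_nat (S n))))%C with
    (f 0%Z + (2 * CSeries (fun n => f (Z.of_nat (S n))) + (- (1)) * 0))%C by ring.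
  eapply clim_ext; [|apply clim_plus; [apply clim_const|apply clim_plus; apply clim_scal;
    [apply (CSeries_lim _ K)|apply (zdom_to_0 f K (fun n => Z.of_nat n)); auto; intros; lia]]].
  - induction n as [|n IH]; [cbn [csum Z.of_nat]; ring|].
    cbn [csum]. rewrite <- IH. unfold zfold.
    replace (- Z.of_nat n - 1)%Z with (- Z.of_nat (S n))%Z by lia. rewrite He. ring.
  - intros n. eapply Rle_trans. apply H. apply Rmult_le_compat_l; [assumption|].
    rewrite <- INR_IZR_INZ, Rabs_pos_eq by apply pos_INR.
    eapply Rle_trans; [apply exp_opp_INR|]. simpl. generalize (pow_lt (/2) n). lra.
Qed.

(** * Averages of periodic functions *)

(** A uniform form of complex differentiability: on each square one constant bounds the values, the
    derivative [d] and the quadratic remainder. The discrete Cauchy argument uses just this, and it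
    passes to products and to theta series. *)
Definition taylor1_bound (g : C -> C) : Prop :=
  forall K, 0 <= K -> exists B, 0 <= B /\ forall z, Rabs (Re z) <= K -> Rabs (Im z) <= K ->
    exists d, Cmod (g z) <= B /\ Cmod d <= B /\
      forall h, Cmod h <= K -> Cmod (g (z + h) - g z - d * h)%C <= B * Cmod h ^ 2.

Lemma Cmod_sum6 a b c d e f : Cmod (a + (b + (c + (d + (e + f)))))%C <=
  Cmod a + (Cmod b + (Cmod c + (Cmod d + (Cmod e + Cmod f)))).
Proof.
  do 5 (eapply Rle_trans; [apply Cmod_triangle|]; apply Rplus_le_compat_l). apply Rle_refl.
Qed.

Lemma taylor1_bound_mult f g : taylor1_bound f -> taylor1_bound g -> taylor1_bound (fun z => f z * g z)%C.
Proof.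
  intros Hf Hg K HK. destruct (Hf K HK) as [A [HA Hf']], (Hg K HK) as [B [HB Hg']].
  exists (A * B * (3 + 2 * K + K ^ 2)).
  assert (HAB : 0 <= A * B) by (apply Rmult_le_pos; auto).
  assert (HABK : 0 <= A * B * K) by (apply Rmult_le_pos; auto).
  assert (HABK2 : 0 <= A * B * K ^ 2) by (apply Rmult_le_pos; nra).
  split. { nra. }
  intros z H1 H2. destruct (Hf' z H1 H2) as [d [F1 [F2 F3]]], (Hg' z H1 H2) as [e [G1 [G2 G3]]].
  pose proof (Cmod_ge_0 (f z)). pose proof (Cmod_ge_0 (g z)).
  pose proof (Cmod_ge_0 d). pose proof (Cmod_ge_0 e).
  assert (P : forall x y, 0 <= x <= A -> 0 <= y <= B -> x * y <= A * B)
    by (intros; apply Rmult_le_compat; lra).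
  exists (d * g z + f z * e)%C. split; [|split].
  - rewrite Cmod_mult. specialize (P (Cmod (f z)) (Cmod (g z))). nra.
  - eapply Rle_trans. apply Cmod_triangle. rewrite !Cmod_mult.
    pose proof (P (Cmod d) (Cmod (g z))). pose proof (P (Cmod (f z)) (Cmod e)). nra.
  - intros h Hh. specialize (F3 h Hh). specialize (G3 h Hh).
    set (r := (f (z + h) - f z - d * h)%C) in *. set (s := (g (z + h) - g z - e * h)%C) in *.
    replace (f (z + h) * g (z + h) - f z * g z - (d * g z + f z * e) * h)%C with
      (f z * s + (r * g z + (d * e * (h * h) + (d * h * s + (r * (e * h) + r * s)))))%C
      by (unfold r, s; ring).
    eapply Rle_trans. apply Cmod_sum6. rewrite !Cmod_mult.
    pose proof (Cmod_ge_0 h) as h0. pose proof (Cmod_ge_0 r) as r0. pose proof (Cmod_ge_0 s) as s0.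
    set (k := Cmod h) in *.
    assert (k2 : 0 <= k ^ 2) by nra.
    assert (kK : k ^ 2 <= K ^ 2) by nra.
    assert (T1 : Cmod (f z) * Cmod s <= A * B * k ^ 2).
    { rewrite Rmult_assoc. apply Rmult_le_compat; auto. }
    assert (T2 : Cmod r * Cmod (g z) <= A * B * k ^ 2).
    { replace (A * B * k ^ 2) with (A * k ^ 2 * B) by ring. apply Rmult_le_compat; auto. }
    assert (T3 : Cmod d * Cmod e * (k * k) <= A * B * k ^ 2).
    { replace (k * k) with (k ^ 2) by ring. apply Rmult_le_compat_r; auto. }
    assert (T4 : Cmod d * k * Cmod s <= A * B * k ^ 2 * K).
    { replace (A * B * k ^ 2 * K) with (A * K * (B * k ^ 2)) by ring.
      apply Rmult_le_compat; auto; [nra|]. apply Rmult_le_compat; auto. }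
    assert (T5 : Cmod r * (Cmod e * k) <= A * B * k ^ 2 * K).
    { replace (A * B * k ^ 2 * K) with (A * k ^ 2 * (B * K)) by ring.
      apply Rmult_le_compat; auto; [nra|]. apply Rmult_le_compat; auto. }
    assert (T6 : Cmod r * Cmod s <= A * B * k ^ 2 * K ^ 2).
    { replace (A * B * k ^ 2 * K ^ 2) with (A * k ^ 2 * (B * K ^ 2)) by ring.
      apply Rmult_le_compat; auto. eapply Rle_trans; [eassumption|]. apply Rmult_le_compat_l; auto. }
    lra.
Qed.

Lemma taylor1_bound_Cexp (c : C) : taylor1_bound (fun z => Cexp (c * z)).
Proof.
  intros K HK.
  set (E := exp (Cmod c * (2 * K))).
  assert (HE : 0 < E) by apply exp_pos.
  pose proof (Cmod_ge_0 c) as c0.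
  set (E2 := exp (Cmod c * K)). assert (HE2 : 0 < E2) by apply exp_pos.
  assert (B1 : 0 <= E * Cmod c) by nra.
  assert (B2 : 0 <= E * (6 * Cmod c ^ 2 * E2)).
  { apply Rmult_le_pos; [lra|]. apply Rmult_le_pos; nra. }
  exists (E + E * Cmod c + E * (6 * Cmod c ^ 2 * E2)). split; [lra|].
  intros z H1 H2. exists (c * Cexp (c * z))%C.
  assert (Hz : Cmod (Cexp (c * z)) <= E).
  { rewrite Cmod_Cexp. apply exp_le_compat. eapply Rle_trans; [apply Rle_abs|].
    eapply Rle_trans. apply re_le_Cmod. rewrite Cmod_mult. apply Rmult_le_compat_l; auto.
    eapply Rle_trans. apply Cmod_le_Rabs. lra. }
  pose proof (Cmod_ge_0 (Cexp (c * z))) as z0.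
  split; [lra|split].
  - rewrite Cmod_mult. nra.
  - intros h Hh.
    replace (c * (z + h))%C with (c * z + c * h)%C by ring. rewrite Cexp_plus.
    replace (Cexp (c * z) * Cexp (c * h) - Cexp (c * z) - c * Cexp (c * z) * h)%C
      with (Cexp (c * z) * (Cexp (c * h) - 1 - c * h))%C by ring.
    rewrite Cmod_mult.
    assert (T := Cexp_taylor1_bound (c * h)). rewrite Cmod_mult in T.
    pose proof (Cmod_ge_0 h) as h0.
    assert (T2 : exp (Cmod c * Cmod h) <= E2) by (apply exp_le_compat; nra).
    assert (T3 : 6 * (Cmod c * Cmod h) ^ 2 * exp (Cmod c * Cmod h) <= 6 * Cmod c ^ 2 * E2 * Cmod h ^ 2).
    { replace (6 * Cmod c ^ 2 * E2 * Cmod h ^ 2) with (6 * (Cmod c * Cmod h) ^ 2 * E2) by ring.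
      apply Rmult_le_compat_l; auto. generalize (pow2_ge_0 (Cmod c * Cmod h)); lra. }
    apply Rle_trans with (E * (6 * Cmod c ^ 2 * E2 * Cmod h ^ 2)).
    { apply Rmult_le_compat; try lra. apply Cmod_ge_0. }
    assert (0 <= Cmod h ^ 2) by nra.
    assert (0 <= (E + E * Cmod c) * Cmod h ^ 2) by (apply Rmult_le_pos; lra). lra.
Qed.

(** The [N]-point Riemann sum for the integral of [F] from [y] to [y + 1]. *)
Definition avg (N : nat) (F : C -> C) (y : C) : C :=
  (/ INR N * csum (fun r => F (RtoC (INR r / INR N) + y)%C) N)%C.

Lemma RtoC_INR_neq0 N : (0 < N)%nat -> RtoC (INR N) <> 0%C.
Proof. intros H E. apply RtoC_inj in E. apply lt_0_INR in H. lra. Qed.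

Lemma avg_bound N F y B : (0 < N)%nat ->
  (forall r, (r < N)%nat -> Cmod (F (RtoC (INR r / INR N) + y)%C) <= B) ->
  Cmod (avg N F y) <= B.
Proof.
  intros HN H. unfold avg. assert (N0 : 0 < INR N) by now apply lt_0_INR.
  rewrite Cmod_mult, Cmod_inv, Cmod_R, Rabs_pos_eq by (try apply RtoC_INR_neq0; auto; lra).
  apply Rle_trans with (/ INR N * (INR N * B)).
  - apply Rmult_le_compat_l. left; now apply Rinv_0_lt_compat. now apply csum_bound.
  - rewrite <- Rmult_assoc, Rinv_l by lra. lra.
Qed.

Lemma frac_bound r N : (r <= N)%nat -> (0 < N)%nat -> 0 <= INR r / INR N <= 1.
Proof.
  intros H HN. assert (N0 : 0 < INR N) by now apply lt_0_INR.
  apply le_INR in H. pose proof (pos_INR r). split.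
  - apply Rmult_le_pos; [lra|]. left; now apply Rinv_0_lt_compat.
  - apply Rmult_le_reg_r with (INR N); auto. unfold Rdiv.
    rewrite Rmult_assoc, Rinv_l by lra. lra.
Qed.

(* Discrete Cauchy theorem: moving the averaging segment by [w / N], [N]
   times, changes the average by [O(1 / N^2)] each time, because to first order
   the increment is [w] times a telescoping sum over a period. *)
Lemma avg_shift F w : taylor1_bound F -> (forall z, F (z + 1)%C = F z) ->
  exists B, forall N, (0 < N)%nat -> Cmod (avg N F w - avg N F 0)%C <= B / INR N.
Proof.
  intros HF Hper.
  pose proof (Cmod_ge_0 w) as w0.
  destruct (HF (Cmod w + 1) ltac:(lra)) as [B [HB Hb]].
  exists (B * (Cmod w ^ 2 + Cmod w)). intros N HN.
  assert (N0 : 0 < INR N) by now apply lt_0_INR.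
  assert (N1 : 1 <= INR N) by (apply (le_INR 1); lia).
  assert (Ni : 0 < / INR N <= 1).
  { split. now apply Rinv_0_lt_compat. rewrite <- Rinv_1. apply Rinv_le_contravar; lra. }
  set (h := / INR N) in *.
  set (y := fun k : nat => (w * RtoC (INR k / INR N))%C).
  replace (avg N F w - avg N F 0)%C with (csum (fun k => avg N F (y (S k)) - avg N F (y k))%C N).
  2:{ rewrite (csum_telescope (fun k => avg N F (y k))). unfold y. f_equal; [|f_equal]; f_equal.
      - replace (INR N / INR N) with 1 by (field; lra). ring.
      - simpl INR. replace (0 / INR N) with 0 by (field; lra). ring. }
  replace (B * (Cmod w ^ 2 + Cmod w) / INR N) with (INR N * (B * (Cmod w ^ 2 + Cmod w) * h ^ 2))
    by (unfold h; field; lra).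
  apply csum_bound. intros k Hk.
  assert (yk : y (S k) = (y k + w * h)%C).
  { unfold y. rewrite S_INR. unfold Rdiv. rewrite Rmult_plus_distr_r, RtoC_plus, Rmult_1_l. fold h. ring. }
  pose proof (frac_bound k N ltac:(lia) HN) as kN.
  assert (ybound : Cmod (y k) <= Cmod w).
  { unfold y. rewrite Cmod_mult, Cmod_R, Rabs_pos_eq by lra. nra. }
  assert (D : (avg N F (y (S k)) - avg N F (y k))%C =
     (h * csum (fun r => (F (RtoC (INR r / INR N) + y k + w * h) - F (RtoC (INR r / INR N) + y k)) -
          w * (F (RtoC (INR (S r) / INR N) + y k) - F (RtoC (INR r / INR N) + y k)))%C N)%C).
  { transitivity (h * csum (fun r => (F (RtoC (INR r / INR N) + y k + w * h) - F (RtoC (INR r / INR N) + y k)))%C N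
        + (- h * w) * csum (fun r => (F (RtoC (INR (S r) / INR N) + y k) - F (RtoC (INR r / INR N) + y k)))%C N)%C.
    - rewrite (csum_telescope (fun r => F (RtoC (INR r / INR N) + y k)%C)).
      replace (RtoC (INR N / INR N) + y k)%C with (RtoC (INR 0 / INR N) + y k + 1)%C.
      2:{ simpl INR. replace (INR N / INR N) with 1 by (field; lra).
          replace (0 / INR N) with 0 by (field; lra). ring. }
      rewrite Hper. unfold avg. rewrite yk.
      assert (Hh : RtoC h = (/ INR N)%C) by (unfold h; apply RtoC_inv; lra). rewrite <- Hh.
      transitivity (h * (csum (fun r => F (RtoC (INR r / INR N) + (y k + w * h))%C) N
         + (- (1)) * csum (fun r => F (RtoC (INR r / INR N) + y k)%C) N))%C; [ring|].
      rewrite <- csum_scal, <- csum_plus.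
      transitivity (h * csum (fun r => F (RtoC (INR r / INR N) + y k + w * h) - F (RtoC (INR r / INR N) + y k))%C N)%C; [|ring].
      f_equal. apply csum_ext. intros r _. rewrite Cplus_assoc. ring.
    - rewrite <- !csum_scal, <- csum_plus. apply csum_ext. intros; ring. }
  rewrite D, Cmod_mult, Cmod_R, Rabs_pos_eq by lra.
  replace (B * (Cmod w ^ 2 + Cmod w) * h ^ 2) with (h * (INR N * (B * (Cmod w ^ 2 + Cmod w) * h ^ 2)))
    by (unfold h; field; lra).
  apply Rmult_le_compat_l; [lra|]. apply csum_bound. intros r Hr.
  set (z := (RtoC (INR r / INR N) + y k)%C).
  pose proof (frac_bound r N ltac:(lia) HN) as rN.
  assert (z1 : Rabs (Re z) <= Cmod w + 1).
  { unfold z. simpl Re. eapply Rle_trans. apply Rabs_triang. rewrite Rabs_pos_eq by apply rN.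
    generalize (re_le_Cmod (y k)). simpl. unfold Re. lra. }
  assert (z2 : Rabs (Im z) <= Cmod w + 1).
  { unfold z. simpl Im. rewrite Rplus_0_l. generalize (Im_le_Cmod (y k)). simpl. unfold Im. lra. }
  destruct (Hb z z1 z2) as [d [_ [_ Hd]]].
  assert (E1 := Hd (w * h)%C). assert (E2 := Hd (RtoC h)).
  rewrite Cmod_mult, Cmod_R, Rabs_pos_eq in E1 by lra. rewrite Cmod_R, Rabs_pos_eq in E2 by lra.
  specialize (E1 ltac:(nra)). specialize (E2 ltac:(lra)).
  replace (RtoC (INR (S r) / INR N) + y k)%C with (z + h)%C.
  2:{ unfold z, h. rewrite S_INR. unfold Rdiv. rewrite Rmult_plus_distr_r, RtoC_plus, Rmult_1_l. ring. }
  (* The derivative [d] cancels, and two quadratic remainders are left. *)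
  replace (F (z + w * h) - F z - w * (F (z + h) - F z))%C with
    ((F (z + w * h) - F z - d * (w * h)) + - (w * (F (z + h) - F z - d * h)))%C by ring.
  eapply Rle_trans. apply Cmod_triangle. rewrite Cmod_opp, Cmod_mult.
  apply Rmult_le_compat_l with (r := Cmod w) in E2; auto. nra.
Qed.

(** * Discrete Fourier coefficients *)

Definition character (x : Z) (z : C) : C := Cexp (2 * PI * Ci * IZR x * z)%C.

Definition fcoef (g : C -> C) (N : nat) (m : Z) : C :=
  avg N (fun z => g z * character (- m) z)%C 0.

Lemma character_plus m z w : character m (z + w) = (character m z * character m w)%C.
Proof. unfold character. rewrite <- Cexp_plus. f_equal. ring. Qed.

Lemma character_plus_l m n z : character (m + n) z = (character m z * character n z)%C.
Proof. unfold character. rewrite <- Cexp_plus, plus_IZR, RtoC_plus. f_equal. ring. Qed.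

Lemma character_Z m n : character m (IZR n) = 1%C.
Proof.
  unfold character. rewrite <- (Cexp_2PIi_Z (m * n)), mult_IZR, RtoC_mult. f_equal. ring.
Qed.

Lemma character_1 m : character m 1 = 1%C.
Proof. exact (character_Z m 1). Qed.

Lemma character_0_l z : character 0 z = 1%C.
Proof. unfold character. rewrite <- Cexp_0. f_equal. ring. Qed.

Lemma character_0_r m : character m 0 = 1%C.
Proof. unfold character. rewrite <- Cexp_0. f_equal. ring. Qed.

Lemma Cmod_character m (x : R) : Cmod (character m x) = 1.
Proof.
  unfold character. rewrite Cmod_Cexp. rewrite <- exp_0. f_equal. simpl. ring.
Qed.

Lemma csum_cyclic (F : nat -> C) N : F N = F O -> csum (fun r => F (S r)) N = csum F N.
Proof.
  intros H.
  assert (E : (F O + csum (fun r => F (S r)) N = csum F N + F N)%C) by exact (eq_sym (csum_S_l F N)).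
  rewrite H in E. apply (f_equal (fun z => z - F O)%C) in E.
  transitivity (F 0%nat + csum (fun r : nat => F (S r)) N - F 0%nat)%C; [ring|]. rewrite E. ring.
Qed.

Lemma csum_window (f : Z -> C) a b :
  csum (fun k => f (Z.of_nat k - Z.of_nat a)%Z) (a + b) =
  (csum (fun n => f (- Z.of_nat n - 1)%Z) a + csum (fun n => f (Z.of_nat n)) b)%C.
Proof.
  revert b. induction a as [|a IH]; intros b.
  - simpl. replace (csum (fun n => f (Z.of_nat n)) b) with (0 + csum (fun n => f (Z.of_nat n)) b)%C at 1 by ring.
    rewrite Cplus_0_l. rewrite Cplus_0_l. apply csum_ext. intros. f_equal. lia.
  - rewrite Nat.add_succ_l, csum_S_l. cbn [csum].
    rewrite (csum_ext _ (fun k => f (Z.of_nat k - Z.of_nat a)%Z)) by (intros; f_equal; lia).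
    rewrite IH. replace (Z.of_nat 0 - Z.of_nat (S a))%Z with (- Z.of_nat a - 1)%Z by lia. ring.
Qed.

Lemma csum_window_zfold (f : Z -> C) M :
  csum (fun k => f (Z.of_nat k - Z.of_nat M)%Z) (2 * M) = csum (zfold f) M.
Proof.
  replace (2 * M)%nat with (M + M)%nat by lia. rewrite csum_window. unfold zfold.
  rewrite csum_plus. ring.
Qed.

(** Orthogonality of characters: the frequencies from [- M] to [M - 1] represent all residues modulo
    [2 M]. The number of points is even so that this is the window of [zfold] and 1/2 is a sample
    point. *)
Lemma fcoef_inversion g M r0 : (r0 < 2 * M)%nat ->
  g (RtoC (INR r0 / INR (2 * M))) =
  csum (zfold (fun m => fcoef g (2 * M) m * character m (RtoC (INR r0 / INR (2 * M))))%C) M.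
Proof.
  intros H. set (N := (2 * M)%nat) in *.
  assert (HN : (0 < N)%nat) by lia.
  assert (N0 : 0 < INR N) by now apply lt_0_INR.
  pose proof (RtoC_INR_neq0 N HN) as Nn.
  rewrite <- csum_window_zfold. fold N.
  set (x := fun r : nat => RtoC (INR r / INR N)).
  rewrite (csum_ext _ (fun k => csum (fun r => / INR N * g (x r) *
     (character (Z.of_nat k - Z.of_nat M) (x r0 - x r)))%C N)).
  2:{ intros k _. unfold fcoef, avg. rewrite <- csum_scal.
      rewrite Cmult_comm, <- csum_scal. apply csum_ext. intros r _. rewrite Cplus_0_r.
      fold (x r) (x r0).
      replace (character (Z.of_nat k - Z.of_nat M) (x r0 - x r)) with
        (character (- (Z.of_nat k - Z.of_nat M)) (x r) * character (Z.of_nat k - Z.of_nat M) (x r0))%C.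
      ring. unfold character. rewrite <- Cexp_plus. f_equal. rewrite opp_IZR, RtoC_opp. ring. }
  rewrite csum_swap. rewrite (csum_single _ N r0); [|assumption|].
  - rewrite (csum_ext _ (fun k => / INR N * g (x r0) * 1)%C).
    2:{ intros. f_equal. rewrite <- (character_0_r (Z.of_nat k - Z.of_nat M)). f_equal. ring. }
    rewrite csum_scal.
    assert (E : forall n, csum (fun _ => 1%C) n = RtoC (INR n)).
    { induction n as [|n IH]; [reflexivity|]. cbn [csum]. rewrite IH, S_INR, RtoC_plus. reflexivity. }
    rewrite E. unfold x. field. assumption.
  - intros r Hr Hrr. rewrite csum_scal.
    set (t := (x r0 - x r)%C).
    (* The ratio of the geometric progression is not 1, since two distinct sample indices differ by
       less than [N]. *)
    assert (Hrho : character 1 t <> 1%C).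
    { unfold character, t, x.
      replace (2 * PI * Ci * 1 * (RtoC (INR r0 / INR N) - RtoC (INR r / INR N)))%C with
        (2 * PI * Ci * RtoC ((INR r0 - INR r) / INR N))%C.
      2:{ unfold Rdiv. rewrite !RtoC_mult, RtoC_minus. ring. }
      intros E. apply Cexp_2PIi_eq1 in E. destruct E as [n En].
      assert (E : INR r0 - INR r = IZR n * INR N) by (rewrite <- En; field; lra).
      rewrite !INR_IZR_INZ, <- mult_IZR, <- minus_IZR in E. apply eq_IZR in E. clearbody N.
      destruct (Z.lt_trichotomy n 0) as [h|[h|h]]; [nia|subst n; lia|nia]. }
    (* Multiplied by the ratio minus 1, the geometric sum telescopes over a full period to 0. *)
    assert (Z0 : csum (fun k => character (Z.of_nat k - Z.of_nat M) t) N = 0%C).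
    { assert (T : ((character 1 t - 1) * csum (fun k => character (Z.of_nat k - Z.of_nat M) t) N = 0)%C).
      { rewrite <- csum_scal.
        rewrite (csum_ext _ (fun k => character (Z.of_nat (S k) - Z.of_nat M) t - character (Z.of_nat k - Z.of_nat M) t)%C).
        - rewrite (csum_telescope (fun k => character (Z.of_nat k - Z.of_nat M) t)).
          replace (Z.of_nat N - Z.of_nat M)%Z with (Z.of_nat N + (Z.of_nat 0 - Z.of_nat M))%Z by lia.
          rewrite character_plus_l.
          replace (character (Z.of_nat N) t) with (character 1 (IZR (Z.of_nat r0 - Z.of_nat r))).
          rewrite character_Z. ring.
          unfold character, t, x. f_equal. rewrite minus_IZR, <- !INR_IZR_INZ.
          unfold Rdiv. rewrite RtoC_minus, !RtoC_mult, RtoC_inv by lra. field. assumption.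
        - intros k _. replace (Z.of_nat (S k) - Z.of_nat M)%Z with (1 + (Z.of_nat k - Z.of_nat M))%Z by lia.
          rewrite character_plus_l. ring. }
      apply Cmult_integral in T. destruct T as [T|T]; [|assumption].
      exfalso. apply Hrho. replace (character 1 t) with (character 1 t - 1 + 1)%C by ring. rewrite T. ring. }
    rewrite Z0. ring.
Qed.

(** Follows from [sin x >= x - x^3 / 6]. The range up to 2 covers [pi m / N] for [|m| <= N / 2]. *)
Lemma sin_ge_quarter (x : R) : 0 <= x <= 2 -> x / 4 <= sin x.
Proof.
  intros [H1 H2].
  generalize (pre_sin_bound x 0). simpl. unfold sin_approx; simpl.
  unfold sin_term; simpl. intros Q. destruct Q as [Q _]; try lra.
  replace (-1 * 1 * (x * (x * (x * 1)) / (6))) with (- x ^ 3 / 6) in Q by field.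
  assert (x ^ 2 <= 2 ^ 2) by (apply pow_incr; lra). nra.
Qed.

Lemma sqr_sin_ge (x : R) : Rabs x <= 2 -> (x / 4) ^ 2 <= sin x ^ 2.
Proof.
  intros H. destruct (Rle_dec 0 x).
  - rewrite Rabs_pos_eq in H by lra. apply pow_incr. split; [lra|]. apply sin_ge_quarter; lra.
  - rewrite Rabs_left in H by lra. replace (x / 4) with (- (- x / 4)) by field.
    replace (sin x) with (- sin (- x)) by (rewrite sin_neg; ring).
    replace ((- (- x / 4)) ^ 2) with ((- x / 4) ^ 2) by ring.
    replace ((- sin (- x)) ^ 2) with (sin (- x) ^ 2) by ring.
    apply pow_incr. split; [lra|]. apply sin_ge_quarter; lra.
Qed.

Lemma character_second_difference m (x : R) :
  (character m x - 2 + character (- m) x)%C = RtoC (- 4 * sin (PI * IZR m * x) ^ 2).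
Proof.
  unfold character, Cexp.
  assert (E1 : Re (2 * PI * Ci * IZR m * x)%C = 0) by (simpl; ring).
  assert (E2 : Im (2 * PI * Ci * IZR m * x)%C = 2 * (PI * IZR m * x)) by (simpl; ring).
  assert (E3 : Re (2 * PI * Ci * IZR (- m) * x)%C = 0) by (simpl; ring).
  assert (E4 : Im (2 * PI * Ci * IZR (- m) * x)%C = - (2 * (PI * IZR m * x)))
    by (rewrite opp_IZR; simpl; ring).
  rewrite E1, E2, E3, E4, cos_neg, sin_neg, exp_0, cos_2a_sin.
  apply C_ext; simpl; ring.
Qed.

(* Summation by parts twice: the coefficients of the second difference of [g]
   are those of [g] multiplied by [- 4 sin^2 (pi m / N)]. *)
Lemma fcoef_second_difference g N m : (0 < N)%nat -> (forall z, g (z + 1)%C = g z) ->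
  (RtoC (- 4 * sin (PI * IZR m * / INR N) ^ 2) * fcoef g N m)%C =
  avg N (fun z => (g (z + RtoC (/ INR N)) - 2 * g z + g (z - RtoC (/ INR N))) * character (- m) z)%C 0.
Proof.
  intros HN Hper. assert (N0 : 0 < INR N) by now apply lt_0_INR.
  set (h := / INR N).
  rewrite <- character_second_difference. unfold fcoef, avg.
  set (x := fun r : nat => RtoC (INR r / INR N)).
  assert (xS : forall r, x (S r) = (x r + h)%C).
  { intros r. unfold x, h. rewrite S_INR. unfold Rdiv. rewrite Rmult_plus_distr_r, RtoC_plus, Rmult_1_l. reflexivity. }
  assert (x0 : x O = 0%C) by (unfold x; simpl; f_equal; field; lra).
  assert (xN : x N = 1%C) by (unfold x; f_equal; field; lra).
  rewrite (csum_ext _ (fun r => g (x r) * character (- m) (x r))%C) by (intros; now rewrite Cplus_0_r).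
  rewrite (csum_ext (fun r => (g _ - _ + _) * _)%C
     (fun r => g (x (S r)) * (character (- m) (x (S r)) * character m h) +
        (- (2) * (g (x r) * character (- m) (x r)) + g (x r - h) * character (- m) (x r - h) * character (- m) h))%C).
  2:{ intros r _. rewrite Cplus_0_r. fold (x r). rewrite xS.
      replace (character (- m) (x r)) with (character (- m) (x r - h) * character (- m) h)%C at 3
        by (rewrite <- character_plus; f_equal; ring).
      replace (character (- m) (x r + h) * character m h)%C with (character (- m) (x r)).
      2:{ rewrite character_plus, <- Cmult_assoc, <- character_plus_l.
          replace (- m + m)%Z with 0%Z by lia. rewrite character_0_l. ring. }
      replace (character (- m) (x r)) with (character (- m) (x r - h) * character (- m) h)%C
        by (rewrite <- character_plus; f_equal; ring). ring. }
  rewrite !csum_plus, csum_scal.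
  set (G := fun r => (g (x r) * character (- m) (x r))%C).
  assert (G0 : csum (fun r => G (S r)) N = csum G N).
  { apply csum_cyclic. unfold G. rewrite x0, xN.
    replace (RtoC 1) with (0 + 1)%C at 1 by ring. rewrite Hper, character_1, character_0_r. reflexivity. }
  set (G' := fun r => (g (x r - h) * character (- m) (x r - h))%C).
  assert (G1 : csum (fun r => G' (S r)) N = csum G' N).
  { apply csum_cyclic. unfold G'. rewrite x0, xN.
    replace (1 - h)%C with (0 - h + 1)%C by ring. rewrite Hper, character_plus, character_1. ring. }
  rewrite (csum_ext (fun r => g (x (S r)) * _)%C (fun r => character m h * G (S r))%C) by (intros; unfold G; ring).
  rewrite (csum_ext (fun r => g (x r - h) * _ * _)%C (fun r => character (- m) h * G' r)%C) by (intros; unfold G'; ring).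
  rewrite !csum_scal, G0, <- G1.
  rewrite (csum_ext (fun r => G' (S r)) G).
  2:{ intros r _. unfold G, G'. rewrite xS. replace (x r + h - h)%C with (x r) by ring. reflexivity. }
  fold G. ring.
Qed.

(** A second difference of step [1 / N] is [O(1 / N^2)], while [4 sin^2 (pi m / N)] is at least of
    order [m^2 / N^2] in this range of [m]. The resulting bound is uniform in [N], which is what
    dominated convergence requires. *)
Lemma fcoef_tail g : taylor1_bound g -> (forall z, g (z + 1)%C = g z) ->
  exists B, forall N m, (0 < N)%nat -> m <> 0%Z -> (2 * Z.abs m <= Z.of_nat N)%Z ->
    Cmod (fcoef g N m) <= B / IZR m ^ 2.
Proof.
  intros Hg Hper. destruct (Hg 1 ltac:(lra)) as [B [HB Hb]].
  exists (2 * B). intros N m HN Hm HmN.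
  assert (N0 : 0 < INR N) by now apply lt_0_INR.
  assert (N1 : 1 <= INR N) by (apply (le_INR 1); lia).
  set (h := / INR N).
  assert (Ni : 0 < h <= 1).
  { unfold h. split. now apply Rinv_0_lt_compat. rewrite <- Rinv_1. apply Rinv_le_contravar; lra. }
  assert (E := fcoef_second_difference g N m HN Hper). fold h in E.
  apply (f_equal Cmod) in E. rewrite Cmod_mult, Cmod_R in E.
  assert (U : Cmod (avg N (fun z => (g (z + h) - 2 * g z + g (z - h)) * character (- m) z)%C 0) <= 2 * B * h ^ 2).
  { apply avg_bound; auto. intros r Hr.
    rewrite Cplus_0_r. rewrite Cmod_mult, Cmod_character, Rmult_1_r.
    pose proof (frac_bound r N ltac:(lia) HN) as rN.
    set (z := RtoC (INR r / INR N)).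
    destruct (Hb z) as [d [_ [_ Hd]]].
    { unfold z; simpl. rewrite Rabs_pos_eq; lra. } { unfold z; simpl. rewrite Rabs_R0; lra. }
    assert (E1 := Hd (RtoC h)). assert (E2 := Hd (- RtoC h)%C).
    rewrite Cmod_opp in E2. rewrite Cmod_R, Rabs_pos_eq in E1, E2 by lra.
    specialize (E1 ltac:(lra)). specialize (E2 ltac:(lra)).
    replace (g (z + h) - 2 * g z + g (z - h))%C with
      ((g (z + h) - g z - d * h) + (g (z + - h) - g z - d * - h))%C by (unfold Cminus; ring).
    eapply Rle_trans. apply Cmod_triangle. lra. }
  rewrite <- E in U. clear E.
  set (s := PI * IZR m * h) in *.
  assert (Pi : 3 < PI <= 4) by (generalize PI2_3_2 PI_4; lra).
  assert (m2 : 1 <= IZR m ^ 2).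
  { replace (IZR m ^ 2) with (IZR (m * m)) by (rewrite mult_IZR; ring). apply IZR_le. nia. }
  assert (sb : Rabs s <= 2).
  { unfold s. rewrite !Rabs_mult, (Rabs_pos_eq PI), (Rabs_pos_eq h) by lra. rewrite <- abs_IZR.
    apply IZR_le in HmN. rewrite mult_IZR, <- INR_IZR_INZ in HmN.
    assert (IZR (Z.abs m) * h <= / 2).
    { apply Rmult_le_reg_r with (INR N); auto. unfold h. rewrite Rmult_assoc, Rinv_l by lra. lra. }
    assert (0 <= IZR (Z.abs m)) by (apply IZR_le; lia). nra. }
  apply sqr_sin_ge in sb.
  assert (s2 : 9 / 16 * (IZR m ^ 2 * h ^ 2) <= (s / 4) ^ 2).
  { unfold s. replace ((PI * IZR m * h / 4) ^ 2) with (PI ^ 2 / 16 * (IZR m ^ 2 * h ^ 2)) by field.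
    apply Rmult_le_compat_r; [|nra]. apply Rmult_le_pos; nra. }
  assert (h2 : 0 < h ^ 2) by nra.
  rewrite Rabs_left1 in U by nra.
  pose proof (Cmod_ge_0 (fcoef g N m)) as f0.
  assert (V : IZR m ^ 2 * h ^ 2 * Cmod (fcoef g N m) <= 2 * B * h ^ 2).
  { eapply Rle_trans; [|exact U]. apply Rmult_le_compat_r; auto.
    assert (0 <= IZR m ^ 2 * h ^ 2) by (apply Rmult_le_pos; lra). lra. }
  apply Rmult_le_reg_r with (IZR m ^ 2 * h ^ 2); [nra|].
  unfold Rdiv. replace (2 * B * / IZR m ^ 2 * (IZR m ^ 2 * h ^ 2)) with (2 * B * h ^ 2) by (field; nra).
  lra.
Qed.

(** * Quasi-periodic functions *)

Lemma clim_csum_0 (a : nat -> nat -> C) n :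
  (forall k, clim (fun M => a M k) 0) -> clim (fun M => csum (a M) n) 0.
Proof.
  intros H. induction n as [|n IH]; [exact (clim_const 0)|].
  cbn [csum]. replace (RtoC 0) with (0 + 0)%C by ring. now apply clim_plus.
Qed.

Lemma csum_split (f : nat -> C) a b :
  csum f (a + b) = (csum f a + csum (fun k => f (a + k)%nat) b)%C.
Proof.
  induction b as [|b IH]; [rewrite Nat.add_0_r; simpl; ring|].
  rewrite Nat.add_succ_r. cbn [csum]. rewrite IH. ring.
Qed.

(** Comparison with a telescoping sum, by [1 / l^2 <= 2 (1 / l - 1 / (l + 1))] for [l >= 1]. *)
Lemma csum_inv_sqr_tail (f : nat -> C) B L n : 0 <= B -> (0 < L)%nat ->
  (forall k, (k < n)%nat -> Cmod (f (L + k)%nat) <= B / INR (L + k) ^ 2) ->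
  Cmod (csum (fun k => f (L + k)%nat) n) <= 2 * B / INR L.
Proof.
  intros HB HL H.
  assert (L0 : 1 <= INR L) by (apply (le_INR 1); lia).
  enough (G : Cmod (csum (fun k => f (L + k)%nat) n) <= 2 * B * (/ INR L - / INR (L + n))).
  { eapply Rle_trans; [apply G|]. unfold Rdiv. apply Rmult_le_compat_l; [lra|].
    assert (0 < / INR (L + n)) by (apply Rinv_0_lt_compat, lt_0_INR; lia). lra. }
  induction n as [|n IH].
  - simpl. rewrite Cmod_0, Nat.add_0_r. lra.
  - cbn [csum]. eapply Rle_trans. apply Cmod_triangle.
    specialize (IH ltac:(intros; apply H; lia)). specialize (H n ltac:(lia)).
    replace (L + S n)%nat with (S (L + n)) by lia. rewrite S_INR.
    assert (l0 : 1 <= INR (L + n)) by (apply (le_INR 1); lia).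
    set (l := INR (L + n)) in *.
    assert (B / l ^ 2 <= 2 * B * (/ l - / (l + 1))).
    { apply Rminus_le_0.
      replace (2 * B * (/ l - / (l + 1)) - B / l ^ 2) with (B * ((l - 1) / (l ^ 2 * (l + 1)))) by (field; lra).
      apply Rmult_le_pos; auto. apply Rmult_le_pos; [lra|]. left. apply Rinv_0_lt_compat. nra. }
    lra.
Qed.

(** Dominated convergence when the number of terms grows with [M]. The term [k = 0], where the
    majorant makes no sense, is covered by pointwise convergence. *)
Lemma tannery (a : nat -> nat -> C) B : 0 <= B ->
  (forall k, clim (fun M => a M k) 0) ->
  (forall M k, (0 < k < M)%nat -> Cmod (a M k) <= B / INR k ^ 2) ->
  clim (fun M => csum (a M) M) 0.
Proof.
  intros HB H0 Hb eps He.
  destruct (INR_unbounded (4 * B / eps)) as [L HL].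
  set (L' := S L).
  destruct (clim_csum_0 a L' H0 (eps / 2) ltac:(lra)) as [N HN].
  exists (N + L')%nat. intros M HM.
  replace (csum (a M) M - 0)%C with (csum (a M) M) by ring.
  replace M with (L' + (M - L'))%nat at 2 by lia. rewrite csum_split.
  eapply Rle_lt_trans. apply Cmod_triangle.
  specialize (HN M ltac:(lia)). replace (csum (a M) L' - 0)%C with (csum (a M) L') in HN by ring.
  assert (T := csum_inv_sqr_tail (a M) B L' (M - L') HB ltac:(unfold L'; lia)).
  specialize (T ltac:(intros; apply Hb; lia)).
  assert (2 * B / INR L' <= eps / 2).
  { assert (L1 : 0 < INR L') by (apply lt_0_INR; unfold L'; lia).
    assert (INR L <= INR L') by (apply le_INR; unfold L'; lia).
    apply Rmult_le_reg_r with (INR L'); auto. unfold Rdiv at 1. rewrite Rmult_assoc, Rinv_l by lra.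
    assert (4 * B / eps * eps < INR L' * eps) by (apply Rmult_lt_compat_r; lra).
    replace (4 * B / eps * eps) with (4 * B) in H1 by (field; lra). lra. }
  lra.
Qed.

Lemma clim_0_mult_bounded s t B : (forall n, Cmod (s n) <= B) -> clim t 0 -> clim (fun n => s n * t n)%C 0.
Proof.
  intros Hs Ht. apply clim_0_le with (fun n => RtoC B * t n)%C.
  - intros n. rewrite !Cmod_mult, Cmod_R. apply Rmult_le_compat_r; [apply Cmod_ge_0|].
    specialize (Hs n). pose proof (Cmod_ge_0 (s n)). rewrite Rabs_pos_eq; lra.
  - replace (RtoC 0) with (RtoC B * 0)%C by ring. now apply clim_scal.
Qed.

Section Quasi_periodic.
Variables (g : C -> C) (s : C).
Hypothesis g_taylor1 : taylor1_bound g.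
Hypothesis g_per : forall z, g (z + 1)%C = g z.
Hypothesis g_quasi : forall z, g (z + s)%C = (Cexp (- (PI * Ci * s) - 2 * PI * Ci * z) * g z)%C.
Hypothesis s_upper : 0 < Im s.

Let q (m : Z) : C := Cexp (PI * Ci * IZR m ^ 2 * s)%C.

Lemma character_per m z : character m (z + 1) = character m z.
Proof. rewrite character_plus, character_1. ring. Qed.

Lemma taylor1_bound_twist m : taylor1_bound (fun z => g z * character m z)%C.
Proof. apply taylor1_bound_mult; [exact g_taylor1 | apply taylor1_bound_Cexp]. Qed.

(** By quasi-periodicity, moving the averaging segment by [s] turns the [m]-th coefficient into a
    multiple of the next one; by [avg_shift] the move costs only [O(1 / N)]. *)
Lemma fcoef_shift m :
  clim (fun N => fcoef g N (m + 1) - Cexp (PI * Ci * (2 * IZR m + 1) * s) * fcoef g N m)%C 0.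
Proof.
  set (c := Cexp (PI * Ci * (2 * IZR m + 1) * s)%C).
  destruct (avg_shift (fun z => g z * character (- m) z)%C s (taylor1_bound_twist (- m))) as [B HB].
  { intros z. now rewrite g_per, character_per. }
  apply clim_0_inv_n with (Cmod c * B). intros N HN.
  specialize (HB N HN).
  assert (E : avg N (fun z => g z * character (- m) z)%C s =
    (Cexp (- (PI * Ci * (2 * IZR m + 1) * s)) * fcoef g N (m + 1))%C).
  { unfold fcoef, avg. set (e := Cexp (- (PI * Ci * (2 * IZR m + 1) * s))%C).
    rewrite Cmult_assoc, (Cmult_comm e), <- Cmult_assoc. f_equal. rewrite <- csum_scal. apply csum_ext. intros r _. rewrite Cplus_0_r. unfold e.
    set (x := RtoC (INR r / INR N)). rewrite g_quasi.
    transitivity (g x * (Cexp (- (PI * Ci * s) - 2 * PI * Ci * x) * character (- m) (x + s)))%C; [ring|].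
    transitivity (g x * (Cexp (- (PI * Ci * (2 * IZR m + 1) * s)) * character (- (m + 1)) x))%C; [|ring].
    f_equal. unfold character. rewrite <- !Cexp_plus. f_equal.
    rewrite !opp_IZR, plus_IZR, RtoC_opp, RtoC_opp, RtoC_plus. ring. }
  rewrite E in HB. fold (fcoef g N m) in HB.
  replace (fcoef g N (m + 1) - c * fcoef g N m)%C with
    (c * (Cexp (- (PI * Ci * (2 * IZR m + 1) * s)) * fcoef g N (m + 1) - fcoef g N m))%C.
  - rewrite Cmod_mult. unfold Rdiv. rewrite Rmult_assoc. apply Rmult_le_compat_l; [apply Cmod_ge_0|exact HB].
  - transitivity ((Cexp (- (PI * Ci * (2 * IZR m + 1) * s)) * c) * fcoef g N (m + 1) - c * fcoef g N m)%C; [ring|].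
    unfold c. rewrite Cexp_opp. ring.
Qed.

Lemma gauss_weight_succ m : q (m + 1) = (Cexp (PI * Ci * (2 * IZR m + 1) * s) * q m)%C.
Proof. unfold q. rewrite <- Cexp_plus. f_equal. rewrite plus_IZR, RtoC_plus. ring. Qed.

(** Iterates [fcoef_shift] from 0 in both directions; downwards the exponential factor is
    inverted. *)
Lemma fcoef_gauss m : clim (fun N => fcoef g N m - q m * fcoef g N 0)%C 0.
Proof.
  pattern m. apply Z.bi_induction.
  - intros x y ->. reflexivity.
  - apply clim_ext with (fun _ => 0%C); [|apply clim_const].
    intros n. unfold q. replace (PI * Ci * IZR 0 ^ 2 * s)%C with (RtoC 0) by ring. rewrite Cexp_0. ring.
  - intros k. replace (Z.succ k) with (k + 1)%Z by lia. pose proof (fcoef_shift k) as Hk.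
    set (c := Cexp (PI * Ci * (2 * IZR k + 1) * s)%C) in *. split; intros H.
    + replace (RtoC 0) with (0 + c * 0)%C by ring.
      eapply clim_ext; [|apply clim_plus; [exact Hk|apply clim_scal, H]].
      intros n. cbv beta. rewrite gauss_weight_succ. fold c. ring.
    + set (d := Cexp (- (PI * Ci * (2 * IZR k + 1) * s))%C).
      assert (dc : (d * c = 1)%C) by apply Cexp_opp.
      replace (RtoC 0) with (d * (0 + (- (1)) * 0))%C by ring.
      eapply clim_ext; [|apply clim_scal; apply clim_plus; [exact H|apply clim_scal, Hk]].
      intros n. cbv beta. rewrite gauss_weight_succ. fold c.
      transitivity ((d * c) * fcoef g n k - (d * c) * q k * fcoef g n 0)%C; [ring|]. rewrite dc. ring.
Qed.

Lemma Cmod_gauss_weight m : Cmod (q m) = exp (- (PI * Im s) * IZR m ^ 2).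
Proof.
  unfold q. rewrite Cmod_Cexp. f_equal.
  replace (PI * Ci * IZR m ^ 2 * s)%C with (RtoC (PI * IZR m ^ 2) * Ci * s)%C
    by (rewrite RtoC_mult, RtoC_pow; ring).
  unfold Re, Im; simpl. ring.
Qed.

Lemma zdom_gauss_weight (x : R) : exists K, zdom (fun m => q m * character m x)%C K.
Proof.
  assert (Ha : 0 < PI * Im s) by (apply Rmult_lt_0_compat; [apply PI_RGT_0|assumption]).
  destruct (gauss_majorant (PI * Im s) 0 0 Ha) as [K [HK HM]].
  exists K. intros m. rewrite Cmod_mult, Cmod_character, Rmult_1_r, Cmod_gauss_weight.
  eapply Rle_trans; [|apply HM]. apply exp_le_compat. lra.
Qed.

Lemma fcoef_0_bound : exists B, 0 <= B /\ forall N, (0 < N)%nat -> Cmod (fcoef g N 0) <= B.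
Proof.
  destruct (g_taylor1 1 ltac:(lra)) as [B [HB Hb]]. exists B. split; auto. intros N HN.
  apply avg_bound; auto. intros r Hr. rewrite Cplus_0_r. simpl Z.opp. rewrite character_0_l, Cmult_1_r.
  pose proof (frac_bound r N ltac:(lia) HN) as rN.
  destruct (Hb (RtoC (INR r / INR N))) as [d [Hd _]]; simpl; auto.
  rewrite Rabs_pos_eq; lra. rewrite Rabs_R0; lra.
Qed.

(** Inserts the asymptotics of the coefficients into the exact inversion formula, so [x] must be a
    sample point for every [2 M]. The coefficient of index 0 stays in the statement because its
    convergence is not known. *)
Lemma value_gauss (x : R) (r : nat -> nat) :
  (forall M, (0 < M)%nat -> (r M < 2 * M)%nat /\ x = INR (r M) / INR (2 * M)) ->
  clim (fun M => g x - zsum (fun m => q m * character m x) * fcoef g (2 * M) 0)%C 0.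
Proof.
  intros Hr.
  destruct (zdom_gauss_weight x) as [K HK]. pose proof (zsum_lim _ _ HK) as HT.
  set (T := zsum (fun m => q m * character m x)%C) in *.
  destruct fcoef_0_bound as [B0 [HB0 Hb0]].
  destruct (fcoef_tail g g_taylor1 g_per) as [B Hb].
  pose proof (zdom_nonneg _ _ HK) as HK0.
  set (err := fun (M : nat) (m : Z) => ((fcoef g (2 * M) m - q m * fcoef g (2 * M) 0) * character m x)%C).
  assert (HB1 : 0 <= B).
  { generalize (Hb 2%nat 1%Z ltac:(lia) ltac:(lia) ltac:(simpl; lia)) (Cmod_ge_0 (fcoef g 2 1)). lra. }
  assert (Herr : forall M m, (0 < Z.abs m <= Z.of_nat M)%Z -> Cmod (err M m) <= (B + 2 * K * B0) / IZR m ^ 2).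
  { intros M m [H1 H2]. unfold err.
    rewrite Cmod_mult, Cmod_character, Rmult_1_r.
    specialize (Hb (2 * M)%nat m ltac:(lia) ltac:(lia) ltac:(lia)).
    specialize (Hb0 (2 * M)%nat ltac:(lia)).
    eapply Rle_trans. apply Cmod_triangle. rewrite Cmod_opp, Cmod_mult.
    specialize (HK m). cbv beta in HK. rewrite Cmod_mult, Cmod_character, Rmult_1_r in HK.
    assert (m0 : 1 <= Rabs (IZR m)) by (rewrite <- abs_IZR; apply IZR_le; lia).
    assert (m2 : 0 < IZR m ^ 2) by (rewrite <- pow2_abs; nra).
    (* Brings the exponential majorant into the same shape [1 / m^2] as the bound on the
       coefficients. *)
    assert (E : exp (- Rabs (IZR m)) <= 2 / IZR m ^ 2).
    { rewrite <- pow2_abs. set (t := Rabs (IZR m)) in *. rewrite exp_Ropp.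
      apply Rmult_le_reg_r with (exp t); [apply exp_pos|]. rewrite Rinv_l by (apply Rgt_not_eq, exp_pos).
      apply Rmult_le_reg_r with (t ^ 2); [nra|].
      replace (2 / t ^ 2 * exp t * t ^ 2) with (2 * exp t) by (field; lra).
      assert (t ^ 2 / 2 <= exp t); [|lra].
      assert (e3 : (1 + t / 4) ^ 4 <= exp t).
      { replace (exp t) with (exp (t / 4) ^ 4).
        - apply pow_incr. generalize (exp_ge_1_plus (t / 4)). lra.
        - simpl. rewrite Rmult_1_r, <- !exp_plus. f_equal. field. }
      assert ((1 + t / 4) ^ 4 = 1 + t + 3 / 8 * t ^ 2 + t ^ 3 / 16 + t ^ 4 / 256) by field.
      assert (0 <= t ^ 3) by (apply pow_le; lra). assert (0 <= t ^ 4) by (apply pow_le; lra).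
      assert (t ^ 2 / 8 <= 1 + t + t ^ 3 / 16); [|lra].
      destruct (Rle_dec t 2). nra. assert (2 * t ^ 2 <= t ^ 3) by (simpl; nra). nra. }
    pose proof (Cmod_ge_0 (q m)). pose proof (Cmod_ge_0 (fcoef g (2 * M) 0)).
    assert (Cmod (q m) * Cmod (fcoef g (2 * M) 0) <= K * (2 / IZR m ^ 2) * B0).
    { apply Rmult_le_compat; auto. eapply Rle_trans; [exact HK|]. apply Rmult_le_compat_l; auto. }
    replace ((B + 2 * K * B0) / IZR m ^ 2) with (B / IZR m ^ 2 + K * (2 / IZR m ^ 2) * B0)
      by (field; intros E0; rewrite E0 in m2; lra).
    lra. }
  assert (KB : 0 <= K * B0) by (apply Rmult_le_pos; auto).
  assert (L1 : clim (fun M => csum (zfold (err M)) M) 0).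
  { apply tannery with (2 * (B + 2 * K * B0)); [lra| |].
    - intros k. unfold zfold. replace (RtoC 0) with (0 + 0)%C by ring.
      assert (E : forall m, clim (fun M => err M m) 0).
      { intros m. unfold err. replace (RtoC 0) with (character m x * 0)%C by ring.
        apply clim_ext with (fun M => character m x * (fcoef g (2 * M) m - q m * fcoef g (2 * M) 0))%C; [intros; ring|].
        apply clim_scal.
        apply (clim_subseq (fun N => fcoef g N m - q m * fcoef g N 0)%C _ (fun M => (2 * M)%nat)); [intros; lia|].
        apply fcoef_gauss. }
      apply clim_plus; apply E.
    - intros M k Hk. unfold zfold. eapply Rle_trans. apply Cmod_triangle.
      assert (E1 := Herr M (Z.of_nat k) ltac:(lia)). assert (E2 := Herr M (- Z.of_nat k - 1)%Z ltac:(lia)).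
      rewrite <- INR_IZR_INZ in E1.
      assert (k0 : 0 < INR k) by (apply lt_0_INR; lia).
      assert ((B + 2 * K * B0) / IZR (- Z.of_nat k - 1) ^ 2 <= (B + 2 * K * B0) / INR k ^ 2).
      { unfold Rdiv. apply Rmult_le_compat_l; [lra|]. apply Rinv_le_contravar; [nra|].
        rewrite minus_IZR, opp_IZR, <- INR_IZR_INZ. nra. }
      unfold Rdiv in *. lra. }
  (* [S (pred M)] is [M] for positive [M] and keeps the number of sample points nonzero at [M = 0],
     so that the bound holds for all [M]. *)
  assert (L2 : clim (fun M => fcoef g (2 * S (pred M)) 0 *
       (csum (zfold (fun m => q m * character m x)%C) M + (- (1)) * T))%C 0).
  { apply clim_0_mult_bounded with B0. intros M. apply Hb0. lia.
    replace (RtoC 0) with (T + (- (1)) * T)%C by ring. apply clim_plus; auto. apply clim_const. }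
  replace (RtoC 0) with (0 + 0)%C by ring.
  intros eps He. destruct (clim_plus _ _ _ _ L1 L2 eps He) as [N HN].
  exists (S N). intros M HM. specialize (HN M ltac:(lia)).
  replace (S (pred M)) with M in HN by lia.
  eapply Rle_lt_trans; [|exact HN]. right. f_equal. f_equal.
  destruct (Hr M ltac:(lia)) as [R1 R2].
  rewrite R2 at 1. rewrite (fcoef_inversion g M (r M) R1). rewrite <- R2.
  transitivity (csum (zfold (err M)) M + fcoef g (2 * M) 0 * csum (zfold (fun m => q m * character m x)%C) M - T * fcoef g (2 * M) 0)%C; [|ring].
  f_equal. rewrite <- csum_scal, <- csum_plus. apply csum_ext. intros. unfold zfold, err. ring.
Qed.

(** Discrete form of the fact that the functions with these two periodicities form a line spanned by
    a theta series, read off at the points 0 and 1/2. *)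
Theorem quasi_periodic_values : exists c,
  g 0 = (c * zsum (fun m => Cexp (PI * Ci * IZR m ^ 2 * s)))%C /\
  g (1 / 2)%R = (c * zsum (fun m => Cexp (PI * Ci * IZR m ^ 2 * s) * character m (1 / 2)%R))%C.
Proof.
  assert (H0 := value_gauss 0 (fun _ => O)).
  assert (H1 := value_gauss (1 / 2) (fun M => M)).
  specialize (H0 ltac:(intros M HM; split; [lia|]; simpl; field; apply Rgt_not_eq, lt_0_INR; lia)).
  specialize (H1 ltac:(intros M HM; split; [lia|]; rewrite mult_INR; simpl; field; apply Rgt_not_eq, lt_0_INR; lia)).
  rewrite (zsum_ext (fun m => q m * character m 0)%C (fun m => q m)) in H0
    by (intros; rewrite character_0_r; ring).
  change (zsum (fun m : Z => Cexp (PI * Ci * IZR m ^ 2 * s))) with (zsum q).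
  change (zsum (fun m : Z => Cexp (PI * Ci * IZR m ^ 2 * s) * character m (1 / 2)%R))%C with
    (zsum (fun m : Z => q m * character m (1 / 2)%R)%C).
  set (T0 := zsum q) in *. set (T1 := zsum (fun m => q m * character m (1 / 2)%R)%C) in *.
  (* Nothing is known yet about zeros of [T0] and [T1], so [c] is the quotient at one that is
     nonzero, or 0 if both vanish. *)
  destruct (Ceq_dec T0 0) as [E0|E0]; [destruct (Ceq_dec T1 0) as [E1|E1]|].
  - exists 0%C. rewrite E0 in H0. rewrite E1 in H1. rewrite !Cmult_0_l.
    split; apply clim_const_eq.
    + eapply clim_ext; [|exact H0]. intros; cbv beta; ring.
    + eapply clim_ext; [|exact H1]. intros; cbv beta; ring.
  - exists (g (1 / 2)%R / T1)%C. split; [|field; assumption].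
    rewrite E0 in *. replace (g (1 / 2)%R / T1 * 0)%C with (RtoC 0) by ring.
    apply clim_const_eq. eapply clim_ext; [|exact H0]. intros; cbv beta; ring.
  - exists (g 0 / T0)%C. split; [field; assumption|].
    enough (E : (g (1 / 2)%R - g 0 / T0 * T1)%C = 0%C).
    { replace (g (1 / 2)%R) with (g (1 / 2)%R - g 0 / T0 * T1 + g 0 / T0 * T1)%C by ring. rewrite E. ring. }
    apply clim_const_eq.
    assert (L := clim_plus _ _ _ _ H1 (clim_scal (- (T1 / T0))%C _ _ H0)).
    replace (0 + - (T1 / T0) * 0)%C with (RtoC 0) in L by ring.
    eapply clim_ext; [|exact L]. intros n. cbv beta. field. assumption.
Qed.
End Quasi_periodic.

(** * Theta series *)

(** With the square completed, that is with an extra factor [e^(2 pi i tau z^2)] compared with the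
    usual theta series, adding 1 to [z] amounts to shifting [n]. *)
Definition gterm (z tau : C) (n : Z) : C := Cexp (2 * PI * Ci * tau * (z + IZR n) ^ 2)%C.

Definition Theta (z tau : C) : C := zsum (gterm z tau).

Lemma Re_gexp z tau n : Re (2 * PI * Ci * tau * (z + IZR n) ^ 2)%C =
  - 2 * PI * (Im tau * ((Re z + IZR n) ^ 2 - Im z ^ 2) + 2 * Re tau * (Re z + IZR n) * Im z).
Proof. destruct z, tau. simpl. ring. Qed.

(** Uniform on compact sets of [z] and [tau]. The spare factor [exp (P |n|)] absorbs the growth in
    [n] of derivatives and remainders. *)
Lemma gterm_majorant t0 K P : 0 < t0 -> 0 <= K -> exists M, 0 < M /\ forall z tau n,
  t0 <= Im tau -> Rabs (Re tau) <= K -> Im tau <= K -> Rabs (Re z) <= K -> Rabs (Im z) <= K ->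
  Cmod (gterm z tau n) * exp (P * Rabs (IZR n)) <= M * exp (- Rabs (IZR n)).
Proof.
  intros Ht HK. pose proof PI_RGT_0 as HP.
  destruct (gauss_majorant (2 * PI * t0) (8 * PI * K ^ 2 + P) (6 * PI * K ^ 3)) as [M [HM HG]]; [nra|].
  exists M. split; auto. intros z tau n H1 H2 H3 H4 H5.
  unfold gterm. rewrite Cmod_Cexp, <- exp_plus. eapply Rle_trans; [|apply HG].
  apply exp_le_compat. rewrite Re_gexp.
  destruct z as [p q], tau as [s t]. simpl Re in *; simpl Im in *. set (x := IZR n).
  assert (B : t * ((p + x) ^ 2 - q ^ 2) + 2 * s * (p + x) * q >= t0 * x ^ 2 - 4 * K ^ 2 * Rabs x - 3 * K ^ 3).
  { apply Rabs_le_between in H2. apply Rabs_le_between in H4. apply Rabs_le_between in H5.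
    assert (Hx := Rabs_pos x). assert (Hx2 : x ^ 2 = Rabs x ^ 2) by (symmetry; apply pow2_abs).
    assert (K2 : 0 <= K ^ 2) by nra.
    assert (tp : Rabs (t * p) <= K ^ 2).
    { rewrite Rabs_mult. replace (K ^ 2) with (K * K) by ring. apply Rmult_le_compat; try apply Rabs_pos; apply Rabs_le; lra. }
    assert (sq : Rabs (s * q) <= K ^ 2).
    { rewrite Rabs_mult. replace (K ^ 2) with (K * K) by ring. apply Rmult_le_compat; try apply Rabs_pos; apply Rabs_le; lra. }
    assert (tpx : Rabs (t * p * x) <= K ^ 2 * Rabs x) by (rewrite Rabs_mult; apply Rmult_le_compat_r; auto).
    assert (sqx : Rabs (s * q * x) <= K ^ 2 * Rabs x) by (rewrite Rabs_mult; apply Rmult_le_compat_r; auto).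
    assert (sqp : Rabs (s * q * p) <= K ^ 3).
    { rewrite Rabs_mult. replace (K ^ 3) with (K ^ 2 * K) by ring. apply Rmult_le_compat; try apply Rabs_pos; auto. apply Rabs_le; lra. }
    assert (q2 : t * q ^ 2 <= K ^ 3) by (replace (K ^ 3) with (K * K ^ 2) by ring; apply Rmult_le_compat; nra).
    assert (p2 : 0 <= t * p ^ 2) by (apply Rmult_le_pos; nra).
    assert (tx : t0 * x ^ 2 <= t * x ^ 2) by (apply Rmult_le_compat_r; nra).
    apply Rabs_le_between in tpx. apply Rabs_le_between in sqx. apply Rabs_le_between in sqp. nra. }
  assert (Hf := Rmult_ge_compat_l (2 * PI) _ _ ltac:(lra) B). lra.
Qed.

Lemma gterm_dom z tau : upper tau -> exists K, zdom (gterm z tau) K.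
Proof.
  intros H. set (K := Rabs (Re tau) + Im tau + Rabs (Re z) + Rabs (Im z)).
  pose proof (Rabs_pos (Re tau)). pose proof (Rabs_pos (Re z)). pose proof (Rabs_pos (Im z)).
  unfold upper in H.
  destruct (gterm_majorant (Im tau) K 0 H) as [M [HM HB]]; [unfold K; lra|].
  exists M. intros n. eapply Rle_trans; [|apply (HB z tau n); unfold K; lra].
  rewrite Rmult_0_l, exp_0. lra.
Qed.

Lemma Theta_per z tau : upper tau -> Theta (z + 1) tau = Theta z tau.
Proof.
  intros H. destruct (gterm_dom z tau H) as [K HK].
  transitivity (zsum (fun n => gterm z tau (n + 1)%Z)); [|apply (zsum_shift _ _ HK)].
  apply zsum_ext. intros n. unfold gterm.
  f_equal. rewrite plus_IZR, RtoC_plus. ring.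
Qed.

(** Termwise: a step [h] multiplies the [n]-th term by [e^w] with
    [w = 2 pi i tau (2 (z + n) h + h^2)], and the Taylor bound for [e^w] costs a factor exponential
    in [|n|], which the Gaussian decay outweighs. *)
Lemma taylor1_bound_Theta tau : upper tau -> taylor1_bound (fun z => Theta z tau).
Proof.
  intros Ht K HK. unfold upper in Ht. pose proof PI_RGT_0 as HP.
  set (K' := K + Rabs (Re tau) + Im tau). set (T := Cmod tau).
  assert (T0 : 0 <= T) by apply Cmod_ge_0.
  set (L := 2 * PI * T).
  assert (L0 : 0 <= L) by (unfold L; apply Rmult_le_pos; lra).
  pose proof (Rabs_pos (Re tau)) as Hr.
  (* [|z + n| <= |n| + 2 K], so a step [h] changes the exponent by at most
     [L (2 (|n| + 2 K) + K) |h|]; this dictates [D]. *)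
  set (D := L * (5 * K + 2)).
  assert (D0 : 0 <= D) by (unfold D; apply Rmult_le_pos; lra).
  destruct (gterm_majorant (Im tau) K' (D * K + 2) Ht) as [M [HM HB]]; [unfold K'; lra|].
  (* The summands account for the values, the derivative and the remainder; [zsum_bound] will
     contribute the factor 4. *)
  set (B := (1 + D + (6 * D ^ 2 * exp (D * K) + L)) * M).
  assert (E0 := exp_pos (D * K)).
  assert (D2 : 0 <= 6 * D ^ 2 * exp (D * K)) by (apply Rmult_le_pos; nra).
  exists (4 * B). split; [unfold B; apply Rmult_le_pos; [lra|]; apply Rmult_le_pos; lra|].
  intros z H1 H2.
  set (d := fun n : Z => (4 * PI * Ci * tau * (z + IZR n) * gterm z tau n)%C).
  assert (zn : forall n, Cmod (z + IZR n) <= Rabs (IZR n) + 2 * K).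
  { intros n. eapply Rle_trans. apply Cmod_triangle. rewrite Cmod_R.
    generalize (Cmod_le_Rabs z). lra. }
  assert (Hg : forall n, Cmod (gterm z tau n) * exp ((D * K + 2) * Rabs (IZR n)) <= M * exp (- Rabs (IZR n))).
  { intros n. apply HB; unfold K'; lra. }
  assert (En : forall n, 1 + Rabs (IZR n) <= exp (Rabs (IZR n))) by (intros; apply exp_ge_1_plus).
  assert (G1 : forall n j, 0 <= j <= D * K + 2 -> Cmod (gterm z tau n) * exp (j * Rabs (IZR n)) <= M * exp (- Rabs (IZR n))).
  { intros n j Hj. eapply Rle_trans; [|apply Hg]. apply Rmult_le_compat_l; [apply Cmod_ge_0|].
    apply exp_le_compat. apply Rmult_le_compat_r; [apply Rabs_pos|lra]. }
  assert (DK0 : 0 <= D * K) by (apply Rmult_le_pos; lra).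
  assert (domg : zdom (gterm z tau) M).
  { intros n. generalize (G1 n 0 ltac:(lra)). rewrite Rmult_0_l, exp_0. lra. }
  assert (Hw : forall n, L * (2 * (Rabs (IZR n) + 2 * K) + K) <= D * (1 + Rabs (IZR n))).
  { intros n. unfold D. rewrite Rmult_assoc. apply Rmult_le_compat_l; auto.
    pose proof (Rabs_pos (IZR n)). assert (0 <= K * Rabs (IZR n)) by (apply Rmult_le_pos; lra). lra. }
  assert (domd : zdom d (D * M)).
  { intros n. unfold d. rewrite !Cmod_mult, Cmod_Ci, !Cmod_R, (Rabs_pos_eq 4), (Rabs_pos_eq PI) by lra.
    fold T. specialize (zn n). specialize (Hw n). specialize (En n).
    assert (Hn := Rabs_pos (IZR n)). assert (Hc := Cmod_ge_0 (gterm z tau n)).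
    assert (4 * PI * 1 * T * Cmod (z + IZR n) <= D * exp (Rabs (IZR n))).
    { apply Rle_trans with (L * (2 * (Rabs (IZR n) + 2 * K) + K)).
      - unfold L. replace (4 * PI * 1 * T * Cmod (z + IZR n)) with (2 * PI * T * (2 * Cmod (z + IZR n))) by ring.
        apply Rmult_le_compat_l; auto. lra.
      - eapply Rle_trans; [exact Hw|]. apply Rmult_le_compat_l; auto. }
    specialize (G1 n 1 ltac:(lra)). rewrite Rmult_1_l in G1.
    apply Rle_trans with (D * exp (Rabs (IZR n)) * Cmod (gterm z tau n)).
    - apply Rmult_le_compat_r; auto.
    - rewrite !Rmult_assoc. apply Rmult_le_compat_l; auto. lra. }
  exists (zsum d).
  assert (Mpos : M <= B).
  { unfold B. rewrite <- (Rmult_1_l M) at 1. apply Rmult_le_compat_r; lra. }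
  assert (DM : D * M <= B) by (unfold B; apply Rmult_le_compat_r; lra).
  split; [|split].
  - eapply Rle_trans. apply (zsum_bound _ _ domg). lra.
  - eapply Rle_trans. apply (zsum_bound _ _ domd). lra.
  - intros h Hh. assert (h0 := Cmod_ge_0 h).
    destruct (gterm_dom (z + h)%C tau Ht) as [Kh HKh].
    assert (domhd : zdom (fun n => - h * d n)%C (Cmod (- h) * (D * M))) by now apply zdom_scal.
    assert (domgm : zdom (fun n => - (1) * gterm z tau n)%C (Cmod (- (1)) * M)) by now apply zdom_scal.
    replace (Theta (z + h) tau - Theta z tau - zsum d * h)%C with
      (zsum (fun n => gterm (z + h) tau n + (- (1) * gterm z tau n + - h * d n))%C).
    2:{ unfold Theta. rewrite (zsum_plus _ _ _ _ HKh (zdom_plus _ _ _ _ domgm domhd)).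
        rewrite (zsum_plus _ _ _ _ domgm domhd).
        rewrite (zsum_scal _ _ _ domg), (zsum_scal _ _ _ domd). ring. }
    replace (4 * B * Cmod h ^ 2) with (4 * (B * Cmod h ^ 2)) by ring.
    apply zsum_bound. intros n.
    set (w := (2 * PI * Ci * tau * (2 * (z + IZR n) * h + h * h))%C).
    replace (gterm (z + h) tau n + (- (1) * gterm z tau n + - h * d n))%C with
      (gterm z tau n * ((Cexp w - 1 - w) + 2 * PI * Ci * tau * (h * h)))%C.
    2:{ unfold d, gterm. replace (2 * PI * Ci * tau * (z + h + IZR n) ^ 2)%C with
         (2 * PI * Ci * tau * (z + IZR n) ^ 2 + w)%C by (unfold w; ring). rewrite Cexp_plus. unfold w. ring. }
    rewrite Cmod_mult.
    set (x := Rabs (IZR n)) in *. assert (x0 : 0 <= x) by apply Rabs_pos.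
    assert (Bw : Cmod w <= D * (1 + x) * Cmod h).
    { apply Rle_trans with (L * (2 * (x + 2 * K) + K) * Cmod h).
      - unfold w. rewrite !Cmod_mult, Cmod_Ci, !Cmod_R, (Rabs_pos_eq 2), (Rabs_pos_eq PI) by lra. fold T.
        replace (2 * PI * 1 * T) with L by (unfold L; ring). rewrite Rmult_assoc. apply Rmult_le_compat_l; auto.
        eapply Rle_trans. apply Cmod_triangle. rewrite !Cmod_mult, Cmod_R, (Rabs_pos_eq 2) by lra.
        specialize (zn n). fold x in zn. nra.
      - apply Rmult_le_compat_r; auto. apply Hw. }
    assert (w0 := Cmod_ge_0 w).
    assert (Ew : exp (Cmod w) <= exp (D * K) * exp (D * K * x)).
    { rewrite <- exp_plus. apply exp_le_compat. eapply Rle_trans; [exact Bw|].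
      replace (D * K + D * K * x) with (D * (1 + x) * K) by ring. apply Rmult_le_compat_l; auto.
      apply Rmult_le_pos; lra. }
    assert (En2 : (1 + x) ^ 2 <= exp (2 * x)).
    { replace (exp (2 * x)) with (exp x ^ 2) by (simpl; rewrite Rmult_1_r, <- exp_plus; f_equal; ring).
      apply pow_incr. specialize (En n). fold x in En. lra. }
    assert (BE : Cmod (Cexp w - 1 - w + 2 * PI * Ci * tau * (h * h)) <=
        (6 * D ^ 2 * exp (D * K) + L) * Cmod h ^ 2 * exp ((D * K + 2) * x)).
    { eapply Rle_trans. apply Cmod_triangle.
      rewrite !Cmod_mult, Cmod_Ci, !Cmod_R, (Rabs_pos_eq 2), (Rabs_pos_eq PI) by lra. fold T.
      replace (2 * PI * 1 * T * (Cmod h * Cmod h)) with (L * Cmod h ^ 2) by (unfold L; ring).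
      assert (E1 : exp ((D * K + 2) * x) = exp (2 * x) * exp (D * K * x)) by (rewrite <- exp_plus; f_equal; ring).
      assert (1 <= exp ((D * K + 2) * x)).
      { rewrite <- exp_0. apply exp_le_compat. apply Rmult_le_pos; lra. }
      assert (Cmod (Cexp w - 1 - w) <= 6 * D ^ 2 * exp (D * K) * Cmod h ^ 2 * exp ((D * K + 2) * x)).
      { eapply Rle_trans; [apply Cexp_taylor1_bound|]. rewrite E1.
        apply Rle_trans with (6 * (D * (1 + x) * Cmod h) ^ 2 * (exp (D * K) * exp (D * K * x))).
        - apply Rmult_le_compat; auto; [nra|left; apply exp_pos|].
          apply Rmult_le_compat_l; [lra|]. apply pow_incr; lra.
        - replace (6 * (D * (1 + x) * Cmod h) ^ 2 * (exp (D * K) * exp (D * K * x))) with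
            (6 * D ^ 2 * exp (D * K) * Cmod h ^ 2 * exp (D * K * x) * (1 + x) ^ 2) by ring.
          replace (6 * D ^ 2 * exp (D * K) * Cmod h ^ 2 * (exp (2 * x) * exp (D * K * x))) with
            (6 * D ^ 2 * exp (D * K) * Cmod h ^ 2 * exp (D * K * x) * exp (2 * x)) by ring.
          apply Rmult_le_compat_l; auto. apply Rmult_le_pos; [|left; apply exp_pos].
          apply Rmult_le_pos; auto. nra. }
      assert (L * Cmod h ^ 2 <= L * Cmod h ^ 2 * exp ((D * K + 2) * x)).
      { rewrite <- (Rmult_1_r (L * Cmod h ^ 2)) at 1. apply Rmult_le_compat_l; auto. apply Rmult_le_pos; nra. }
      lra. }
    apply Rle_trans with (Cmod (gterm z tau n) * ((6 * D ^ 2 * exp (D * K) + L) * Cmod h ^ 2 * exp ((D * K + 2) * x))).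
    + apply Rmult_le_compat_l; auto. apply Cmod_ge_0.
    + replace (Cmod (gterm z tau n) * ((6 * D ^ 2 * exp (D * K) + L) * Cmod h ^ 2 * exp ((D * K + 2) * x))) with
        ((6 * D ^ 2 * exp (D * K) + L) * Cmod h ^ 2 * (Cmod (gterm z tau n) * exp ((D * K + 2) * x))) by ring.
      apply Rle_trans with ((6 * D ^ 2 * exp (D * K) + L) * Cmod h ^ 2 * (M * exp (- x))).
      * apply Rmult_le_compat_l; [apply Rmult_le_pos; nra|]. apply Hg.
      * unfold B. replace ((1 + D + (6 * D ^ 2 * exp (D * K) + L)) * M * Cmod h ^ 2 * exp (- x)) with
          ((1 + D + (6 * D ^ 2 * exp (D * K) + L)) * (M * Cmod h ^ 2 * exp (- x))) by ring.
        replace ((6 * D ^ 2 * exp (D * K) + L) * Cmod h ^ 2 * (M * exp (- x))) with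
          ((6 * D ^ 2 * exp (D * K) + L) * (M * Cmod h ^ 2 * exp (- x))) by ring.
        apply Rmult_le_compat_r; [|lra]. apply Rmult_le_pos; [nra|left; apply exp_pos].
Qed.

(* [thA tau] and [thB tau] are Jacobi's theta_2 and theta_3 at [2 tau]. *)
Definition thA (tau : C) : C := Theta (1 / 2)%R tau.
Definition thB (tau : C) : C := Theta 0 tau.

(** * Theta constants under inversion and translation *)

Definition Sact (tau : C) : C := (- (1) / tau)%C.

Lemma upper_neq0 tau : upper tau -> tau <> 0%C.
Proof. intros H E. rewrite E in H. unfold upper in H. simpl in H. lra. Qed.

Lemma Im_Sact (tau : C) : tau <> 0%C -> Im (Sact tau) = Im tau / (Cmod tau ^ 2).
Proof.
  intros H. rewrite Cmod2_alt. destruct tau as [s t]. unfold Sact.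
  assert (s ^ 2 + t ^ 2 <> 0).
  { intros E. apply H. apply C_ext; simpl; nra. }
  simpl. field. simpl in *. nra.
Qed.

Lemma upper_S tau : upper tau -> upper (Sact tau).
Proof.
  intros H. unfold upper. rewrite Im_Sact by now apply upper_neq0.
  apply Rdiv_lt_0_compat; auto. apply pow_lt, Cmod_gt_0, upper_neq0, H.
Qed.

Lemma upper_shift tau (x : R) : upper tau -> upper (tau + x).
Proof. unfold upper, Im; simpl. lra. Qed.

Lemma character_half n : character (2 * n) (1 / 2)%R = 1%C /\ character (2 * n + 1) (1 / 2)%R = (- (1))%C.
Proof.
  assert (E : character (2 * n) (1 / 2)%R = 1%C).
  { rewrite <- (character_1 n). unfold character. f_equal. rewrite mult_IZR, RtoC_mult.
    unfold Rdiv. rewrite Rmult_1_l, RtoC_inv by lra. field. }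
  split; auto. rewrite character_plus_l, E, Cmult_1_l. unfold character, Cexp.
  replace (Re (2 * PI * Ci * 1 * (1 / 2)%R)%C) with 0 by (simpl; field).
  replace (Im (2 * PI * Ci * 1 * (1 / 2)%R)%C) with PI by (simpl; field).
  rewrite exp_0, cos_PI, sin_PI. apply C_ext; simpl; ring.
Qed.

Lemma half_half : RtoC (1 / 2) = (/ 2)%C.
Proof. unfold Rdiv. rewrite Rmult_1_l, RtoC_inv by lra. reflexivity. Qed.

Lemma C2_neq0 : RtoC 2 <> 0%C.
Proof. intros X; apply RtoC_inj in X; lra. Qed.

Section Half_period.
Variable tau : C.
Hypothesis Ht : upper tau.
Let f (m : Z) : C := Cexp (PI * Ci * IZR m ^ 2 * (tau / 2)).

Lemma half_upper : upper (tau / 2)%C.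
Proof. revert Ht. unfold upper, Im; simpl. lra. Qed.

Lemma zdom_half (x : R) : exists K, zdom (fun m => f m * character m x)%C K.
Proof. apply (zdom_gauss_weight (tau / 2)%C half_upper x). Qed.

Lemma half_even_term n : f (2 * n) = gterm 0 tau n.
Proof. unfold f, gterm. f_equal. rewrite mult_IZR, RtoC_mult. field. Qed.

Lemma half_odd_term n : f (2 * n + 1) = gterm (1 / 2)%R tau n.
Proof.
  unfold f, gterm. f_equal. rewrite plus_IZR, mult_IZR, RtoC_plus, RtoC_mult, half_half. field.
Qed.

(** In the exponent [pi i m^2 tau / 2], even [m = 2 n] gives [2 pi i tau n^2] and odd [m = 2 n + 1]
    gives [2 pi i tau (n + 1/2)^2]. The alternating sum changes the sign of the odd part. *)
Lemma zsum_half : zsum f = (thA tau + thB tau)%C.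
Proof.
  destruct (zdom_half 0) as [K HK].
  apply (zdom_ext _ f) in HK; [|intros; rewrite character_0_r; ring].
  destruct (gterm_dom 0 tau Ht) as [K0 HK0]. destruct (gterm_dom (1 / 2)%R tau Ht) as [K1 HK1].
  rewrite (zsum_parity f K K0 K1 HK).
  - rewrite (zsum_ext _ _ half_even_term), (zsum_ext _ _ half_odd_term). unfold thA, thB, Theta. ring.
  - eapply zdom_ext; [|exact HK0]. intros; symmetry; apply half_even_term.
  - eapply zdom_ext; [|exact HK1]. intros; symmetry; apply half_odd_term.
Qed.

Lemma zsum_half_alt : zsum (fun m => f m * character m (1 / 2)%R)%C = (thB tau - thA tau)%C.
Proof.
  destruct (zdom_half (1 / 2)) as [K HK].
  destruct (gterm_dom 0 tau Ht) as [K0 HK0]. destruct (gterm_dom (1 / 2)%R tau Ht) as [K1 HK1].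
  assert (E0 : forall n, (f (2 * n) * character (2 * n) (1 / 2)%R)%C = gterm 0 tau n).
  { intros n. rewrite half_even_term, (proj1 (character_half n)). ring. }
  assert (E1 : forall n, (f (2 * n + 1) * character (2 * n + 1) (1 / 2)%R)%C = (- (1) * gterm (1 / 2)%R tau n)%C).
  { intros n. rewrite half_odd_term, (proj2 (character_half n)). ring. }
  rewrite (zsum_parity _ K K0 (Cmod (- (1)) * K1) HK).
  - rewrite (zsum_ext _ _ E0), (zsum_ext _ _ E1), (zsum_scal _ _ _ HK1). unfold thA, thB, Theta. ring.
  - eapply zdom_ext; [|exact HK0]. intros; symmetry; apply E0.
  - eapply zdom_ext; [|apply zdom_scal; exact HK1]. intros; symmetry; apply E1.
Qed.

Lemma half_term_opp n : f (- n) = f n.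
Proof. unfold f. f_equal. rewrite opp_IZR, RtoC_opp. ring. Qed.

Lemma half_term_q_term n : f (Z.of_nat (S n)) = q_term (S n) (tau / 2).
Proof. unfold f, q_term. f_equal. rewrite <- INR_IZR_INZ, RtoC_mult, RtoC_pow. ring. Qed.

Lemma half_term_0 : f 0 = 1%C.
Proof. unfold f. rewrite <- Cexp_0. f_equal. ring. Qed.

Lemma theta3_half : theta3 (tau / 2) = (thA tau + thB tau)%C.
Proof.
  rewrite <- zsum_half. destruct (zdom_half 0) as [K HK].
  apply (zdom_ext _ f) in HK; [|intros; rewrite character_0_r; ring].
  rewrite (zsum_even f K HK half_term_opp), half_term_0. unfold theta3. do 2 f_equal.
  apply CSeries_ext. intros n. now rewrite half_term_q_term.
Qed.

Lemma character_half_sign n : character (Z.of_nat n) (1 / 2)%R = RtoC ((-1) ^ n).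
Proof.
  induction n as [|n IH]; [apply character_0_l|].
  replace (Z.of_nat (S n)) with (Z.of_nat n + 1)%Z by lia.
  rewrite character_plus_l, IH.
  assert (E : character 1 (1 / 2)%R = (- (1))%C) by exact (proj2 (character_half 0)). rewrite E.
  simpl pow. rewrite RtoC_mult. ring.
Qed.

Lemma theta4_half : theta4 (tau / 2) = (thB tau - thA tau)%C.
Proof.
  rewrite <- zsum_half_alt. destruct (zdom_half (1 / 2)) as [K HK].
  rewrite (zsum_even _ K HK).
  - rewrite half_term_0, character_0_l. unfold theta4. f_equal; [ring|]. f_equal.
    apply CSeries_ext. intros n. rewrite half_term_q_term, character_half_sign. ring.
  - intros n. rewrite half_term_opp. f_equal.
    replace (- n)%Z with (n + 2 * - n)%Z by lia. rewrite character_plus_l, (proj1 (character_half _)). ring.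
Qed.
End Half_period.

Lemma Theta_quasi z tau : upper tau ->
  Theta (z + tau / 2) (Sact tau) =
  (Cexp (- (PI * Ci * (tau / 2)) - 2 * PI * Ci * z) * Theta z (Sact tau))%C.
Proof.
  intros Ht. assert (tn := upper_neq0 _ Ht).
  destruct (gterm_dom z (Sact tau) (upper_S _ Ht)) as [K HK].
  unfold Theta. rewrite <- (zsum_scal _ _ _ HK). apply zsum_ext. intros n.
  unfold gterm. rewrite <- Cexp_plus.
  (* Expanding the square leaves the integral phase [e^(- 2 pi i n)]; it is supplied here as a
     factor 1. *)
  rewrite <- (Cmult_1_l (Cexp (- _ - _ + _))). rewrite <- (Cexp_2PIi_Z (- n)), <- Cexp_plus.
  f_equal. unfold Sact. rewrite opp_IZR, RtoC_opp. field. exact tn.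
Qed.

(** Classically [c] is the square root of [- i tau / 2]. *)
Lemma th_S tau : upper tau -> exists c,
  thA (Sact tau) = (c * (thB tau - thA tau))%C /\ thB (Sact tau) = (c * (thB tau + thA tau))%C.
Proof.
  intros Ht. pose proof (upper_S _ Ht) as HS.
  destruct (quasi_periodic_values (fun z => Theta z (Sact tau)) (tau / 2)%C) as [c [H0 H1]].
  - now apply taylor1_bound_Theta.
  - intros z. now apply Theta_per.
  - intros z. now apply Theta_quasi.
  - now apply half_upper.
  - exists c. unfold thA at 1, thB at 2. rewrite H0, H1.
    split; f_equal.
    + now apply zsum_half_alt.
    + rewrite Cplus_comm. now apply zsum_half.
Qed.

Lemma Cexp_half_PIi : Cexp (PI * Ci / 2)%C = Ci.
Proof.
  unfold Cexp.
  replace (Re (PI * Ci / 2)%C) with 0 by (simpl; field).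
  replace (Im (PI * Ci / 2)%C) with (PI / 2) by (simpl; field).
  rewrite exp_0, cos_PI2, sin_PI2. apply C_ext; simpl; ring.
Qed.

Lemma thB_T tau : thB (tau + 1) = thB tau.
Proof.
  apply zsum_ext. intros n. unfold gterm.
  transitivity (Cexp (2 * PI * Ci * tau * (0 + IZR n) ^ 2 + 2 * PI * Ci * IZR (n * n)))%C.
  - f_equal. rewrite mult_IZR, RtoC_mult. ring.
  - rewrite Cexp_plus, Cexp_2PIi_Z. ring.
Qed.

(** Since [(n + 1/2)^2 = n^2 + n + 1/4], every term gains the same factor [e^(pi i / 2) = i]. *)
Lemma thA_T tau : upper tau -> thA (tau + 1) = (Ci * thA tau)%C.
Proof.
  intros Ht. destruct (gterm_dom (1 / 2)%R tau Ht) as [K HK].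
  unfold thA, Theta. rewrite <- (zsum_scal _ _ _ HK). apply zsum_ext. intros n. unfold gterm.
  transitivity (Cexp (2 * PI * Ci * tau * ((1 / 2)%R + IZR n) ^ 2 + 2 * PI * Ci * IZR (n * n + n) + PI * Ci / 2))%C.
  - f_equal. rewrite plus_IZR, mult_IZR, RtoC_plus, RtoC_mult, half_half. field.
  - rewrite !Cexp_plus, Cexp_2PIi_Z, Cexp_half_PIi. ring.
Qed.

(** * Leading terms at the cusp *)

(** The local parameter [x] at infinity for translations by 4: [thA = 2 (x + x^9 + ...)] and
    [thB = 1 + 2 x^4 + 2 x^16 + ...]. *)
Definition xq (tau : C) : C := Cexp (PI * Ci * tau / 2)%C.
Definition yq (tau : C) : R := exp (- (PI * Im tau / 2)).

Lemma Cmod_xq tau : Cmod (xq tau) = yq tau.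
Proof. unfold xq, yq. rewrite Cmod_Cexp. f_equal. unfold Re, Im; simpl. field. Qed.

Lemma Cexp_pow z n : Cexp (INR n * z)%C = (Cexp z ^ n)%C.
Proof.
  induction n as [|n IH].
  - simpl. rewrite <- Cexp_0. f_equal. ring.
  - rewrite S_INR, RtoC_plus. replace ((INR n + 1) * z)%C with (z + INR n * z)%C by ring.
    rewrite Cexp_plus, IH, Cpow_S. reflexivity.
Qed.

Lemma gterm_0_pow tau n : gterm 0 tau (Z.of_nat n) = (xq tau ^ (4 * n * n))%C.
Proof.
  unfold gterm, xq. rewrite <- Cexp_pow. f_equal.
  rewrite <- INR_IZR_INZ, !mult_INR, !RtoC_mult. simpl (INR 4). replace (RtoC (1 + 1 + 1 + 1)) with (2 * 2)%C.
  field. rewrite <- RtoC_mult. f_equal. ring.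
Qed.

Lemma gterm_half_pow tau n : gterm (1 / 2)%R tau (Z.of_nat n) = (xq tau ^ ((2 * n + 1) * (2 * n + 1)))%C.
Proof.
  unfold gterm, xq. rewrite <- Cexp_pow. f_equal.
  rewrite <- INR_IZR_INZ, !mult_INR, !plus_INR, !mult_INR, half_half, !RtoC_mult, !RtoC_plus, !RtoC_mult. simpl (INR 2). simpl (INR 1).
  replace (RtoC (1 + 1)) with (RtoC 2) by (f_equal; ring). field.
Qed.

Lemma gterm_half_refl tau n : gterm (1 / 2)%R tau (- n - 1) = gterm (1 / 2)%R tau n.
Proof. unfold gterm. f_equal. rewrite minus_IZR, opp_IZR, RtoC_minus, RtoC_opp, half_half. field. Qed.

(** Compares the sparse power series in [xq] with a geometric series of ratio 1/2. *)
Lemma pow_le_pow_half y a b n : 0 <= y -> y ^ a <= / 2 -> y <= 1 -> forall N, (b + a * n <= N)%nat ->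
  y ^ N <= y ^ b * (/ 2) ^ n.
Proof.
  intros Hy Ha H1 N HN.
  apply Rle_trans with (y ^ (b + a * n)).
  - replace N with (b + a * n + (N - (b + a * n)))%nat by lia. rewrite pow_add.
    rewrite <- (Rmult_1_r (y ^ (b + a * n))) at 2. apply Rmult_le_compat_l; [now apply pow_le|].
    rewrite <- (pow1 (N - (b + a * n))). apply pow_incr. lra.
  - rewrite pow_add, pow_mult. apply Rmult_le_compat_l; [now apply pow_le|].
    apply pow_incr. split; auto. now apply pow_le.
Qed.

Lemma thB_bound tau : upper tau -> yq tau <= 2 / 5 -> Cmod (thB tau - 1) <= 4 * yq tau ^ 4.
Proof.
  intros Ht Hy. assert (y0 : 0 < yq tau) by apply exp_pos.
  destruct (gterm_dom 0 tau Ht) as [K HK].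
  unfold thB, Theta. rewrite (zsum_even _ _ HK).
  2:{ intros n. unfold gterm. f_equal. rewrite opp_IZR, RtoC_opp. ring. }
  replace (gterm 0 tau 0) with (RtoC 1) by exact (eq_sym (gterm_0_pow tau 0)).
  replace (1 + 2 * CSeries (fun n => gterm 0 tau (Z.of_nat (S n))) - 1)%C with
    (2 * CSeries (fun n => gterm 0 tau (Z.of_nat (S n))))%C by ring.
  rewrite Cmod_mult, Cmod_R, Rabs_pos_eq by lra.
  replace (4 * yq tau ^ 4) with (2 * (2 * yq tau ^ 4)) by ring. apply Rmult_le_compat_l; [lra|].
  assert (B : forall n, Cmod (gterm 0 tau (Z.of_nat (S n))) <= yq tau ^ 4 * (/ 2) ^ n).
  { intros n. rewrite gterm_0_pow, Cmod_pow, Cmod_xq.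
    apply pow_le_pow_half with 1%nat; try lra. nia. }
  apply clim_bound with (csum (fun n => gterm 0 tau (Z.of_nat (S n)))).
  - now apply CSeries_lim with (yq tau ^ 4).
  - now apply csum_geom_bound.
Qed.

Lemma thA_bound tau : upper tau -> yq tau <= 2 / 5 -> Cmod (thA tau - 2 * xq tau) <= 4 * yq tau ^ 9.
Proof.
  intros Ht Hy. assert (y0 : 0 < yq tau) by apply exp_pos.
  destruct (gterm_dom (1 / 2)%R tau Ht) as [K HK].
  set (a := fun n : nat => (2 * xq tau ^ ((2 * n + 1) * (2 * n + 1)))%C).
  assert (Ea : forall n, zfold (gterm (1 / 2)%R tau) n = a n).
  { intros n. unfold zfold. rewrite gterm_half_refl, gterm_half_pow. unfold a. ring. }
  apply clim_bound with (csum (fun n => a (S n))).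
  - assert (L : clim (fun n => csum (zfold (gterm (1 / 2)%R tau)) (S n)) (thA tau)).
    { apply (clim_subseq (csum (zfold (gterm (1 / 2)%R tau))) _ S); [lia|]. eapply zsum_lim, HK. }
    assert (L2 := clim_plus _ _ _ _ L (clim_const (- (2 * xq tau))%C)).
    eapply clim_ext; [|exact L2]. intros n. cbv beta.
    rewrite (csum_ext _ a) by (intros; apply Ea). rewrite csum_S_l.
    replace (a O) with (2 * xq tau)%C by (unfold a; simpl; ring). ring.
  - replace (4 * yq tau ^ 9) with (2 * (2 * yq tau ^ 9)) by ring. apply csum_geom_bound.
    intros n. unfold a. rewrite Cmod_mult, Cmod_R, Rabs_pos_eq, Cmod_pow, Cmod_xq by lra.
    rewrite Rmult_assoc. apply Rmult_le_compat_l; [lra|].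
    apply pow_le_pow_half with 1%nat; try lra. nia.
Qed.

(** * Reduction theory and non-vanishing *)

(** The usual fundamental domain lies above [sqrt 3 / 2], which exceeds 3/4. This slack gives
    termination: a point below 3/4 with [|Re| <= 1/2] has squared modulus at most
    [1/4 + 9/16 = 13/16], so each inversion multiplies the height by at least 16/13. *)
Lemma upper_reduction (Q : C -> Prop) :
  (forall tau, upper tau -> 3 / 4 <= Im tau -> Q tau) ->
  (forall tau, upper tau -> Q (tau + 1)%C -> Q tau) ->
  (forall tau, upper tau -> Q tau -> Q (tau + 1)%C) ->
  (forall tau, upper tau -> Q (Sact tau) -> Q tau) ->
  forall tau, upper tau -> Q tau.
Proof.
  intros Hbase HT HT' HS.
  assert (Hn : forall (n : nat) tau, upper tau -> (Q (tau + INR n)%C -> Q tau) /\ (Q (tau - INR n)%C -> Q tau)).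
  { induction n as [|n IH]; intros tau Ht.
    - simpl INR. split; intros H; [replace tau with (tau + 0)%C by ring | replace tau with (tau - 0)%C by ring]; exact H.
    - rewrite S_INR, RtoC_plus. split; intros H.
      + apply HT; auto. apply (proj1 (IH (tau + 1)%C (upper_shift _ 1 Ht))).
        replace (tau + 1 + INR n)%C with (tau + (INR n + 1))%C by ring. exact H.
      + assert (Ht' : upper (tau + (-1)%R)%C) by now apply upper_shift.
        replace tau with (tau + (-1)%R + 1)%C by (replace (RtoC (-1)) with (- (1))%C by ring; ring).
        apply HT'; auto. apply (proj2 (IH _ Ht')).
        replace (tau + (-1)%R - INR n)%C with (tau - (INR n + 1))%C by (replace (RtoC (-1)) with (- (1))%C by ring; ring).
        exact H. }
  assert (Hz : forall (k : Z) tau, upper tau -> Q (tau + IZR k)%C -> Q tau).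
  { intros k tau Ht H. destruct (Z_le_gt_dec 0 k) as [Hk|Hk].
    - apply (proj1 (Hn (Z.to_nat k) tau Ht)). rewrite INR_IZR_INZ, Z2Nat.id by lia. exact H.
    - apply (proj2 (Hn (Z.to_nat (- k)) tau Ht)). rewrite INR_IZR_INZ, Z2Nat.id, opp_IZR, RtoC_opp by lia.
      replace (tau - - IZR k)%C with (tau + IZR k)%C by ring. exact H. }
  assert (Hpow : forall n tau, upper tau -> 3 / 4 <= Im tau * (16 / 13) ^ n -> Q tau).
  { induction n as [|n IH]; intros tau Ht H.
    - apply Hbase; auto. simpl in H. lra.
    - destruct (Rle_dec (3 / 4) (Im tau)) as [h|h]; [now apply Hbase|].
      set (k := (- up (Re tau - / 2))%Z).
      apply Hz with k; auto.
      assert (Ht' : upper (tau + IZR k)%C) by now apply upper_shift.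
      apply HS; auto. apply IH; [now apply upper_S|].
      rewrite Im_Sact by now apply upper_neq0.
      assert (Hk : Rabs (Re (tau + IZR k)%C) <= / 2).
      { unfold k. rewrite opp_IZR. simpl. destruct (archimed (Re tau - / 2)) as [A1 A2].
        unfold Re in *. apply Rabs_le. lra. }
      assert (M : Cmod (tau + IZR k)%C ^ 2 <= 13 / 16).
      { rewrite Cmod2_alt. rewrite <- (pow2_abs (Re _)).
        assert (Rabs (Re (tau + IZR k)%C) ^ 2 <= (/ 2) ^ 2) by (apply pow_incr; split; [apply Rabs_pos|auto]).
        replace (Im (tau + IZR k)%C) with (Im tau) by (unfold Im; simpl; ring).
        unfold upper in Ht. nra. }
      assert (M0 : 0 < Cmod (tau + IZR k)%C ^ 2) by (apply pow_lt, Cmod_gt_0, upper_neq0; auto).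
      replace (Im (tau + IZR k)%C) with (Im tau) by (unfold Im; simpl; ring).
      eapply Rle_trans; [exact H|]. simpl pow. rewrite <- Rmult_assoc.
      apply Rmult_le_compat_r; [apply pow_le; lra|]. unfold Rdiv at 2.
      apply Rmult_le_compat_l; [unfold upper in Ht; lra|].
      replace (16 / 13) with (/ (13 / 16)) by field. now apply Rinv_le_contravar. }
  intros tau Ht.
  destruct (Pow_x_infinity (16 / 13) ltac:(rewrite Rabs_pos_eq; lra) (3 / 4 / Im tau)) as [N HN].
  apply Hpow with N; auto. specialize (HN N (le_n N)).
  rewrite Rabs_pos_eq in HN by (apply pow_le; lra). unfold upper in Ht.
  apply Rge_le in HN. apply (Rmult_le_compat_l (Im tau)) in HN; [|lra].
  replace (Im tau * (3 / 4 / Im tau)) with (3 / 4) in HN by (field; lra). exact HN.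
Qed.

(** Classically [2 eta(tau)^6]; as a form in [thA] and [thB] its six roots are the vertices of an
    octahedron. *)
Definition thD (tau : C) : C := (thA tau * thB tau * (thB tau ^ 4 - thA tau ^ 4))%C.

Lemma Ci2 : (Ci * Ci)%C = (- (1))%C.
Proof. apply C_ext; simpl; ring. Qed.

Lemma Ci4 : (Ci ^ 4)%C = 1%C.
Proof. replace (Ci ^ 4)%C with ((Ci * Ci) * (Ci * Ci))%C by ring. rewrite Ci2. ring. Qed.

Lemma thD_T tau : upper tau -> thD (tau + 1) = (Ci * thD tau)%C.
Proof.
  intros Ht. unfold thD. rewrite thB_T, thA_T by assumption.
  replace ((Ci * thA tau) ^ 4)%C with (Ci ^ 4 * thA tau ^ 4)%C by ring. rewrite Ci4. ring.
Qed.

(** As [pi > 3], the exponent is at most [- 9/8], and [e^(9/8) >= (1 + 9/32)^4 > 5/2]. *)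
Lemma yq_le tau : 3 / 4 <= Im tau -> yq tau <= 2 / 5.
Proof.
  intros H. unfold yq. apply Rle_trans with (exp (- (9 / 8))).
  - apply exp_le_compat. assert (3 < PI) by (generalize PI2_3_2; lra). nra.
  - rewrite exp_Ropp. replace (2 / 5) with (/ (5 / 2)) by field. apply Rinv_le_contravar; [lra|].
    replace (exp (9 / 8)) with (exp (9 / 32) ^ 4) by (simpl; rewrite Rmult_1_r, <- !exp_plus; f_equal; field).
    apply Rle_trans with ((1 + 9 / 32) ^ 4); [lra|]. apply pow_incr. generalize (exp_ge_1_plus (9 / 32)). lra.
Qed.

Lemma th_bounds tau : upper tau -> yq tau <= 2 / 5 ->
  yq tau <= Cmod (thA tau) <= 2.1 * yq tau /\ 8 / 9 <= Cmod (thB tau) <= 10 / 9.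
Proof.
  intros Ht Hy. assert (y0 : 0 < yq tau) by apply exp_pos.
  pose proof (thA_bound tau Ht Hy) as HA. pose proof (thB_bound tau Ht Hy) as HB.
  set (y := yq tau) in *.
  assert (y4 : y ^ 4 <= (2 / 5) ^ 4) by (apply pow_incr; lra).
  assert (y8 : y ^ 8 <= (2 / 5) ^ 8) by (apply pow_incr; lra).
  assert (y9 : 4 * y ^ 9 <= 0.01 * y) by (simpl in *; nra).
  assert (Hx : Cmod (2 * xq tau) = 2 * y) by (rewrite Cmod_mult, Cmod_xq, Cmod_R, Rabs_pos_eq by lra; reflexivity).
  split.
  - assert (T1 := Cmod_triangle (thA tau - 2 * xq tau) (2 * xq tau)).
    replace (thA tau - 2 * xq tau + 2 * xq tau)%C with (thA tau) in T1 by ring.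
    assert (T2 := Cmod_triangle (- (thA tau - 2 * xq tau)) (thA tau)).
    replace (- (thA tau - 2 * xq tau) + thA tau)%C with (2 * xq tau)%C in T2 by ring.
    rewrite Cmod_opp in T2. lra.
  - assert (T1 := Cmod_triangle (thB tau - 1) 1).
    replace (thB tau - 1 + 1)%C with (thB tau) in T1 by ring.
    assert (T2 := Cmod_triangle (- (thB tau - 1)) (thB tau)).
    replace (- (thB tau - 1) + thB tau)%C with (RtoC 1) in T2 by ring.
    rewrite Cmod_opp in T2. rewrite Cmod_1 in *. lra.
Qed.

Lemma thD_neq0 tau : upper tau -> thD tau <> 0%C.
Proof.
  revert tau. apply upper_reduction.
  - intros tau Ht H. pose proof (th_bounds tau Ht (yq_le tau H)) as [HA HB].
    pose proof (yq_le tau H) as Hy. assert (y0 : 0 < yq tau) by apply exp_pos.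
    unfold thD. repeat apply Cmult_neq_0.
    + intros E. rewrite E, Cmod_0 in HA. lra.
    + intros E. rewrite E, Cmod_0 in HB. lra.
    + intros E. assert (E4 : (thB tau ^ 4)%C = (thA tau ^ 4)%C).
      { replace (thB tau ^ 4)%C with (thB tau ^ 4 - thA tau ^ 4 + thA tau ^ 4)%C by ring. rewrite E. ring. }
      apply (f_equal Cmod) in E4. rewrite !Cmod_pow in E4.
      (* Here 0.84 is [2.1 * 2/5], which stays below 8/9. *)
      assert (L : Cmod (thA tau) ^ 4 <= (0.84) ^ 4) by (apply pow_incr; lra).
      assert (U : (8 / 9) ^ 4 <= Cmod (thB tau) ^ 4) by (apply pow_incr; lra). lra.
  - intros tau Ht H E. apply H. rewrite thD_T, E by assumption. ring.
  - intros tau Ht H E. rewrite thD_T in E by assumption. apply Cmult_integral in E. destruct E as [E|E]; auto.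
    apply (f_equal Cmod) in E. rewrite Cmod_Ci, Cmod_0 in E. lra.
  (* The value of [thD] at [Sact tau] is [8 c^6 thD tau], so non-vanishing passes to [tau] even
     though [c] might be 0. *)
  - intros tau Ht H E. apply H. destruct (th_S tau Ht) as [c [H0 H1]].
    transitivity (8 * c ^ 6 * thD tau)%C; [|rewrite E; ring].
    unfold thD. rewrite H0, H1. ring.
Qed.

Lemma thAB_neq0 tau : upper tau ->
  thA tau <> 0%C /\ thB tau <> 0%C /\ (thB tau + thA tau)%C <> 0%C /\ (thB tau - thA tau)%C <> 0%C.
Proof.
  intros Ht. pose proof (thD_neq0 tau Ht) as H. unfold thD in H.
  repeat split; intros E; apply H.
  - rewrite E. ring.
  - rewrite E. ring.
  - transitivity (thA tau * thB tau * ((thB tau + thA tau) * (thB tau - thA tau) * (thB tau ^ 2 + thA tau ^ 2)))%C;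
    [ring|rewrite E; ring].
  - transitivity (thA tau * thB tau * ((thB tau + thA tau) * (thB tau - thA tau) * (thB tau ^ 2 + thA tau ^ 2)))%C;
    [ring|rewrite E; ring].
Qed.

(** * The function [uq] and its relation to [chi] *)

Definition uq (tau : C) : C := (thA tau / thB tau)%C.

Lemma uq_T tau : upper tau -> uq (tau + 1) = (Ci * uq tau)%C.
Proof.
  intros Ht. unfold uq. rewrite thA_T, thB_T by assumption. field. now apply thAB_neq0.
Qed.

Lemma uq_neq tau : upper tau -> uq tau <> 0%C /\ (1 + uq tau)%C <> 0%C /\ (1 - uq tau)%C <> 0%C /\
  (1 - uq tau ^ 4)%C <> 0%C.
Proof.
  intros Ht. destruct (thAB_neq0 tau Ht) as [H1 [H2 [H3 H4]]]. unfold uq.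
  assert (E : forall z, (thB tau * z)%C <> 0%C -> z <> 0%C) by (intros z Hz E; apply Hz; rewrite E; ring).
  repeat split.
  - apply E. replace (thB tau * (thA tau / thB tau))%C with (thA tau) by (field; auto). auto.
  - apply E. replace (thB tau * (1 + thA tau / thB tau))%C with (thB tau + thA tau)%C by (field; auto). auto.
  - apply E. replace (thB tau * (1 - thA tau / thB tau))%C with (thB tau - thA tau)%C by (field; auto). auto.
  - intros X. apply (thD_neq0 tau Ht). unfold thD.
    replace (thB tau ^ 4 - thA tau ^ 4)%C with (thB tau ^ 4 * (1 - (thA tau / thB tau) ^ 4))%C by (field; auto).
    rewrite X. ring.
Qed.

Lemma uq_S tau : upper tau -> uq (Sact tau) = ((1 - uq tau) / (1 + uq tau))%C.
Proof.
  intros Ht. destruct (th_S tau Ht) as [c [H0 H1]].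
  destruct (thAB_neq0 tau Ht) as [T1 [T2 [T3 T4]]].
  destruct (thAB_neq0 _ (upper_S _ Ht)) as [S1 [S2 [S3 S4]]].
  assert (c0 : c <> 0%C) by (intros E; apply S1; rewrite H0, E; ring).
  unfold uq. rewrite H0, H1. field. auto.
Qed.

Lemma chi_uq tau : upper tau -> chi tau = ((uq tau - 1) / (uq tau + 1))%C.
Proof.
  intros Ht. destruct (thAB_neq0 tau Ht) as [T1 [T2 [T3 T4]]].
  unfold chi. rewrite theta3_half, theta4_half by assumption. unfold uq. field.
  rewrite Cplus_comm. auto.
Qed.

Lemma uq_chi tau : upper tau -> uq tau = ((1 + chi tau) / (1 - chi tau))%C.
Proof.
  intros Ht. rewrite chi_uq by assumption. destruct (uq_neq tau Ht) as [_ [H [_ _]]].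
  rewrite Cplus_comm in H. field. split; auto.
  replace (uq tau + 1 - (uq tau - 1))%C with (RtoC 2) by ring. apply C2_neq0.
Qed.

Lemma chi_eq_iff tau tau' : upper tau -> upper tau' -> chi tau = chi tau' <-> uq tau = uq tau'.
Proof.
  intros H H'. split; intros E; [rewrite !uq_chi | rewrite !chi_uq]; auto; now rewrite E.
Qed.

(** * Continuity on the half-plane *)

Definition ccont (f : C -> C) (z : C) : Prop :=
  forall eps, 0 < eps -> exists d, 0 < d /\ forall w, Cmod (w - z) < d -> Cmod (f w - f z) < eps.

Lemma ccont_plus f g z : ccont f z -> ccont g z -> ccont (fun w => f w + g w)%C z.
Proof.
  intros Hf Hg eps He. destruct (Hf (eps / 2) ltac:(lra)) as [d [Hd H]], (Hg (eps / 2) ltac:(lra)) as [e [He' H']].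
  exists (Rmin d e). split; [now apply Rmin_glb_lt|]. intros w Hw.
  specialize (H w (Rlt_le_trans _ _ _ Hw (Rmin_l _ _))). specialize (H' w (Rlt_le_trans _ _ _ Hw (Rmin_r _ _))).
  replace (f w + g w - (f z + g z))%C with ((f w - f z) + (g w - g z))%C by ring.
  eapply Rle_lt_trans; [apply Cmod_triangle|]. lra.
Qed.

(** Common core of the product rules for [ccont] and [cusp_lim]. *)
Lemma Cmult_near (a b : C) eps : 0 < eps -> exists e, 0 < e /\ forall x y,
  Cmod (x - a) < e -> Cmod (y - b) < e -> Cmod (x * y - a * b) < eps.
Proof.
  intros He. pose proof (Cmod_ge_0 a) as F0. pose proof (Cmod_ge_0 b) as G0.
  set (e := Rmin 1 (eps / (2 + Cmod a + Cmod b))).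
  assert (D0 : 0 < eps / (2 + Cmod a + Cmod b)) by (apply Rdiv_lt_0_compat; lra).
  assert (e0 : 0 < e) by (apply Rmin_glb_lt; lra).
  assert (e1 : e <= 1) by apply Rmin_l.
  assert (e2 : e * (2 + Cmod a + Cmod b) <= eps).
  { apply Rle_trans with (eps / (2 + Cmod a + Cmod b) * (2 + Cmod a + Cmod b)).
    apply Rmult_le_compat_r; [lra|apply Rmin_r]. right. field. lra. }
  exists e. split; auto. intros x' y' Hx Hy.
  set (x := (x' - a)%C) in *. set (y := (y' - b)%C) in *.
  replace (x' * y' - a * b)%C with (x * y + (x * b + a * y))%C by (unfold x, y; ring).
  eapply Rle_lt_trans; [apply Cmod_triangle|].
  eapply Rle_lt_trans; [apply Rplus_le_compat_l, Cmod_triangle|]. rewrite !Cmod_mult.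
  pose proof (Cmod_ge_0 x). pose proof (Cmod_ge_0 y).
  assert (Cmod x * Cmod y <= e * 1) by (apply Rmult_le_compat; lra).
  assert (Cmod x * Cmod b <= e * Cmod b) by (apply Rmult_le_compat_r; lra).
  assert (Cmod a * Cmod y <= e * Cmod a) by (rewrite Rmult_comm; apply Rmult_le_compat_r; lra).
  lra.
Qed.

Lemma ccont_mult f g z : ccont f z -> ccont g z -> ccont (fun w => f w * g w)%C z.
Proof.
  intros Hf Hg eps He. destruct (Cmult_near (f z) (g z) eps He) as [e [e0 Hm]].
  destruct (Hf e e0) as [d [Hd H]], (Hg e e0) as [d' [Hd' H']].
  exists (Rmin d d'). split; [now apply Rmin_glb_lt|]. intros w Hw.
  apply Hm; [apply H | apply H']; apply (Rlt_le_trans _ _ _ Hw); [apply Rmin_l | apply Rmin_r].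
Qed.

Lemma ccont_pow f z n : ccont f z -> ccont (fun w => f w ^ n)%C z.
Proof.
  intros Hf. induction n as [|n IH].
  - intros eps He. exists 1. split; [lra|]. intros w _. simpl. replace (1 - 1)%C with (RtoC 0) by ring. now rewrite Cmod_0.
  - exact (ccont_mult _ _ _ Hf IH).
Qed.

Lemma ccont_comp f g z : ccont g z -> ccont f (g z) -> ccont (fun w => f (g w)) z.
Proof.
  intros Hg Hf eps He. destruct (Hf eps He) as [d [Hd H]]. destruct (Hg d Hd) as [e [He' H']].
  exists e. split; auto.
Qed.

Lemma ccont_shift (c z : C) : ccont (fun w => w + c)%C z.
Proof.
  intros eps He. exists eps. split; auto. intros w Hw. replace (w + c - (z + c))%C with (w - z)%C by ring. exact Hw.
Qed.

Lemma ccont_Sact (z : C) : z <> 0%C -> ccont Sact z.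
Proof.
  intros Hz eps He. assert (z0 : 0 < Cmod z) by now apply Cmod_gt_0.
  exists (Rmin (Cmod z / 2) (eps * (Cmod z * (Cmod z / 2)))).
  assert (m0 : 0 < Cmod z * (Cmod z / 2)) by nra.
  split; [apply Rmin_glb_lt; nra|]. intros w Hw.
  assert (W1 := Rlt_le_trans _ _ _ Hw (Rmin_l _ _)). assert (W2 := Rlt_le_trans _ _ _ Hw (Rmin_r _ _)).
  assert (w1 : Cmod z / 2 <= Cmod w).
  { assert (T := Cmod_triangle w (- (w - z))). replace (w + - (w - z))%C with z in T by ring.
    rewrite Cmod_opp in T. lra. }
  assert (wn : w <> 0%C) by (apply Cmod_gt_0; lra).
  unfold Sact. replace (- (1) / w - - (1) / z)%C with ((w - z) / (z * w))%C by (field; auto).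
  rewrite Cmod_div by now apply Cmult_neq_0. rewrite Cmod_mult.
  assert (Z : 0 < Cmod z * Cmod w) by nra.
  apply Rmult_lt_reg_r with (Cmod z * Cmod w); auto. unfold Rdiv. rewrite Rmult_assoc, Rinv_l, Rmult_1_r by lra.
  eapply Rlt_le_trans; [exact W2|]. apply Rmult_le_compat_l; [lra|]. apply Rmult_le_compat_l; lra.
Qed.

(** A Lipschitz bound. A term of size [e^(- t0 v)] changes by the factor [e^e - 1] with
    [|e| <= t0 v / 4]; bounding this factor costs three times [exp (t0 v / 4)], which leaves exactly
    the term of the convergent series at [i t0 / 4]. *)
Lemma ccont_Theta (x : R) tau : upper tau -> ccont (fun w => Theta x w) tau.
Proof.
  intros Ht. unfold upper in Ht. set (t0 := Im tau) in *. pose proof PI_RGT_0 as HP.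
  set (tau4 := (Ci * (t0 / 4))%C).
  assert (E4 : tau4 = (Ci * RtoC (t0 / 4))%C).
  { unfold tau4, Rdiv. rewrite RtoC_mult, RtoC_inv by lra. reflexivity. }
  assert (Im4 : Im tau4 = t0 / 4) by (rewrite E4; simpl; ring).
  assert (Re4 : Re tau4 = 0) by (rewrite E4; simpl; ring).
  assert (U4 : upper tau4) by (unfold upper; rewrite Im4; lra).
  destruct (gterm_dom x tau4 U4) as [M HM].
  pose proof (zdom_nonneg _ _ HM) as M0.
  set (L := 28 / t0 * M). assert (L0 : 0 <= L).
  { unfold L. apply Rmult_le_pos; auto. left. apply Rdiv_lt_0_compat; lra. }
  assert (Lip : forall w, Cmod (w - tau) <= t0 / 4 -> Cmod (Theta x w - Theta x tau) <= 4 * (L * Cmod (w - tau))).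
  { intros w Hw. set (d := (w - tau)%C) in *.
    assert (Uw : upper w).
    { unfold upper.
      assert (I2 : Rabs (Im w - t0) <= t0 / 4).
      { eapply Rle_trans; [|exact Hw]. replace (Im w - t0) with (Im d) by (unfold d, t0, Im; simpl; ring). apply Im_le_Cmod. }
      apply Rabs_le_between in I2. lra. }
    destruct (gterm_dom x w Uw) as [K HK]. destruct (gterm_dom x tau Ht) as [K0 HK0].
    replace (Theta x w - Theta x tau)%C with (zsum (fun n => gterm x w n + - (1) * gterm x tau n)%C).
    2:{ rewrite (zsum_plus _ _ _ _ HK (zdom_scal (- (1))%C _ _ HK0)), (zsum_scal _ _ _ HK0). unfold Theta. ring. }
    apply zsum_bound. intros n. specialize (HM n).
    set (e := (2 * PI * Ci * d * (x + IZR n) ^ 2)%C).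
    replace (gterm x w n + - (1) * gterm x tau n)%C with (gterm x tau n * (Cexp e - 1))%C.
    2:{ unfold gterm. replace (2 * PI * Ci * w * (x + IZR n) ^ 2)%C with (2 * PI * Ci * tau * (x + IZR n) ^ 2 + e)%C
          by (unfold e, d; ring). rewrite Cexp_plus. ring. }
    rewrite Cmod_mult.
    set (v := 2 * PI * (x + IZR n) ^ 2). assert (v0 : 0 <= v) by (unfold v; generalize (pow2_ge_0 (x + IZR n)); nra).
    assert (G : Cmod (gterm x tau n) = exp (- (t0 * v))).
    { unfold gterm. rewrite Cmod_Cexp, Re_gexp. f_equal. unfold v, t0. simpl. ring. }
    assert (G4 : Cmod (gterm x tau4 n) = exp (- (t0 / 4 * v))).
    { unfold gterm. rewrite Cmod_Cexp, Re_gexp, Im4, Re4. f_equal. unfold v. simpl. field. }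
    assert (Ce : Cmod e = v * Cmod d).
    { unfold e. rewrite !Cmod_mult, Cmod_pow, <- RtoC_plus, Cmod_Ci, !Cmod_R, (Rabs_pos_eq 2), (Rabs_pos_eq PI), pow2_abs by lra.
      unfold v. ring. }
    assert (d0 := Cmod_ge_0 d).
    assert (E := Cexp_minus_1_bound e). rewrite Ce in E.
    set (q := t0 / 4 * v) in *. assert (q0 : 0 <= q) by (unfold q; apply Rmult_le_pos; lra).
    assert (vq : v * Cmod d <= q) by (unfold q; nra).
    assert (Ev : v = 4 / t0 * q) by (unfold q; field; lra).
    (* The three factors [exp q] dominate, up to [4 / t0] and [|d|], the three factors [|e|],
       [1 + |e|] and [exp |e|]. *)
    assert (B1 : Cmod (Cexp e - 1) <= 7 * (4 / t0) * Cmod d * (exp q * (exp q * exp q))).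
    { eapply Rle_trans; [exact E|].
      pose proof (exp_ge_1_plus q). pose proof (exp_pos q).
      assert (X1 : exp (v * Cmod d) <= exp q) by now apply exp_le_compat.
      replace (7 * (4 / t0) * Cmod d * (exp q * (exp q * exp q))) with (7 * ((4 / t0) * exp q * Cmod d) * exp q * exp q) by ring.
      assert (X0 := exp_pos (v * Cmod d)).
      assert (vd : 0 <= v * Cmod d) by now apply Rmult_le_pos.
      assert (t4 : 0 < 4 / t0) by (apply Rdiv_lt_0_compat; lra).
      assert (v * Cmod d <= 4 / t0 * exp q * Cmod d).
      { rewrite Ev. apply Rmult_le_compat_r; auto. apply Rmult_le_compat_l; lra. }
      apply Rmult_le_compat; try lra. apply Rmult_le_pos; lra.
      apply Rmult_le_compat; lra. }
    assert (Q : exp (- (t0 * v)) * (exp q * (exp q * exp q)) = Cmod (gterm x tau4 n)).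
    { rewrite G4, <- !exp_plus. f_equal. unfold q. field. }
    apply Rle_trans with (exp (- (t0 * v)) * (7 * (4 / t0) * Cmod d * (exp q * (exp q * exp q)))).
    - rewrite G. apply Rmult_le_compat_l; auto. left; apply exp_pos.
    - replace (exp (- (t0 * v)) * (7 * (4 / t0) * Cmod d * (exp q * (exp q * exp q)))) with
        (28 / t0 * Cmod d * (exp (- (t0 * v)) * (exp q * (exp q * exp q)))) by (field; lra).
      rewrite Q. unfold L.
      replace (28 / t0 * M * Cmod d * exp (- Rabs (IZR n))) with (28 / t0 * Cmod d * (M * exp (- Rabs (IZR n)))) by ring.
      apply Rmult_le_compat_l; auto. apply Rmult_le_pos; auto. left. apply Rdiv_lt_0_compat; lra. }
  intros eps He. exists (Rmin (t0 / 4) (eps / (4 * L + 1))).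
  assert (e0 : 0 < eps / (4 * L + 1)) by (apply Rdiv_lt_0_compat; lra).
  split; [apply Rmin_glb_lt; lra|]. intros w Hw.
  assert (W1 := Rlt_le_trans _ _ _ Hw (Rmin_l _ _)). assert (W2 := Rlt_le_trans _ _ _ Hw (Rmin_r _ _)).
  eapply Rle_lt_trans; [apply Lip; lra|].
  assert (X : Cmod (w - tau) * (4 * L + 1) < eps).
  { apply Rmult_lt_reg_r with (/ (4 * L + 1)); [apply Rinv_0_lt_compat; lra|].
    rewrite Rmult_assoc, Rinv_r by lra. rewrite Rmult_1_r. exact W2. }
  pose proof (Cmod_ge_0 (w - tau)). lra.
Qed.

Lemma ccont_ex_derive (f : C -> C) z : ex_derive (K := C_AbsRing) f z -> ccont f z.
Proof.
  intros H. apply ex_derive_continuous in H. intros eps He.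
  assert (He2 : 0 < eps / 2) by lra.
  assert (L := proj1 (filterlim_locally f (f z)) H (mkposreal _ He2)).
  destruct L as [d Hd]. exists d. split; [apply cond_pos|]. intros w Hw.
  specialize (Hd w Hw). apply C_NormedModule_mixin_compat2 in Hd. simpl in Hd.
  change (Cmod (f w - f z) < sqrt 2 * (eps / 2)) in Hd.
  (* Balls in the target are squares, whence [sqrt 2]; starting from [eps / 2] pays for it. *)
  assert (sqrt 2 <= 2).
  { rewrite <- (sqrt_square 2) at 2 by lra. apply sqrt_le_1; lra. }
  nra.
Qed.

Definition segment (a b : C) (t : R) : C := (a + t * (b - a))%C.

Lemma segment_upper a b t : upper a -> upper b -> 0 <= t <= 1 -> upper (segment a b t).
Proof.
  unfold upper, segment. intros Ha Hb Ht.
  replace (Im (a + t * (b - a))%C) with ((1 - t) * Im a + t * Im b) by (unfold Im; simpl; ring).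
  destruct (Req_dec t 0) as [->|]; [lra|].
  assert (0 <= (1 - t) * Im a) by (apply Rmult_le_pos; lra).
  assert (0 < t * Im b) by (apply Rmult_lt_0_compat; lra). lra.
Qed.

Lemma segment_continuity_pt (h : C -> C) a b t : ccont h (segment a b t) ->
  continuity_pt (fun s => Re (h (segment a b s))) t.
Proof.
  intros H eps He. destruct (H eps He) as [d [Hd Hh]].
  pose proof (Cmod_ge_0 (b - a)) as c0.
  exists (d / (Cmod (b - a) + 1)). split; [apply Rdiv_lt_0_compat; lra|].
  intros s [_ Hs]. simpl in *. unfold R_dist in *.
  eapply Rle_lt_trans; [apply (re_le_Cmod (h (segment a b s) - h (segment a b t)))|].
  apply Hh. unfold segment.
  replace (a + s * (b - a) - (a + t * (b - a)))%C with ((s - t)%R * (b - a))%C by (rewrite RtoC_minus; ring).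
  rewrite Cmod_mult, Cmod_R.
  assert (X : Rabs (s - t) * (Cmod (b - a) + 1) < d).
  { apply Rmult_lt_reg_r with (/ (Cmod (b - a) + 1)); [apply Rinv_0_lt_compat; lra|].
    rewrite Rmult_assoc, Rinv_r by lra. rewrite Rmult_1_r. exact Hs. }
  pose proof (Rabs_pos (s - t)). lra.
Qed.

Lemma ccont_conj f z : ccont f z -> ccont (fun w => Cconj (f w)) z.
Proof.
  intros H eps He. destruct (H eps He) as [d [Hd Hf]]. exists d. split; auto. intros w Hw.
  replace (Cconj (f w) - Cconj (f z))%C with (Cconj (f w - f z)) by (apply C_ext; simpl; ring).
  rewrite Cmod_conj. auto.
Qed.

Lemma C_eq_opp (z : C) : z = (- z)%C -> z = 0%C.
Proof.
  intros E. transitivity ((z + z) / 2)%C; [field|]. rewrite E at 1. field.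
Qed.

Lemma upper_Ci : upper Ci.
Proof. unfold upper; simpl; lra. Qed.

(* [F / G] is a continuous square root of a constant: along a segment, the real part
   of [F] times the conjugate of [k G] cannot change sign without vanishing. *)
Lemma proportional_of_squares (F G : C -> C) (k2 : C) :
  (forall tau, upper tau -> ccont F tau) -> (forall tau, upper tau -> ccont G tau) ->
  (forall tau, upper tau -> G tau <> 0%C) ->
  (forall tau, upper tau -> (F tau ^ 2 = k2 * G tau ^ 2)%C) -> k2 <> 0%C ->
  exists k, (k ^ 2 = k2)%C /\ forall tau, upper tau -> F tau = (k * G tau)%C.
Proof.
  intros HF HG HG0 Hsq Hk2.
  pose proof upper_Ci as Ui.
  set (k := (F Ci / G Ci)%C).
  assert (kk : (k ^ 2 = k2)%C).
  { unfold k. replace ((F Ci / G Ci) ^ 2)%C with (F Ci ^ 2 / G Ci ^ 2)%C by (field; auto).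
    rewrite Hsq by auto. field. auto. }
  assert (k0 : k <> 0%C) by (intros E; apply Hk2; rewrite <- kk, E; ring).
  exists k. split; auto. intros tau Ht.
  assert (Hpm : forall w, upper w -> F w = (k * G w)%C \/ F w = (- (k * G w))%C).
  { intros w Hw.
    assert (E : ((F w - k * G w) * (F w + k * G w) = 0)%C).
    { transitivity (F w ^ 2 - k ^ 2 * G w ^ 2)%C; [ring|]. rewrite Hsq, kk by auto. ring. }
    apply Cmult_integral in E. destruct E as [E|E]; [left|right].
    - replace (F w) with (F w - k * G w + k * G w)%C by ring. rewrite E. ring.
    - replace (F w) with (F w + k * G w - k * G w)%C by ring. rewrite E. ring. }
  destruct (Hpm tau Ht) as [E|E]; auto. exfalso.
  set (h := fun w => (F w * Cconj (k * G w))%C).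
  assert (Hh : forall w, upper w -> (F w = (k * G w)%C /\ Re (h w) = Cmod (k * G w) ^ 2) \/ (F w = (- (k * G w))%C /\ Re (h w) = - Cmod (k * G w) ^ 2)).
  { intros w Hw. destruct (Hpm w Hw) as [X|X]; [left|right]; split; auto; unfold h; rewrite X.
    - rewrite <- Cmod2_conj. simpl. ring.
    - replace (- (k * G w) * Cconj (k * G w))%C with (- (k * G w * Cconj (k * G w)))%C by ring.
      rewrite <- Cmod2_conj. simpl. ring. }
  assert (Hpos : forall w, upper w -> 0 < Cmod (k * G w) ^ 2).
  { intros w Hw. apply pow_lt, Cmod_gt_0, Cmult_neq_0; auto. }
  destruct (IVT_interv (fun t => - Re (h (segment Ci tau t))) 0 1) as [t [Ht1 Ht2]].
  - intros t Ht'. apply continuity_pt_opp. apply segment_continuity_pt.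
    pose proof (segment_upper Ci tau t Ui Ht Ht'). unfold h.
    apply ccont_mult; [now apply HF|]. apply ccont_conj.
    apply (ccont_mult (fun _ => k) G); [|now apply HG].
    intros eps He. exists 1. split; [lra|]. intros. replace (k - k)%C with (RtoC 0) by ring. now rewrite Cmod_0.
  - lra.
  - replace (segment Ci tau 0) with Ci by (unfold segment; ring).
    assert (X : F Ci = (k * G Ci)%C) by (unfold k; field; auto).
    destruct (Hh Ci Ui) as [[_ Y]|[Y _]]; [rewrite Y; generalize (Hpos Ci Ui); lra|].
    exfalso. rewrite X in Y. apply C_eq_opp, Cmult_integral in Y.
    destruct Y as [Y|Y]; [auto | now apply (HG0 Ci Ui)].
  - replace (segment Ci tau 1) with tau by (unfold segment; ring).
    destruct (Hh tau Ht) as [[Y _]|[_ Y]]; [|rewrite Y; generalize (Hpos tau Ht); lra].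
    exfalso. rewrite E in Y. symmetry in Y. apply C_eq_opp, Cmult_integral in Y.
    destruct Y as [Y|Y]; [auto | now apply (HG0 tau Ht)].
  - pose proof (segment_upper Ci tau t Ui Ht Ht1) as U. pose proof (Hpos _ U).
    destruct (Hh _ U) as [[_ Y]|[_ Y]]; lra.
Qed.

(** * The signs of [phi] *)

(** Stated for maps rather than matrices, so that it can be conjugated directly by [Sact] and by
    translation. Invariance of [uq] is included because the conjugation lemmas depend on it. *)
Definition flips (phi : C -> C) (g : C -> C) : Prop := forall tau, upper tau ->
  upper (g tau) /\ uq (g tau) = uq tau /\ phi (g tau) = (- phi tau)%C.

Section Burnside_phi.
Variable phi : C -> C.
Hypothesis Hphi : is_burnside_phi phi.

Let Psi (tau : C) : C := (phi tau * (thB tau + thA tau) ^ 3)%C.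

Lemma ccont_thA tau : upper tau -> ccont thA tau.
Proof. apply ccont_Theta. Qed.

Lemma ccont_thB tau : upper tau -> ccont thB tau.
Proof. apply ccont_Theta. Qed.

Lemma ccont_thAB tau : upper tau -> ccont (fun w => (thB w + thA w) ^ 3)%C tau.
Proof. intros H. apply ccont_pow, ccont_plus; [now apply ccont_thB | now apply ccont_thA]. Qed.

Lemma ccont_Psi tau : upper tau -> ccont Psi tau.
Proof.
  intros H. apply ccont_mult; [|now apply ccont_thAB].
  apply ccont_ex_derive. now apply (proj1 Hphi).
Qed.

(** With [x = (A - B) / (A + B)] one has [(A + B)^6 (x^5 - x) = 8 A B (B^4 - A^4)]. *)
Lemma Psi_sq tau : upper tau -> (Psi tau ^ 2 = 8 * thD tau)%C.
Proof.
  intros Ht. destruct (thAB_neq0 tau Ht) as [H1 [H2 [H3 H4]]].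
  unfold Psi. transitivity (phi tau ^ 2 * (thB tau + thA tau) ^ 6)%C; [ring|].
  rewrite (proj2 Hphi tau Ht). unfold chi. rewrite theta3_half, theta4_half by assumption.
  unfold thD. field. rewrite Cplus_comm. exact H3.
Qed.

Lemma Psi_neq0 tau : upper tau -> Psi tau <> 0%C.
Proof.
  intros Ht E. apply (thD_neq0 tau Ht).
  assert (X := Psi_sq tau Ht). rewrite E in X.
  replace (thD tau) with (8 * thD tau / 8)%C by field.
  rewrite <- X. field.
Qed.

Lemma Psi_T : exists k, (k ^ 2 = Ci)%C /\ forall tau, upper tau -> Psi (tau + 1) = (k * Psi tau)%C.
Proof.
  apply (proportional_of_squares (fun tau => Psi (tau + 1)) Psi Ci).
  - intros tau Ht. apply (ccont_comp Psi (fun w => w + 1)%C); [apply ccont_shift|].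
    apply ccont_Psi. now apply upper_shift.
  - exact ccont_Psi.
  - exact Psi_neq0.
  - intros tau Ht. rewrite !Psi_sq, thD_T by (try apply upper_shift; assumption). ring.
  - intros E. apply (f_equal Cmod) in E. rewrite Cmod_Ci, Cmod_0 in E. lra.
Qed.

Lemma uq_T4 tau : upper tau -> uq (tau + 4) = uq tau.
Proof.
  intros Ht. replace (tau + 4)%C with (tau + 1 + 1 + 1 + 1)%C by ring.
  rewrite !uq_T by (repeat apply upper_shift; assumption).
  transitivity (Ci ^ 4 * uq tau)%C; [ring|]. rewrite Ci4. ring.
Qed.

(* [k ^ 2 = i] in [Psi_T] forces [k ^ 4 = -1]. *)
Lemma flips_T4 : flips phi (fun tau => tau + 4)%C.
Proof.
  destruct Psi_T as [k [k2 Hk]]. intros tau Ht.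
  split; [now apply upper_shift|]. split; [now apply uq_T4|].
  assert (E : Psi (tau + 4) = (- Psi tau)%C).
  { replace (tau + 4)%C with (tau + 1 + 1 + 1 + 1)%C by ring.
    rewrite !Hk by (repeat apply upper_shift; assumption).
    transitivity (k ^ 2 * k ^ 2 * Psi tau)%C; [ring|]. rewrite k2, Ci2. ring. }
  unfold Psi in E.
  assert (EA : thA (tau + 4) = thA tau).
  { replace (tau + 4)%C with (tau + 1 + 1 + 1 + 1)%C by ring.
    rewrite !thA_T by (repeat apply upper_shift; assumption).
    transitivity (Ci ^ 4 * thA tau)%C; [ring|]. rewrite Ci4. ring. }
  assert (EB : thB (tau + 4) = thB tau).
  { replace (tau + 4)%C with (tau + 1 + 1 + 1 + 1)%C by ring. now rewrite !thB_T. }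
  rewrite EA, EB in E. destruct (thAB_neq0 tau Ht) as [_ [_ [H3 _]]].
  replace (phi (tau + 4)) with (phi (tau + 4) * (thB tau + thA tau) ^ 3 / (thB tau + thA tau) ^ 3)%C by (field; auto).
  rewrite E. field. auto.
Qed.

Lemma phi_S : exists k, forall tau, upper tau -> phi (Sact tau) = (k * phi tau * (1 + uq tau) ^ 3)%C.
Proof.
  (* The extra cubes are chosen so that both squares contain the unknown [c] to the power 6; it
     cancels and the ratio of the squares is the constant 8. *)
  destruct (proportional_of_squares (fun tau => Psi (Sact tau) * (thB tau + thA tau) ^ 3)%C
     (fun tau => Psi tau * thB (Sact tau) ^ 3)%C 8) as [k [_ Hk]].
  - intros tau Ht. apply ccont_mult; [|now apply ccont_thAB].
    apply (ccont_comp Psi Sact); [apply ccont_Sact, upper_neq0, Ht | apply ccont_Psi, upper_S, Ht].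
  - intros tau Ht. apply ccont_mult; [now apply ccont_Psi|]. apply ccont_pow.
    apply (ccont_comp thB Sact); [apply ccont_Sact, upper_neq0, Ht | apply ccont_thB, upper_S, Ht].
  - intros tau Ht. apply Cmult_neq_0; [now apply Psi_neq0|]. apply Cpow_nz.
    now apply (thAB_neq0 _ (upper_S _ Ht)).
  - intros tau Ht. destruct (th_S tau Ht) as [c [HA HB]].
    transitivity (Psi (Sact tau) ^ 2 * (thB tau + thA tau) ^ 6)%C; [ring|].
    transitivity (8 * (Psi tau ^ 2 * thB (Sact tau) ^ 6))%C; [|ring].
    rewrite !Psi_sq by (try apply upper_S; assumption). unfold thD. rewrite HA, HB. ring.
  - intros Y; apply RtoC_inj in Y; lra.
  - exists (k / 8)%C. intros tau Ht. specialize (Hk tau Ht). unfold Psi in Hk.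
    destruct (th_S tau Ht) as [c [HA HB]]. rewrite HA, HB in Hk.
    destruct (thAB_neq0 tau Ht) as [H1 [H2 [H3 H4]]].
    assert (c0 : c <> 0%C).
    { intros E. destruct (thAB_neq0 _ (upper_S _ Ht)) as [N _]. apply N. rewrite HA, E. ring. }
    set (a := thA tau) in *. set (b := thB tau) in *.
    assert (n8 : RtoC 8 <> 0%C) by (intros Y; apply RtoC_inj in Y; lra).
    assert (X : (phi (Sact tau) * (8 * c ^ 3 * b ^ 3 * (b + a) ^ 3) = k * phi tau * (b + a) ^ 3 * (c * (b + a)) ^ 3)%C).
    { transitivity (phi (Sact tau) * (c * (b + a) + c * (b - a)) ^ 3 * (b + a) ^ 3)%C; [ring|].
      rewrite Hk. ring. }
    assert (N : (8 * c ^ 3 * b ^ 3 * (b + a) ^ 3)%C <> 0%C) by (apply Cmult_neq_0; [apply Cmult_neq_0; [apply Cmult_neq_0; [exact n8|]|]|]; now apply Cpow_nz).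
    transitivity (phi (Sact tau) * (8 * c ^ 3 * b ^ 3 * (b + a) ^ 3) / (8 * c ^ 3 * b ^ 3 * (b + a) ^ 3))%C; [field; auto|].
    rewrite X. unfold uq. fold a b. field. auto.
Qed.

Lemma Sact_involutive tau : upper tau -> Sact (Sact tau) = tau.
Proof.
  intros H. unfold Sact. field. now apply upper_neq0.
Qed.

(** The factor in [phi_S] depends on [tau] only through [uq], which [g] preserves, so it cancels in
    the conjugate. This takes [V0] to [V1]; the translation analogue then takes each later [V_j] to
    the next. *)
Lemma flips_conj_S g : flips phi g -> flips phi (fun tau => Sact (g (Sact tau))).
Proof.
  intros Hg tau Ht. destruct phi_S as [k Hk].
  pose proof (upper_S _ Ht) as HS. destruct (Hg _ HS) as [G1 [G2 G3]].
  split; [now apply upper_S|]. split.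
  - rewrite uq_S, G2, <- uq_S, Sact_involutive by assumption. reflexivity.
  - rewrite Hk, G2, G3 by assumption. rewrite <- (Sact_involutive tau Ht) at 3.
    rewrite (Hk _ HS). ring.
Qed.

Lemma phi_T : exists k, forall tau, upper tau ->
  phi (tau + 1) = (k * phi tau * ((1 + uq tau) / (1 + Ci * uq tau)) ^ 3)%C.
Proof.
  destruct Psi_T as [k [_ Hk]]. exists k. intros tau Ht. specialize (Hk tau Ht). unfold Psi in Hk.
  rewrite thB_T, thA_T in Hk by assumption.
  destruct (thAB_neq0 tau Ht) as [H1 [H2 [H3 H4]]].
  destruct (thAB_neq0 _ (upper_shift _ 1 Ht)) as [_ [_ [H5 _]]]. rewrite thB_T, thA_T in H5 by assumption.
  set (a := thA tau) in *. set (b := thB tau) in *.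
  transitivity (phi (tau + 1) * (b + Ci * a) ^ 3 / (b + Ci * a) ^ 3)%C; [field; auto|].
  rewrite Hk. unfold uq. fold a b. field. split; auto.
Qed.

Lemma flips_conj_T g : flips phi g -> flips phi (fun tau => g (tau + (-1)%R) + 1)%C.
Proof.
  intros Hg tau Ht. destruct phi_T as [k Hk].
  pose proof (upper_shift _ (-1) Ht) as Ht'. destruct (Hg _ Ht') as [G1 [G2 G3]].
  assert (E : (tau + (-1)%R + 1)%C = tau) by ring.
  split; [now apply upper_shift|]. split.
  - rewrite uq_T, G2, <- uq_T, E by assumption. reflexivity.
  - rewrite Hk, G2, G3 by assumption.
    transitivity (- phi (tau + (-1)%R + 1))%C; [rewrite (Hk _ Ht'); ring | now rewrite E].
Qed.

Lemma flips_ext g h : (forall tau, upper tau -> g tau = h tau) -> flips phi g -> flips phi h.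
Proof. intros E H tau Ht. rewrite <- E by assumption. now apply H. Qed.

Lemma linear_neq0 (c d : R) tau : upper tau -> c <> 0 -> (RtoC c * tau + RtoC d)%C <> 0%C.
Proof.
  intros Ht Hc E. apply (f_equal Im) in E. unfold upper, Im in *. simpl in E.
  assert (X : c * snd tau = 0) by lra. apply Rmult_integral in X. lra.
Qed.

Lemma flips_V0 : flips phi (moebius V0).
Proof.
  eapply flips_ext; [|apply flips_T4]. intros tau Ht. unfold moebius; simpl.
  field.
Qed.

Ltac field_side X Y Z := field; repeat split;
  intros E; first [apply X; rewrite <- E; ring | apply Y; rewrite <- E; ring | apply Z; rewrite <- E; ring].

Lemma flips_V1 : flips phi (moebius V1).
Proof.
  eapply flips_ext; [|apply flips_conj_S, flips_T4]. intros tau Ht. unfold moebius, V1; simpl. unfold Sact.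
  assert (tn := upper_neq0 _ Ht).
  assert (X := linear_neq0 (-4) 1 tau Ht ltac:(lra)).
  assert (n1 : (RtoC (-1) + 4 * tau)%C <> 0%C).
  { intros E. apply X. transitivity (- (RtoC (-1) + 4 * tau))%C; [ring|]. rewrite E. ring. }
  field_side X n1 tn.
Qed.

Lemma flips_V2 : flips phi (moebius V2).
Proof.
  eapply flips_ext; [|apply flips_conj_T, flips_V1]. intros tau Ht. unfold moebius, V1, V2; simpl.
  assert (X := linear_neq0 (-4) 1 _ (upper_shift _ (-1) Ht) ltac:(lra)).
  assert (Y := linear_neq0 4 (-5) tau Ht ltac:(lra)).
  field_side X Y X.
Qed.

Lemma flips_V3 : flips phi (moebius V3).
Proof.
  eapply flips_ext; [|apply flips_conj_T, flips_V2]. intros tau Ht. unfold moebius, V2, V3; simpl.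
  assert (X := linear_neq0 4 (-5) _ (upper_shift _ (-1) Ht) ltac:(lra)).
  assert (Y := linear_neq0 4 (-9) tau Ht ltac:(lra)).
  field_side X Y X.
Qed.

Lemma flips_V4 : flips phi (moebius V4).
Proof.
  eapply flips_ext; [|apply flips_conj_T, flips_V3]. intros tau Ht. unfold moebius, V3, V4; simpl.
  assert (X := linear_neq0 4 (-9) _ (upper_shift _ (-1) Ht) ltac:(lra)).
  assert (Y := linear_neq0 4 (-13) tau Ht ltac:(lra)).
  field_side X Y X.
Qed.

Lemma phi_neq0 tau : upper tau -> phi tau <> 0%C.
Proof. intros Ht E. apply (Psi_neq0 tau Ht). unfold Psi. rewrite E. ring. Qed.
End Burnside_phi.

(** * Moebius transformations and behaviour at the cusp *)

Lemma mat_ext A B : m11 A = m11 B -> m12 A = m12 B -> m21 A = m21 B -> m22 A = m22 B -> A = B.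
Proof. destruct A, B; simpl; congruence. Qed.

Ltac mat_ring := apply mat_ext; unfold mmul, minv, mopp, mone, zmat; simpl; ring.

Lemma mmul_assoc A B D : mmul A (mmul B D) = mmul (mmul A B) D.
Proof. mat_ring. Qed.

Lemma mmul_1_l A : mmul mone A = A.
Proof. mat_ring. Qed.

Lemma mmul_1_r A : mmul A mone = A.
Proof. mat_ring. Qed.

Lemma minv_mul A B : minv (mmul A B) = mmul (minv B) (minv A).
Proof. mat_ring. Qed.

Lemma minv_minv A : minv (minv A) = A.
Proof. mat_ring. Qed.

Lemma mmul_minv_l A : det A = 1 -> mmul (minv A) A = mone.
Proof. unfold det. intros H. apply mat_ext; unfold mmul, minv, mone; simpl; lra. Qed.

Lemma mmul_minv_r A : det A = 1 -> mmul A (minv A) = mone.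
Proof. unfold det. intros H. apply mat_ext; unfold mmul, minv, mone; simpl; lra. Qed.

Lemma mopp_mopp A : mopp (mopp A) = A.
Proof. mat_ring. Qed.

Lemma det_mul A B : det (mmul A B) = det A * det B.
Proof. unfold det; simpl; ring. Qed.

Lemma det_minv A : det (minv A) = det A.
Proof. unfold det; simpl; ring. Qed.

Lemma det_mopp A : det (mopp A) = det A.
Proof. unfold det; simpl; ring. Qed.

Lemma moebius_den A tau : det A = 1 -> upper tau -> (RtoC (m21 A) * tau + RtoC (m22 A))%C <> 0%C.
Proof.
  unfold det. intros HA Ht. destruct (Req_dec (m21 A) 0) as [E|E]; [|now apply linear_neq0].
  intros X. apply (f_equal Re) in X. rewrite E in *. simpl in X. assert (m22 A = 0) by lra. nra.
Qed.

Lemma Im_moebius A tau : det A = 1 -> upper tau ->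
  Im (moebius A tau) = Im tau / Cmod (RtoC (m21 A) * tau + RtoC (m22 A)) ^ 2.
Proof.
  intros HA Ht. pose proof (moebius_den A tau HA Ht) as D.
  assert (D2 : 0 < Cmod (RtoC (m21 A) * tau + RtoC (m22 A)) ^ 2) by now apply pow_lt, Cmod_gt_0.
  unfold moebius, Cdiv. rewrite Cmod2_alt in *. unfold det in HA.
  destruct A as [a b c d], tau as [s t]. unfold Re, Im in *. simpl in *.
  match goal with |- _ = t / ?den => transitivity (t * (a * d - b * c) / den) end.
  - field. lra.
  - rewrite HA. field. lra.
Qed.

Lemma moebius_upper A tau : det A = 1 -> upper tau -> upper (moebius A tau).
Proof.
  intros HA Ht. unfold upper. rewrite Im_moebius by assumption.
  apply Rdiv_lt_0_compat; [exact Ht|]. apply pow_lt, Cmod_gt_0. now apply moebius_den.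
Qed.

Lemma moebius_mul A B tau : det A = 1 -> det B = 1 -> upper tau ->
  moebius (mmul A B) tau = moebius A (moebius B tau).
Proof.
  intros HA HB Ht.
  pose proof (moebius_den B tau HB Ht) as D1.
  pose proof (moebius_den A _ HA (moebius_upper B tau HB Ht)) as D2.
  assert (D3 := moebius_den (mmul A B) tau ltac:(rewrite det_mul, HA, HB; ring) Ht).
  unfold moebius in *. simpl in *. rewrite !RtoC_plus, !RtoC_mult in *.
  field. repeat split; auto.
  intros E. apply D3. rewrite <- E. ring.
Qed.

Lemma moebius_1 tau : moebius mone tau = tau.
Proof. unfold moebius; simpl. field. Qed.

Lemma moebius_opp A tau : det A = 1 -> upper tau -> moebius (mopp A) tau = moebius A tau.
Proof.
  intros HA Ht. pose proof (moebius_den A tau HA Ht) as D1.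
  unfold moebius; simpl. rewrite !RtoC_opp. field. split; auto.
  intros E. apply D1. transitivity (- (- m21 A * tau + - m22 A))%C; [ring|]. rewrite E. ring.
Qed.

Lemma Aut_1 f : Aut f mone.
Proof. split; [unfold det; simpl; ring|]. intros. now rewrite moebius_1. Qed.

Lemma Aut_mul f A B : Aut f A -> Aut f B -> Aut f (mmul A B).
Proof.
  intros [HA FA] [HB FB]. split; [rewrite det_mul, HA, HB; ring|].
  intros tau Ht. rewrite moebius_mul, FA, FB by (try apply moebius_upper; assumption). reflexivity.
Qed.

Lemma Aut_inv f A : Aut f A -> Aut f (minv A).
Proof.
  intros [HA FA]. split; [now rewrite det_minv|]. intros tau Ht.
  assert (HA' : det (minv A) = 1) by now rewrite det_minv.
  rewrite <- (FA _ (moebius_upper _ _ HA' Ht)), <- moebius_mul, mmul_minv_r, moebius_1 by assumption.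
  reflexivity.
Qed.

Lemma Aut_sign f A B : psl_eq A B -> Aut f A -> Aut f B.
Proof.
  intros [E|E] HA; [now subst|]. subst A. destruct HA as [HA FA].
  rewrite det_mopp in HA. split; auto. intros tau Ht. now rewrite <- moebius_opp, FA.
Qed.

(** * Limits at the cusp *)

(** Uniform in the real part, so that a limit applies to any point lying high enough. *)
Definition cusp_lim (f : C -> C) (l : C) : Prop :=
  forall eps, 0 < eps -> exists Y, forall tau, upper tau -> Y <= Im tau -> Cmod (f tau - l) < eps.

Lemma cusp_lim_const c : cusp_lim (fun _ => c) c.
Proof.
  intros eps He. exists 0. intros. replace (c - c)%C with (RtoC 0) by ring. now rewrite Cmod_0.
Qed.

Lemma cusp_lim_ext f g l : (forall tau, upper tau -> f tau = g tau) -> cusp_lim f l -> cusp_lim g l.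
Proof.
  intros E H eps He. destruct (H eps He) as [Y HY]. exists Y. intros tau Ht HI. rewrite <- E; auto.
Qed.

Lemma cusp_lim_plus f g a b : cusp_lim f a -> cusp_lim g b -> cusp_lim (fun tau => f tau + g tau)%C (a + b).
Proof.
  intros Hf Hg eps He. destruct (Hf (eps / 2) ltac:(lra)) as [Y HY], (Hg (eps / 2) ltac:(lra)) as [Z HZ].
  exists (Rmax Y Z). intros tau Ht HI.
  specialize (HY tau Ht (Rle_trans _ _ _ (Rmax_l _ _) HI)). specialize (HZ tau Ht (Rle_trans _ _ _ (Rmax_r _ _) HI)).
  replace (f tau + g tau - (a + b))%C with ((f tau - a) + (g tau - b))%C by ring.
  eapply Rle_lt_trans; [apply Cmod_triangle|]. lra.
Qed.

Lemma cusp_lim_mult f g a b : cusp_lim f a -> cusp_lim g b -> cusp_lim (fun tau => f tau * g tau)%C (a * b).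
Proof.
  intros Hf Hg eps He. destruct (Cmult_near a b eps He) as [e [e0 Hm]].
  destruct (Hf e e0) as [Y HY], (Hg e e0) as [Z HZ].
  exists (Rmax Y Z). intros tau Ht HI.
  apply Hm; [apply HY | apply HZ]; auto; (eapply Rle_trans; [|exact HI]); [apply Rmax_l | apply Rmax_r].
Qed.

Lemma cusp_lim_pow f a n : cusp_lim f a -> cusp_lim (fun tau => f tau ^ n)%C (a ^ n).
Proof.
  intros H. induction n as [|n IH]; [exact (cusp_lim_const 1)|]. exact (cusp_lim_mult _ _ _ _ H IH).
Qed.

Lemma cusp_lim_affine f l (p b : R) : 0 < p -> cusp_lim f l -> cusp_lim (fun tau => f (p * tau + b)%C) l.
Proof.
  intros Hp H eps He. destruct (H eps He) as [Y HY]. exists (Y / p). intros tau Ht HI.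
  assert (E : Im (p * tau + b)%C = p * Im tau) by (unfold Im; simpl; ring).
  apply HY; unfold upper in *; rewrite E. now apply Rmult_lt_0_compat.
  apply Rmult_le_reg_r with (/ p); [now apply Rinv_0_lt_compat|].
  replace (p * Im tau * / p) with (Im tau) by (field; lra). exact HI.
Qed.

Lemma cusp_lim_unique f a b : cusp_lim f a -> cusp_lim f b -> a = b.
Proof.
  intros Ha Hb. destruct (Ceq_dec a b) as [|H]; [assumption|exfalso].
  assert (H0 : 0 < Cmod (a - b)).
  { apply Cmod_gt_0. intros H1. apply H. replace a with (a - b + b)%C by ring. rewrite H1. ring. }
  destruct (Ha (Cmod (a - b) / 2) ltac:(lra)) as [Y HY], (Hb (Cmod (a - b) / 2) ltac:(lra)) as [Z HZ].
  set (t := Rmax 1 (Rmax Y Z)).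
  assert (t1 : 1 <= t) by apply Rmax_l.
  assert (tm : Rmax Y Z <= t) by apply Rmax_r.
  assert (U : upper (0, t)) by (unfold upper; simpl; lra).
  specialize (HY (0, t) U (Rle_trans _ _ _ (Rmax_l _ _) tm)).
  specialize (HZ (0, t) U (Rle_trans _ _ _ (Rmax_r _ _) tm)).
  assert (T : Cmod (a - b) <= Cmod (f (0, t) - a) + Cmod (f (0, t) - b)).
  { replace (a - b)%C with (- (f (0, t) - a) + (f (0, t) - b))%C by ring.
    eapply Rle_trans. apply Cmod_triangle. rewrite Cmod_opp. lra. }
  lra.
Qed.

Lemma cusp_lim_Cexp (c : R) : 0 < c -> cusp_lim (fun tau => Cexp (c * Ci * tau)) 0.
Proof.
  intros Hc eps He. exists (/ (c * eps)). intros tau Ht HI.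
  replace (Cexp (c * Ci * tau) - 0)%C with (Cexp (c * Ci * tau)) by ring.
  rewrite Cmod_Cexp. replace (Re (c * Ci * tau)%C) with (- (c * Im tau)) by (unfold Re, Im; simpl; ring).
  rewrite exp_Ropp. rewrite <- (Rinv_inv eps). assert (ie : 0 < / eps) by now apply Rinv_0_lt_compat.
  apply Rinv_lt_contravar; [apply Rmult_lt_0_compat; [exact ie|apply exp_pos]|].
  assert (X : / eps <= c * Im tau).
  { apply (Rmult_le_compat_l c) in HI; [|lra]. rewrite Rinv_mult in HI.
    replace (c * (/ c * / eps)) with (/ eps) in HI by (field; lra). exact HI. }
  generalize (exp_ge_1_plus (c * Im tau)). lra.
Qed.

Lemma cusp_lim_bound f l : (exists K, forall tau, upper tau -> yq tau <= 2 / 5 -> Cmod (f tau - l) <= K * yq tau) ->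
  cusp_lim f l.
Proof.
  intros [K HK] eps He. pose proof PI_RGT_0 as HP. pose proof (Rabs_pos K) as K0.
  destruct (cusp_lim_Cexp (PI / 2) ltac:(lra) (eps / (Rabs K + 1))) as [Y HY].
  { apply Rdiv_lt_0_compat; lra. }
  exists (Rmax Y (3 / 4)). intros tau Ht HI.
  specialize (HK tau Ht (yq_le _ (Rle_trans _ _ _ (Rmax_r _ _) HI))).
  specialize (HY tau Ht (Rle_trans _ _ _ (Rmax_l _ _) HI)).
  replace (Cexp (RtoC (PI / 2) * Ci * tau) - 0)%C with (Cexp (RtoC (PI / 2) * Ci * tau)) in HY by ring.
  rewrite Cmod_Cexp in HY.
  replace (Re (RtoC (PI / 2) * Ci * tau)%C) with (- (PI * Im tau / 2)) in HY by (unfold Re, Im; simpl; field).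
  fold (yq tau) in HY. assert (y0 : 0 < yq tau) by apply exp_pos.
  assert (X : yq tau * (Rabs K + 1) < eps).
  { apply Rmult_lt_reg_r with (/ (Rabs K + 1)); [apply Rinv_0_lt_compat; lra|].
    rewrite Rmult_assoc, Rinv_r by lra. rewrite Rmult_1_r. exact HY. }
  generalize (Rle_abs K). nra.
Qed.

Lemma cusp_thB : cusp_lim thB 1.
Proof.
  apply cusp_lim_bound. exists 4. intros tau Ht Hy. eapply Rle_trans; [now apply thB_bound|].
  assert (y0 : 0 < yq tau) by apply exp_pos.
  assert (yq tau ^ 3 <= 1) by (rewrite <- (pow1 3); apply pow_incr; lra). simpl in *. nra.
Qed.

Definition thA_x (tau : C) : C := (thA tau / xq tau)%C.

Lemma thA_xE tau : thA tau = (xq tau * thA_x tau)%C.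
Proof. unfold thA_x. field. apply Cexp_neq0. Qed.

Lemma cusp_thA_x : cusp_lim thA_x 2.
Proof.
  apply cusp_lim_bound. exists 4. intros tau Ht Hy. pose proof (thA_bound tau Ht Hy) as H.
  assert (y0 : 0 < yq tau) by apply exp_pos.
  replace (thA_x tau - 2)%C with ((thA tau - 2 * xq tau) / xq tau)%C by (unfold thA_x; field; apply Cexp_neq0).
  rewrite Cmod_div, Cmod_xq by apply Cexp_neq0.
  apply Rmult_le_reg_r with (yq tau); auto. unfold Rdiv. rewrite Rmult_assoc, Rinv_l, Rmult_1_r by lra.
  eapply Rle_trans; [exact H|].
  assert (yq tau ^ 7 <= 1) by (rewrite <- (pow1 7); apply pow_incr; lra).
  replace (4 * yq tau ^ 9) with (4 * yq tau * yq tau * yq tau ^ 7) by ring.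
  rewrite <- (Rmult_1_r (4 * yq tau * yq tau)) at 2. apply Rmult_le_compat_l; nra.
Qed.

Lemma cusp_xq : cusp_lim xq 0.
Proof.
  apply cusp_lim_bound. exists 1. intros tau Ht Hy. replace (xq tau - 0)%C with (xq tau) by ring.
  rewrite Cmod_xq. lra.
Qed.

(* In terms of [uq], the group [PSL_2(Z)] acts through the octahedral group, with
   vertices the roots of [u (1 - u ^ 4)] and infinity. [octN] is the cube of the
   face form and [octE] is the fourth power of the vertex form divided by its
   leading term [xq ^ 4] at the cusp, so that [Jinv] is Klein's invariant. *)
Definition octN (tau : C) : C := ((thA tau ^ 8 + 14 * thA tau ^ 4 * thB tau ^ 4 + thB tau ^ 8) ^ 3)%C.
Definition octE (tau : C) : C := ((thA_x tau * thB tau * (thB tau ^ 4 - thA tau ^ 4)) ^ 4)%C.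
Definition Jinv (tau : C) : C := (octN tau / thD tau ^ 4)%C.

Lemma thD4 tau : (thD tau ^ 4)%C = (xq tau ^ 4 * octE tau)%C.
Proof. unfold thD, octE. rewrite thA_xE at 1. ring. Qed.

Lemma cusp_thA : cusp_lim thA 0.
Proof.
  replace (RtoC 0) with (0 * 2)%C by ring. apply cusp_lim_ext with (fun tau => xq tau * thA_x tau)%C.
  intros; symmetry; apply thA_xE. apply cusp_lim_mult; [apply cusp_xq | apply cusp_thA_x].
Qed.

Lemma cusp_octN : cusp_lim octN 1.
Proof.
  replace (RtoC 1) with ((0 ^ 8 + 14 * 0 ^ 4 * 1 ^ 4 + 1 ^ 8) ^ 3)%C by ring.
  apply cusp_lim_pow, cusp_lim_plus; [apply cusp_lim_plus; [|apply cusp_lim_mult; [apply cusp_lim_mult; [apply cusp_lim_const|]|]]|];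
  apply cusp_lim_pow; first [apply cusp_thA | apply cusp_thB].
Qed.

Lemma cusp_octE : cusp_lim octE 16.
Proof.
  replace (RtoC 16) with ((2 * 1 * (1 ^ 4 + - (1) * 0 ^ 4)) ^ 4)%C by ring.
  apply cusp_lim_pow, cusp_lim_mult; [apply cusp_lim_mult; [apply cusp_thA_x | apply cusp_thB]|].
  apply cusp_lim_ext with (fun tau => thB tau ^ 4 + - (1) * thA tau ^ 4)%C; [intros; ring|].
  apply cusp_lim_plus; [|apply cusp_lim_mult; [apply cusp_lim_const|]]; apply cusp_lim_pow;
  first [apply cusp_thA | apply cusp_thB].
Qed.

Lemma cusp_thD4 : cusp_lim (fun tau => thD tau ^ 4)%C 0.
Proof.
  replace (RtoC 0) with (0 ^ 4 * 16)%C by ring.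
  apply cusp_lim_ext with (fun tau => xq tau ^ 4 * octE tau)%C; [intros; symmetry; apply thD4|].
  apply cusp_lim_mult; [apply cusp_lim_pow, cusp_xq | apply cusp_octE].
Qed.

(** Makes [Jinv] a rational function of [uq]. Hence whatever fixes [chi] preserves it, and its
    modular invariance reduces to the substitutions [u -> i u] and [u -> (1 - u) / (1 + u)]. *)
Lemma Jinv_uq tau : upper tau -> Jinv tau =
  ((uq tau ^ 8 + 14 * uq tau ^ 4 + 1) ^ 3 / (uq tau * (1 - uq tau ^ 4)) ^ 4)%C.
Proof.
  intros Ht. destruct (thAB_neq0 tau Ht) as [H1 [H2 _]]. pose proof (thD_neq0 tau Ht) as H3.
  destruct (uq_neq tau Ht) as [_ [_ [_ H4]]].
  unfold thD in H3. unfold Jinv, octN, thD, uq in *.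
  assert (H5 : (thB tau ^ 4 - thA tau ^ 4)%C <> 0%C) by (intros E; apply H3; rewrite E; ring).
  field. repeat split; auto.
Qed.

Lemma Jinv_T tau : upper tau -> Jinv (tau + 1) = Jinv tau.
Proof.
  intros Ht. rewrite !Jinv_uq by (try apply upper_shift; assumption). rewrite uq_T by assumption.
  destruct (uq_neq tau Ht) as [H1 [H2 [H3 H4]]]. set (u := uq tau) in *.
  replace ((Ci * u) ^ 8)%C with ((Ci ^ 4) * (Ci ^ 4) * u ^ 8)%C by ring.
  replace ((Ci * u * (1 - (Ci * u) ^ 4)) ^ 4)%C with (Ci ^ 4 * (u * (1 - Ci ^ 4 * u ^ 4)) ^ 4)%C by ring.
  replace ((Ci * u) ^ 4)%C with (Ci ^ 4 * u ^ 4)%C by ring.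
  rewrite !Ci4, !Cmult_1_l. reflexivity.
Qed.

Lemma Jinv_S tau : upper tau -> Jinv (Sact tau) = Jinv tau.
Proof.
  intros Ht. rewrite !Jinv_uq by (try apply upper_S; assumption). rewrite uq_S by assumption.
  destruct (uq_neq tau Ht) as [H1 [H2 [H3 H4]]].
  destruct (uq_neq _ (upper_S _ Ht)) as [_ [_ [_ H5]]]. rewrite uq_S in H5 by assumption.
  set (u := uq tau) in *.
  field. repeat split; auto.
  intros E. apply H5. replace (1 - ((1 - u) / (1 + u)) ^ 4)%C with (((1 + u) ^ 4 - (1 - u) ^ 4) / (1 + u) ^ 4)%C by (field; auto).
  match type of E with ?x = _ => replace ((1 + u) ^ 4 - (1 - u) ^ 4)%C with x by ring end. rewrite E. field. auto.
Qed.

(** * The automorphism group of [chi] *)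

Definition SL2Z (g : mat) : Prop :=
  exists a b c d : Z, (a * d - b * c = 1)%Z /\ g = zmat a b c d.

Lemma SL2Z_det g : SL2Z g -> det g = 1.
Proof.
  intros [a [b [c [d [H E]]]]]. subst g. unfold det; simpl.
  now rewrite <- !mult_IZR, <- minus_IZR, H.
Qed.

Lemma zmat_mul a b c d a' b' c' d' : mmul (zmat a b c d) (zmat a' b' c' d') =
  zmat (a * a' + b * c') (a * b' + b * d') (c * a' + d * c') (c * b' + d * d').
Proof. apply mat_ext; simpl; now rewrite !plus_IZR, !mult_IZR. Qed.

Lemma zmat_inv a b c d : minv (zmat a b c d) = zmat d (- b) (- c) a.
Proof. apply mat_ext; simpl; now rewrite ?opp_IZR. Qed.

Lemma zmat_opp a b c d : mopp (zmat a b c d) = zmat (- a) (- b) (- c) (- d).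
Proof. apply mat_ext; simpl; now rewrite ?opp_IZR. Qed.

Lemma zmat_inj a b c d a' b' c' d' : zmat a b c d = zmat a' b' c' d' -> a = a' /\ b = b' /\ c = c' /\ d = d'.
Proof. intros H. injection H. intros. repeat split; now apply eq_IZR. Qed.

Lemma SL2Z_mul g h : SL2Z g -> SL2Z h -> SL2Z (mmul g h).
Proof.
  intros [a [b [c [d [H E]]]]] [a' [b' [c' [d' [H' E']]]]]. subst.
  rewrite zmat_mul. do 4 eexists. split; [|reflexivity].
  transitivity ((a * d - b * c) * (a' * d' - b' * c'))%Z; [ring|]. rewrite H, H'. reflexivity.
Qed.

Lemma SL2Z_inv g : SL2Z g -> SL2Z (minv g).
Proof.
  intros [a [b [c [d [H E]]]]]. subst. rewrite zmat_inv. do 4 eexists. split; [|reflexivity].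
  rewrite <- H. ring.
Qed.

Definition preserves_J (g : mat) : Prop := forall tau, upper tau -> Jinv (moebius g tau) = Jinv tau.

Lemma preserves_J_mul g h : det g = 1 -> det h = 1 -> preserves_J g -> preserves_J h -> preserves_J (mmul g h).
Proof.
  intros Dg Dh Hg Hh tau Ht. rewrite moebius_mul, Hg, Hh by (try apply moebius_upper; assumption). reflexivity.
Qed.

Lemma Jinv_shift (k : Z) tau : upper tau -> Jinv (tau + IZR k) = Jinv tau.
Proof.
  assert (P : forall (n : nat) t, upper t -> Jinv (t + INR n) = Jinv t).
  { induction n as [|n IH]; intros t Ht.
    - simpl INR. f_equal. ring.
    - rewrite S_INR, RtoC_plus, Cplus_assoc, Jinv_T by now apply upper_shift. auto. }
  intros Ht. destruct (Z_le_gt_dec 0 k) as [Hk|Hk].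
  - rewrite <- (P (Z.to_nat k) tau Ht), INR_IZR_INZ, Z2Nat.id by lia. reflexivity.
  - rewrite <- (P (Z.to_nat (- k)) _ (upper_shift _ (IZR k) Ht)), INR_IZR_INZ, Z2Nat.id, opp_IZR, RtoC_opp by lia.
    f_equal. ring.
Qed.

Definition Tmat (k : Z) : mat := zmat 1 k 0 1.
Definition Smat : mat := zmat 0 (-1) 1 0.

Lemma moebius_Tmat k tau : moebius (Tmat k) tau = (tau + IZR k)%C.
Proof. unfold moebius; simpl. field. Qed.

Lemma moebius_Smat tau : upper tau -> moebius Smat tau = Sact tau.
Proof. intros Ht. unfold moebius, Sact; simpl. field. now apply upper_neq0. Qed.

Lemma SL2Z_Tmat k : SL2Z (Tmat k).
Proof. exists 1%Z, k, 0%Z, 1%Z. split; [ring|reflexivity]. Qed.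

Lemma SL2Z_Smat : SL2Z Smat.
Proof. exists 0%Z, (-1)%Z, 1%Z, 0%Z. split; [ring|reflexivity]. Qed.

Lemma nearest_multiple (a c : R) : c <> 0 -> exists k : Z, Rabs (a + IZR k * c) <= Rabs c / 2.
Proof.
  intros Hc. exists (- up (a / c - / 2))%Z. rewrite opp_IZR.
  destruct (archimed (a / c - / 2)) as [A1 A2].
  replace (a + - IZR (up (a / c - / 2)) * c) with ((a / c - IZR (up (a / c - / 2))) * c) by (field; auto).
  rewrite Rabs_mult. replace (Rabs c / 2) with (/ 2 * Rabs c) by field.
  apply Rmult_le_compat_r; [apply Rabs_pos|]. apply Rabs_le. lra.
Qed.

(* Euclid's algorithm on the first column of a real matrix. *)
Lemma modular_descent (A : mat) (n : nat) : exists g, SL2Z g /\ preserves_J g /\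
  (m21 (mmul g A) = 0 \/ 0 < Rabs (m21 (mmul g A)) <= Rabs (m21 A) * (/ 2) ^ n).
Proof.
  induction n as [|n [g [Hg [Jg IH]]]].
  - exists mone. split; [exact (SL2Z_Tmat 0)|]. split.
    + intros tau Ht. now rewrite moebius_1.
    + rewrite mmul_1_l. simpl. destruct (Req_dec (m21 A) 0) as [E|E]; [now left|right].
      split; [now apply Rabs_pos_lt|lra].
  - destruct IH as [E|[E1 E2]]; [exists g; auto|].
    set (a := m11 (mmul g A)). set (c := m21 (mmul g A)) in *.
    assert (c0 : c <> 0) by (intros E; rewrite E, Rabs_R0 in E1; lra).
    destruct (nearest_multiple a c c0) as [k Hk].
    exists (mmul Smat (mmul (Tmat k) g)).
    assert (HT : SL2Z (mmul (Tmat k) g)) by (apply SL2Z_mul; [apply SL2Z_Tmat | exact Hg]).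
    split; [apply SL2Z_mul; [apply SL2Z_Smat | exact HT]|]. split.
    + apply preserves_J_mul; [apply SL2Z_det, SL2Z_Smat | now apply SL2Z_det | |].
      * intros tau Ht. now rewrite moebius_Smat, Jinv_S.
      * apply preserves_J_mul; [apply SL2Z_det, SL2Z_Tmat | now apply SL2Z_det | | assumption].
        intros tau Ht. now rewrite moebius_Tmat, Jinv_shift.
    + rewrite <- !mmul_assoc.
      replace (m21 (mmul Smat (mmul (Tmat k) (mmul g A)))) with (a + IZR k * c) by (unfold a, c; simpl; ring).
      destruct (Req_dec (a + IZR k * c) 0) as [E|E]; [now left|right].
      split; [now apply Rabs_pos_lt|]. simpl pow. lra.
Qed.

Lemma Aut_chi_uq A : Aut chi A -> forall tau, upper tau -> uq (moebius A tau) = uq tau.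
Proof.
  intros [HA H] tau Ht. apply chi_eq_iff; auto. now apply moebius_upper.
Qed.

Lemma uq_Aut_chi A : det A = 1 -> (forall tau, upper tau -> uq (moebius A tau) = uq tau) -> Aut chi A.
Proof.
  intros HA H. split; auto. intros tau Ht. apply chi_eq_iff; auto. now apply moebius_upper.
Qed.

Lemma Aut_chi_J A : Aut chi A -> preserves_J A.
Proof.
  intros HA tau Ht. assert (U := moebius_upper A tau (proj1 HA) Ht).
  rewrite !Jinv_uq, Aut_chi_uq by assumption. reflexivity.
Qed.

Lemma Jinv_value tau j : upper tau -> Jinv tau = j -> octN tau = (j * thD tau ^ 4)%C.
Proof.
  intros Ht E. rewrite <- E. unfold Jinv. field. now apply thD_neq0.
Qed.

Lemma xq4_affine (p b : R) tau : (xq (p * tau + b) ^ 4)%C =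
  (Cexp (2 * PI * Ci * b) * Cexp (2 * PI * Ci * (p - 1)%R * tau) * xq tau ^ 4)%C.
Proof.
  unfold xq. rewrite <- !(Cexp_pow _ 4), <- !Cexp_plus. f_equal. simpl (INR 4).
  replace (RtoC (1 + 1 + 1 + 1)) with (RtoC 4) by (f_equal; ring). rewrite RtoC_minus. field.
Qed.

(* Compare the leading terms of [Jinv ~ 1 / (16 xq ^ 4)] at the cusp on both sides. *)
Lemma affine_preserving_J (p b : R) : 0 < p ->
  (forall tau, upper tau -> Jinv (p * tau + b) = Jinv tau) -> p = 1 /\ exists n : Z, b = IZR n.
Proof.
  intros Hp HJ. pose proof PI_RGT_0 as HP.
  set (e := Cexp (2 * PI * Ci * b)%C).
  assert (Haff : forall tau, upper tau -> upper (p * tau + b)%C).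
  { intros tau Ht. unfold upper in *. replace (Im (p * tau + b)%C) with (p * Im tau) by (unfold Im; simpl; ring).
    now apply Rmult_lt_0_compat. }
  (* Apart from the exponential and [e], both sides tend to 16. For [p < 1] the inverse exponential
     tends to 0 and forces [16 e = 0]; for [p > 1] one gets [16 = 0]; for [p = 1] there remains
     [e = 1]. *)
  assert (Key : forall tau, upper tau ->
    (octN tau * octE (p * tau + b) * (e * Cexp (2 * PI * Ci * (p - 1)%R * tau)) = octN (p * tau + b) * octE tau)%C).
  { intros tau Ht.
    assert (E1 := Jinv_value tau _ Ht eq_refl). assert (E2 := Jinv_value _ _ (Haff tau Ht) (HJ tau Ht)).
    rewrite thD4 in E1, E2. rewrite xq4_affine in E2. fold e in E2.
    rewrite E1 at 1. rewrite E2. ring. }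
  assert (L1 : cusp_lim (fun tau => octN tau * octE (p * tau + b))%C (1 * 16)%C).
  { apply cusp_lim_mult; [apply cusp_octN|]. apply (cusp_lim_affine octE); [assumption|apply cusp_octE]. }
  assert (L2 : cusp_lim (fun tau => octN (p * tau + b) * octE tau)%C (1 * 16)%C).
  { apply cusp_lim_mult; [|apply cusp_octE]. apply (cusp_lim_affine octN); [assumption|apply cusp_octN]. }
  assert (n16 : (1 * 16)%C <> 0%C) by (rewrite <- RtoC_mult; intros Y; apply RtoC_inj in Y; lra).
  destruct (Rtotal_order p 1) as [Hlt|[Heq|Hgt]].
  - exfalso.
    assert (L3 : cusp_lim (fun tau => octN (p * tau + b) * octE tau * Cexp (2 * PI * (1 - p) * Ci * tau))%C (1 * 16 * 0)%C).
    { apply cusp_lim_mult; [exact L2|].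
      apply cusp_lim_ext with (fun tau => Cexp (RtoC (2 * PI * (1 - p)) * Ci * tau)).
      - intros. f_equal. now rewrite !RtoC_mult, RtoC_minus.
      - apply cusp_lim_Cexp. apply Rmult_lt_0_compat; lra. }
    assert (L4 : cusp_lim (fun tau => octN tau * octE (p * tau + b) * e)%C (1 * 16 * e)%C)
      by (apply cusp_lim_mult; [exact L1 | apply cusp_lim_const]).
    apply (cusp_lim_ext _ (fun tau => octN tau * octE (p * tau + b) * e)%C) in L3.
    + assert (E := cusp_lim_unique _ _ _ L4 L3). rewrite Cmult_0_r in E.
      apply Cmult_integral in E. destruct E as [E|E]; [auto|]. now apply (Cexp_neq0 (2 * PI * Ci * b)%C).
    + intros tau Ht. cbv beta. rewrite <- (Key tau Ht).
      transitivity (octN tau * octE (p * tau + b) * e * (Cexp (2 * PI * Ci * (p - 1)%R * tau) * Cexp (2 * PI * (1 - p) * Ci * tau)))%C; [ring|].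
      rewrite <- Cexp_plus.
      replace (2 * PI * Ci * (p - 1)%R * tau + 2 * PI * (1 - p) * Ci * tau)%C with (RtoC 0) by (rewrite RtoC_minus; ring).
      rewrite Cexp_0. ring.
  - split; [assumption|]. apply Cexp_2PIi_eq1. fold e.
    assert (L4 : cusp_lim (fun tau => octN tau * octE (p * tau + b) * e)%C (1 * 16 * e)%C)
      by (apply cusp_lim_mult; [exact L1 | apply cusp_lim_const]).
    apply (cusp_lim_ext _ (fun tau => octN tau * octE (p * tau + b) * e)%C) in L2.
    + assert (E := cusp_lim_unique _ _ _ L4 L2).
      transitivity (1 * 16 * e / (1 * 16))%C; [field; exact n16|]. rewrite E. field; exact n16.
    + intros tau Ht. cbv beta. rewrite <- (Key tau Ht). rewrite Heq.
      replace (2 * PI * Ci * (1 - 1)%R * tau)%C with (RtoC 0) by (rewrite RtoC_minus; ring).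
      rewrite Cexp_0. ring.
  - exfalso. apply n16.
    assert (L3 : cusp_lim (fun tau => octN tau * octE (p * tau + b) * (e * Cexp (2 * PI * Ci * (p - 1)%R * tau)))%C (1 * 16 * (e * 0))%C).
    { apply cusp_lim_mult; [exact L1|]. apply cusp_lim_mult; [apply cusp_lim_const|].
      apply cusp_lim_ext with (fun tau => Cexp (RtoC (2 * PI * (p - 1)) * Ci * tau)).
      - intros. f_equal. rewrite !RtoC_mult. ring.
      - apply cusp_lim_Cexp. apply Rmult_lt_0_compat; lra. }
    apply (cusp_lim_ext _ (fun tau => octN (p * tau + b) * octE tau)%C) in L3; [|intros; now apply Key].
    rewrite (cusp_lim_unique _ _ _ L2 L3). ring.
Qed.

Lemma preserving_J_SL2Z A : det A = 1 -> preserves_J A -> SL2Z A.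
Proof.
  intros HA JA.
  (* Above [Y] the product [Jinv Ci * thD^4] is smaller than 1/2, above [Z] the form [octN] is
     within 1/2 of 1. A point above both where [Jinv] takes its value at [i] is impossible. *)
  destruct (cusp_lim_mult _ _ _ _ (cusp_lim_const (Jinv Ci)) cusp_thD4 (/ 2) ltac:(lra)) as [Y HY].
  destruct (cusp_octN (/ 2) ltac:(lra)) as [Z HZ].
  set (W := Rmax 1 (Rmax Y Z)).
  assert (W1 : 1 <= W) by apply Rmax_l. assert (WY : Rmax Y Z <= W) by apply Rmax_r.
  (* [N] is large enough to make the lower left entry at most [1 / (2 W)]. *)
  destruct (Pow_x_infinity 2 ltac:(rewrite Rabs_pos_eq; lra) ((Rabs (m21 A) + 1) * 2 * W)) as [N HN].
  specialize (HN N (le_n N)). rewrite Rabs_pos_eq in HN by (apply pow_le; lra).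
  destruct (modular_descent A N) as [g [Hg [Jg Hc]]].
  pose proof (SL2Z_det g Hg) as Dg.
  set (B := mmul g A) in *.
  assert (DB : det B = 1) by (unfold B; rewrite det_mul, Dg, HA; ring).
  assert (JB : preserves_J B) by (apply preserves_J_mul; assumption).
  destruct Hc as [E|[E1 E2]].
  - assert (HB : SL2Z B).
    { unfold det in DB. rewrite E in DB.
      assert (ad : m11 B * m22 B = 1) by lra.
      assert (a0 : m11 B <> 0) by (intros X; rewrite X in ad; lra).
      assert (d0 : m22 B <> 0) by (intros X; rewrite X in ad; lra).
      assert (dE : m22 B = / m11 B) by (apply (Rmult_eq_reg_l (m11 B)); auto; rewrite Rinv_r; auto).
      (* With [c = 0] and [d = 1 / a] the action is [tau -> a^2 tau + a b]. *)
      destruct (affine_preserving_J (m11 B ^ 2) (m11 B * m12 B)) as [P1 [n Hn]].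
      - now apply pow2_gt_0.
      - intros tau Ht. rewrite <- (JB tau Ht). f_equal. unfold moebius.
        rewrite E, dE, RtoC_pow, RtoC_mult, RtoC_inv by auto. field.
        intros X; apply RtoC_inj in X; auto.
      - assert (P : m11 B = 1 \/ m11 B = -1).
        { assert (X : (m11 B - 1) * (m11 B + 1) = 0) by (transitivity (m11 B ^ 2 - 1); [ring | lra]).
          apply Rmult_integral in X. destruct X; [left|right]; lra. }
        destruct P as [P|P].
        + exists 1%Z, n, 0%Z, 1%Z. split; [ring|]. apply mat_ext; unfold zmat; cbn [m11 m12 m21 m22]; rewrite ?dE, ?P, ?E; try lra.
          rewrite <- Hn, P. ring.
        + exists (-1)%Z, (- n)%Z, 0%Z, (-1)%Z. split; [ring|]. apply mat_ext; unfold zmat; cbn [m11 m12 m21 m22]; rewrite ?dE, ?P, ?E; try lra.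
          rewrite opp_IZR, <- Hn, P. ring. }
    replace A with (mmul (minv g) B).
    + apply SL2Z_mul; [now apply SL2Z_inv | assumption].
    + unfold B. now rewrite mmul_assoc, mmul_minv_l, mmul_1_l.
  - (* For small [c], some translate of [i] is moved high into the cusp. *)
    exfalso. set (c := m21 B) in *. set (d := m22 B).
    assert (c0 : c <> 0) by (intros X; rewrite X, Rabs_R0 in E1; lra).
    destruct (nearest_multiple d c c0) as [k Hk].
    pose proof upper_Ci as Ui.
    assert (Uk : upper (Ci + IZR k)%C) by now apply upper_shift.
    set (w := moebius B (Ci + IZR k)%C).
    assert (Uw : upper w) by now apply moebius_upper.
    assert (Jw : Jinv w = Jinv Ci) by (unfold w; rewrite JB, Jinv_shift by assumption; reflexivity).
    (* The height is [1 / ((d + k c)^2 + c^2) >= 4 / (5 c^2)], and [|c| <= 1 / (2 W)]. *)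
    assert (Iw : W <= Im w).
    { unfold w. rewrite Im_moebius by assumption. fold c d.
      replace (Im (Ci + IZR k)%C) with 1 by (simpl; ring).
      rewrite Cmod2_alt.
      replace (Re (c * (Ci + IZR k) + d)%C) with (d + IZR k * c) by (simpl; ring).
      replace (Im (c * (Ci + IZR k) + d)%C) with c by (simpl; ring).
      assert (X : (d + IZR k * c) ^ 2 <= c ^ 2 / 4).
      { rewrite <- (pow2_abs (d + _)), <- (pow2_abs c). replace (Rabs c ^ 2 / 4) with ((Rabs c / 2) ^ 2) by field.
        apply pow_incr. split; [apply Rabs_pos|auto]. }
      assert (c2 : 0 < c ^ 2) by now apply pow2_gt_0.
      assert (cb : Rabs c * (2 * W) <= 1).
      { assert (P2 : 0 < 2 ^ N) by (apply pow_lt; lra). rewrite pow_inv in E2.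
        pose proof (Rabs_pos (m21 A)).
        apply Rle_trans with (Rabs (m21 A) * / 2 ^ N * (2 * W)); [apply Rmult_le_compat_r; lra|].
        apply Rmult_le_reg_r with (2 ^ N); auto.
        replace (Rabs (m21 A) * / 2 ^ N * (2 * W) * 2 ^ N) with (Rabs (m21 A) * (2 * W)) by (field; lra).
        nra. }
      pose proof (pow2_ge_0 (d + IZR k * c)) as q2.
      apply Rmult_le_reg_r with ((d + IZR k * c) ^ 2 + c ^ 2); [lra|].
      unfold Rdiv. rewrite Rmult_assoc, Rinv_l by lra.
      apply Rle_trans with (W * (5 / 4 * Rabs c ^ 2)).
      - apply Rmult_le_compat_l; [lra|]. rewrite pow2_abs. lra.
      - assert (Rabs c <= / 2) by nra. nra. }
    assert (A1 := HY w Uw (Rle_trans _ _ _ (Rmax_l _ _) (Rle_trans _ _ _ WY Iw))).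
    assert (A2 := HZ w Uw (Rle_trans _ _ _ (Rmax_r _ _) (Rle_trans _ _ _ WY Iw))).
    cbv beta in A1. rewrite <- (Jinv_value w _ Uw Jw) in A1. rewrite Cmult_0_r in A1.
    replace (octN w - 0)%C with (octN w) in A1 by ring.
    assert (T := Cmod_triangle (octN w) (- (octN w - 1))).
    replace (octN w + - (octN w - 1))%C with (RtoC 1) in T by ring.
    rewrite Cmod_1, Cmod_opp in T. lra.
Qed.

Lemma Aut_chi_SL2Z A : Aut chi A -> SL2Z A.
Proof. intros H. apply preserving_J_SL2Z; [apply H | now apply Aut_chi_J]. Qed.

(** * Arithmetic of translations on [uq] *)

Lemma uq_shift (k : Z) : exists n : nat, (Z.of_nat n mod 4 = k mod 4)%Z /\ forall tau, upper tau -> uq (tau + IZR k) = (Ci ^ n * uq tau)%C.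
Proof.
  assert (P : forall (n : nat) t, upper t -> uq (t + INR n) = (Ci ^ n * uq t)%C).
  { induction n as [|n IH]; intros t Ht.
    - simpl INR. rewrite Cplus_0_r. simpl. ring.
    - rewrite S_INR, RtoC_plus, Cplus_assoc, uq_T by now apply upper_shift. rewrite IH by assumption.
      rewrite Cpow_S. ring. }
  set (m := Z.to_nat (Z.abs k)).
  (* Adding [4 |k|] makes the exponent nonnegative without changing its residue modulo 4. *)
  exists (Z.to_nat (k + 4 * Z.of_nat m)). split.
  - rewrite Z2Nat.id by lia. rewrite Z.mul_comm. apply Z_mod_plus_full.
  - intros tau Ht. rewrite <- P by assumption.
    rewrite INR_IZR_INZ, Z2Nat.id by lia. rewrite plus_IZR, RtoC_plus, Cplus_assoc.
    replace (4 * Z.of_nat m)%Z with (Z.of_nat (4 * m)) by lia. rewrite <- INR_IZR_INZ, P by now apply upper_shift.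
    rewrite Cpow_mult_r, Ci4, Cpow_1_l. ring.
Qed.

Lemma Cmod_uq_shift (k : Z) tau : upper tau -> Cmod (uq (tau + IZR k)) = Cmod (uq tau).
Proof.
  intros Ht. destruct (uq_shift k) as [n [_ H]]. rewrite H, Cmod_mult, Cmod_pow, Cmod_Ci, pow1 by assumption. ring.
Qed.

Lemma translation_fixing_uq (k : Z) : (forall tau, upper tau -> uq (tau + IZR k) = uq tau) -> (4 | k)%Z.
Proof.
  intros H. destruct (uq_shift k) as [n [Hn Hu]].
  pose proof upper_Ci as Ui.
  assert (E : (Ci ^ n)%C = 1%C).
  { destruct (uq_neq Ci Ui) as [H0 _]. specialize (H Ci Ui). rewrite Hu in H by assumption.
    transitivity (Ci ^ n * uq Ci / uq Ci)%C; [field; auto|]. rewrite H. field. auto. }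
  apply Z.mod_divide; [lia|]. rewrite <- Hn.
  rewrite (Nat.div_mod_eq n 4), Cpow_add_r, Cpow_mult_r, Ci4, Cpow_1_l, Cmult_1_l in E.
  change 4%Z with (Z.of_nat 4). rewrite <- Nat2Z.inj_mod.
  assert (Hr : (n mod 4 < 4)%nat) by (apply Nat.mod_upper_bound; lia).
  destruct (n mod 4) as [|[|[|[|r]]]]; [reflexivity| | | |lia]; exfalso.
  - apply (f_equal Re) in E. simpl in E. lra.
  - apply (f_equal Re) in E. simpl in E. lra.
  - apply (f_equal Re) in E. simpl in E. lra.
Qed.

(** A test point at which [|u|] differs both from [|(1 - u) / (1 + u)|] and from [1 / |u|]. *)
Lemma uq_small : exists tau, upper tau /\ 0 < Cmod (uq tau) <= 1 / 4.
Proof.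
  exists (0, 2). assert (U : upper (0, 2)) by (unfold upper; simpl; lra).
  assert (Hy : yq (0, 2) <= / 10).
  { unfold yq. simpl Im. rewrite exp_Ropp. apply Rinv_le_contravar; [lra|].
    apply Rle_trans with (exp 3).
    - replace (exp 3) with (exp (1 / 2) ^ 6) by (simpl; rewrite !Rmult_1_r, <- !exp_plus; f_equal; field).
      apply Rle_trans with ((1 + 1 / 2) ^ 6); [lra|]. apply pow_incr. generalize (exp_ge_1_plus (1 / 2)). lra.
    - apply exp_le_compat. assert (3 < PI) by (generalize PI2_3_2; lra). lra. }
  split; auto.
  destruct (th_bounds (0, 2) U ltac:(lra)) as [A B]. assert (y0 : 0 < yq (0, 2)) by apply exp_pos.
  destruct (thAB_neq0 _ U) as [_ [B0 _]].
  unfold uq. rewrite Cmod_div by assumption. split.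
  - apply Rdiv_lt_0_compat; lra.
  - apply Rmult_le_reg_r with (Cmod (thB (0, 2))); [lra|]. unfold Rdiv at 1. rewrite Rmult_assoc, Rinv_l by lra. lra.
Qed.

(** * Generators *)

Definition V_letters : list mat :=
  [V0; V1; V2; V3; V4; minv V0; minv V1; minv V2; minv V3; minv V4].

(** The parity of a word in the [V_j]: even words lie in the group of the [T_j], and odd ones do so
    after multiplication by [V0]. *)
Definition even_or_odd (A : mat) : Prop := generated T_gens A \/ generated T_gens (mmul V0 A).

Lemma V_letters_inv X : In X V_letters -> In (minv X) V_letters.
Proof.
  simpl. intros H. decompose [or] H; subst; rewrite ?minv_minv; tauto.
Qed.

Lemma V_letters_SL2Z X : In X V_letters -> SL2Z X.
Proof.
  assert (H : forall a b c d, (a * d - b * c = 1)%Z -> SL2Z (zmat a b c d) /\ SL2Z (minv (zmat a b c d))).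
  { intros a b c d E. assert (S : SL2Z (zmat a b c d)) by (exists a, b, c, d; auto).
    split; [auto | now apply SL2Z_inv]. }
  simpl. intros HX. decompose [or] HX; subst; try contradiction; apply H; reflexivity.
Qed.

Lemma V_letters_det X : In X V_letters -> det X = 1.
Proof. intros H. now apply SL2Z_det, V_letters_SL2Z. Qed.

(** The products [V0 X] are the nine generators, except for [X = minv V0], which gives the
    identity. *)
Lemma generated_V0_letter X : In X V_letters -> generated T_gens (mmul V0 X).
Proof.
  intros H. simpl in H. decompose [or] H; subst; try contradiction;
  try (apply gen_mem; unfold T_gens; simpl; tauto).
  rewrite mmul_minv_r; [apply gen_one | apply V_letters_det; simpl; tauto].
Qed.

(** A letter reverses parity; in the odd case because [X A = (V0 X^-1)^-1 (V0 A)]. *)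
Lemma even_or_odd_letter X A : In X V_letters -> even_or_odd A -> even_or_odd (mmul X A).
Proof.
  intros HX [H|H].
  - right. rewrite mmul_assoc. apply gen_mul; [now apply generated_V0_letter | assumption].
  - left. replace (mmul X A) with (mmul (minv (mmul V0 (minv X))) (mmul V0 A)).
    + apply gen_mul; [|assumption]. apply gen_inv, generated_V0_letter. now apply V_letters_inv.
    + rewrite minv_mul, minv_minv, mmul_assoc, <- (mmul_assoc X), mmul_minv_l, mmul_1_r; [reflexivity|].
      apply V_letters_det; simpl; tauto.
Qed.

Lemma psl_eq_mmul_r A B D : psl_eq B D -> psl_eq (mmul A B) (mmul A D).
Proof. intros [E|E]; subst; [now left|right]. mat_ring. Qed.

Lemma even_or_odd_sign A B : psl_eq A B -> even_or_odd A -> even_or_odd B.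
Proof.
  intros E [H|H]; [left|right]; (eapply gen_sign; [|exact H]); [exact E | now apply psl_eq_mmul_r].
Qed.

Lemma closed_V0_power (P : mat -> Prop) :
  (forall X A, In X V_letters -> P A -> P (mmul X A)) ->
  forall (k : Z) A, P A -> P (mmul (Tmat (4 * k)) A).
Proof.
  intros H k A HA. pattern k. apply Z.bi_induction.
  - intros x y ->. reflexivity.
  - replace (Tmat (4 * 0)) with mone by reflexivity. now rewrite mmul_1_l.
  - intros j. split; intros Hj.
    + replace (Tmat (4 * Z.succ j)) with (mmul V0 (Tmat (4 * j))).
      * rewrite <- mmul_assoc. apply H; [simpl; tauto | assumption].
      * unfold V0, Tmat. rewrite zmat_mul. f_equal; lia.
    + replace (Tmat (4 * j)) with (mmul (minv V0) (Tmat (4 * Z.succ j))).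
      * rewrite <- mmul_assoc. apply H; [simpl; tauto | assumption].
      * unfold V0, Tmat. rewrite zmat_inv, zmat_mul. f_equal; lia.
Qed.

(* The letter whose isometric circle is centred at [(2 m + 1) / 4]. *)
Lemma letter_of_sector (m : Z) : (-1 <= m <= 6)%Z -> exists X a b c d,
  In X V_letters /\ X = zmat a b c d /\ ((c = 4 /\ d = - (2 * m + 1)) \/ (c = -4 /\ d = 2 * m + 1))%Z.
Proof.
  intros H.
  assert (C : (m = -1 \/ m = 0 \/ m = 1 \/ m = 2 \/ m = 3 \/ m = 4 \/ m = 5 \/ m = 6)%Z) by lia.
  decompose [or] C; subst m;
  [exists (minv V1) | exists V1 | exists (minv V2) | exists V2 | exists (minv V3) | exists V3 | exists (minv V4) | exists V4];
  unfold V1, V2, V3, V4; rewrite ?zmat_inv; do 4 eexists; (split; [|split; [reflexivity|lia]]);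
  unfold V_letters, V1, V2, V3, V4; rewrite ?zmat_inv; simpl; tauto.
Qed.

(** [K] stands for [Gamma 4] and for [Aut chi]. [K_cusp] keeps [a / c] from being a half-integer,
    and [K_translation] handles the end of the descent. *)
Section Descent.
Variable K : mat -> Prop.
Hypothesis K_SL2Z : forall A, K A -> SL2Z A.
Hypothesis K_letter : forall X A, In X V_letters -> K A -> K (mmul X A).
Hypothesis K_cusp : forall a b c d, (a * d - b * c = 1)%Z -> K (zmat a b c d) -> c <> 0%Z -> ~ (c | 2)%Z.
Hypothesis K_translation : forall a b d, (a * d = 1)%Z -> K (zmat a b 0 d) -> (4 | b)%Z.

(* The isometric circles of the letters and their translates by 4 cover the
   real line except for the half-integers, so some letter decreases [|c|]
   unless [a / c] is a half-integer. *)
Lemma descent A : K A -> even_or_odd A.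
Proof.
  intros HK. destruct (K_SL2Z A HK) as [a [b [c [d [Hd E]]]]]. subst A.
  enough (G : forall (n : nat) a b c d, (Z.abs c < Z.of_nat n)%Z -> (a * d - b * c = 1)%Z ->
    K (zmat a b c d) -> even_or_odd (zmat a b c d)).
  { apply (G (S (Z.abs_nat c))); auto. lia. }
  clear a b c d Hd HK. induction n as [|n IH]; intros a b c d Hn Hd HK; [lia|].
  destruct (Z.eq_dec c 0) as [Ec|Ec].
  - subst c. assert (ad : (a * d = 1)%Z) by lia.
    destruct (K_translation a b d ad HK) as [q Hq].
    assert (T : forall j, even_or_odd (Tmat (4 * j))).
    { intros j. rewrite <- (mmul_1_r (Tmat (4 * j))). apply closed_V0_power; [exact even_or_odd_letter|].
      left. apply gen_one. }
    destruct (Z.eq_mul_1 a d ad) as [Ea|Ea]; subst a.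
    + replace d with 1%Z by lia. subst b. rewrite Z.mul_comm. apply T.
    + replace d with (-1)%Z by lia. subst b.
      eapply even_or_odd_sign; [|apply (T (- q)%Z)]. right. unfold Tmat. rewrite zmat_opp. f_equal; lia.
  - pose proof (K_cusp a b c d Hd HK Ec) as Hc.
    set (q := (2 * a / c)%Z). set (r := (2 * a mod c)%Z).
    assert (Hr : (2 * a = c * q + r)%Z) by (apply Z.div_mod; assumption).
    (* If [c] divided [2 a], it would divide [2 (a d - b c) = 2]. *)
    assert (r0 : r <> 0%Z).
    { intros E0. apply Hc. exists (q * d - 2 * b)%Z. rewrite E0 in Hr.
      transitivity (2 * (a * d - b * c))%Z; [lia|]. transitivity ((2 * a) * d - 2 * b * c)%Z; [ring|]. rewrite Hr. ring. }
    (* Up to sign, [2 r - c] is the lower left entry after the chosen letter is applied. *)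
    assert (Hbound : (Z.abs (2 * r - c) < Z.abs c)%Z).
    { destruct (Z_lt_ge_dec 0 c) as [h|h].
      - pose proof (Z.mod_pos_bound (2 * a) c h). lia.
      - pose proof (Z.mod_neg_bound (2 * a) c ltac:(lia)). lia. }
    (* A translation by 4 changes [2 a / c] by 8; [j] brings its integer part into the range -1 to
       6, where letters are available. *)
    set (j := ((q + 1) / 8)%Z).
    assert (Hj : (-1 <= q - 8 * j <= 6)%Z).
    { pose proof (Z.div_mod (q + 1) 8 ltac:(lia)). pose proof (Z.mod_pos_bound (q + 1) 8 ltac:(lia)). lia. }
    destruct (letter_of_sector _ Hj) as [X [xa [xb [xc [xd [HX [EX Hcd]]]]]]].
    assert (E : mmul X (mmul (Tmat (4 * (- j))) (zmat a b c d)) =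
       zmat (xa * (a - 4 * j * c) + xb * c) (xa * (b - 4 * j * d) + xb * d)
            (xc * (a - 4 * j * c) + xd * c) (xc * (b - 4 * j * d) + xd * d)).
    { unfold Tmat. rewrite EX, !zmat_mul. f_equal; ring. }
    assert (KY : K (mmul X (mmul (Tmat (4 * - j)) (zmat a b c d)))).
    { apply K_letter; [assumption|]. now apply closed_V0_power. }
    assert (Y : even_or_odd (mmul X (mmul (Tmat (4 * - j)) (zmat a b c d)))).
    { rewrite E in KY |- *.
      destruct (K_SL2Z _ KY) as [a' [b' [c' [d' [Hd' E']]]]].
      apply zmat_inj in E'. destruct E' as [Ea [Eb [Ec' Ed]]].
      apply IH; [|rewrite Ea, Eb, Ec', Ed; exact Hd' | exact KY].
      destruct Hcd as [[H1 H2]|[H1 H2]]; subst xc xd.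
      - replace (4 * (a - 4 * j * c) + - (2 * (q - 8 * j) + 1) * c)%Z with (2 * (2 * a) - 2 * (c * q) - c)%Z by ring. lia.
      - replace (-4 * (a - 4 * j * c) + (2 * (q - 8 * j) + 1) * c)%Z with (- (2 * (2 * a) - 2 * (c * q) - c))%Z by ring. lia. }
    replace (zmat a b c d) with (mmul (Tmat (4 * j)) (mmul (minv X) (mmul X (mmul (Tmat (4 * - j)) (zmat a b c d))))).
    + apply closed_V0_power; [exact even_or_odd_letter|].
      apply even_or_odd_letter; [now apply V_letters_inv | assumption].
    + rewrite (mmul_assoc (minv X)), mmul_minv_l, mmul_1_l, mmul_assoc by now apply V_letters_det.
      replace (mmul (Tmat (4 * j)) (Tmat (4 * - j))) with mone; [apply mmul_1_l|].
      unfold Tmat. rewrite zmat_mul. change mone with (zmat 1 0 0 1). f_equal; ring.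
Qed.
End Descent.

(** * The group [Gamma 4] *)

Lemma Gamma_sign N A B : psl_eq A B -> Gamma N A -> Gamma N B.
Proof.
  intros E [a [b [c [d [H1 [H2 H3]]]]]]. exists a, b, c, d. split; [auto|split; [auto|]].
  destruct E as [E|E], H3 as [H3|H3]; subst A.
  - left. exact H3.
  - right. exact H3.
  - right. rewrite <- H3. now rewrite mopp_mopp.
  - left. rewrite <- (mopp_mopp B), H3. apply mopp_mopp.
Qed.

Lemma Gamma_zmat N a b c d : (a * d - b * c = 1)%Z -> (N | a - 1)%Z -> (N | b)%Z -> (N | c)%Z -> (N | d - 1)%Z ->
  Gamma N (zmat a b c d).
Proof. intros. exists a, b, c, d. split; [auto|split; [auto|now left]]. Qed.

Lemma Gamma_1 N : Gamma N mone.
Proof. apply (Gamma_zmat N 1 0 0 1); try apply Z.divide_0_r; reflexivity. Qed.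

Lemma psl_eq_mul A A' B B' : psl_eq A A' -> psl_eq B B' -> psl_eq (mmul A B) (mmul A' B').
Proof.
  intros [E|E] [F|F]; subst; [left; reflexivity|right; mat_ring|right; mat_ring|left; mat_ring].
Qed.

Lemma Gamma_mul N A B : Gamma N A -> Gamma N B -> Gamma N (mmul A B).
Proof.
  intros [a [b [c [d [H1 [[A1 [A2 [A3 A4]]] H3]]]]]] [a' [b' [c' [d' [H1' [[B1 [B2 [B3 B4]]] H3']]]]]].
  assert (E := psl_eq_mul _ _ _ _ H3 H3'). rewrite zmat_mul in E.
  do 4 eexists. split; [|split; [|exact E]].
  - transitivity ((a * d - b * c) * (a' * d' - b' * c'))%Z; [ring|]. rewrite H1, H1'. reflexivity.
  - repeat split.
    + replace (a * a' + b * c' - 1)%Z with ((a - 1) * a' + (a' - 1) + b * c')%Z by ring.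
      apply Z.divide_add_r; [apply Z.divide_add_r|]; auto using Z.divide_mul_l, Z.divide_mul_r.
    + apply Z.divide_add_r; auto using Z.divide_mul_l, Z.divide_mul_r.
    + apply Z.divide_add_r; auto using Z.divide_mul_l, Z.divide_mul_r.
    + replace (c * b' + d * d' - 1)%Z with (c * b' + (d - 1) * d' + (d' - 1))%Z by ring.
      apply Z.divide_add_r; [apply Z.divide_add_r|]; auto using Z.divide_mul_l, Z.divide_mul_r.
Qed.

Lemma Gamma_inv N A : Gamma N A -> Gamma N (minv A).
Proof.
  intros [a [b [c [d [H1 [[A1 [A2 [A3 A4]]] H3]]]]]].
  exists d, (- b)%Z, (- c)%Z, a. split; [rewrite <- H1; ring|]. split.
  - rewrite !Z.divide_opp_r. auto.
  - destruct H3 as [E|E]; subst A; [left|right]; rewrite <- zmat_inv; [reflexivity|mat_ring].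
Qed.

Lemma Gamma4_letter X : In X V_letters -> Gamma 4 X.
Proof.
  assert (G : forall a b c d, (a * d - b * c = 1)%Z -> (4 | a - 1)%Z -> (4 | b)%Z -> (4 | c)%Z -> (4 | d - 1)%Z ->
    Gamma 4 (zmat a b c d) /\ Gamma 4 (minv (zmat a b c d))).
  { intros. split; [|apply Gamma_inv]; now apply Gamma_zmat. }
  (* For [V2], [V3] and [V4] it is the negative matrix that is congruent to the identity modulo
     4. *)
  assert (G' : forall a b c d, (a * d - b * c = 1)%Z -> (4 | - a - 1)%Z -> (4 | - b)%Z -> (4 | - c)%Z -> (4 | - d - 1)%Z ->
    Gamma 4 (zmat a b c d) /\ Gamma 4 (minv (zmat a b c d))).
  { intros a b c d H1 H2 H3 H4 H5. destruct (G (- a) (- b) (- c) (- d) ltac:(lia) H2 H3 H4 H5)%Z as [G1 G2].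
    rewrite <- zmat_opp in G1, G2. split; [eapply Gamma_sign; [|exact G1] | eapply Gamma_sign; [|exact G2]]; right; [reflexivity|mat_ring]. }
  assert (D : forall k, (4 | 4 * k)%Z) by (intros k; exists k; ring).
  assert (H0 : Gamma 4 V0 /\ Gamma 4 (minv V0))
    by (apply G; [reflexivity|exact (D 0%Z)|exact (D 1%Z)|exact (D 0%Z)|exact (D 0%Z)]).
  assert (H1 : Gamma 4 V1 /\ Gamma 4 (minv V1))
    by (apply G; [reflexivity|exact (D 0%Z)|exact (D 0%Z)|exact (D (-1)%Z)|exact (D 0%Z)]).
  assert (H2 : Gamma 4 V2 /\ Gamma 4 (minv V2))
    by (apply G'; [reflexivity|exact (D (-1)%Z)|exact (D 1%Z)|exact (D (-1)%Z)|exact (D 1%Z)]).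
  assert (H3 : Gamma 4 V3 /\ Gamma 4 (minv V3))
    by (apply G'; [reflexivity|exact (D (-2)%Z)|exact (D 4%Z)|exact (D (-1)%Z)|exact (D 2%Z)]).
  assert (H4 : Gamma 4 V4 /\ Gamma 4 (minv V4))
    by (apply G'; [reflexivity|exact (D (-3)%Z)|exact (D 9%Z)|exact (D (-1)%Z)|exact (D 3%Z)]).
  simpl. intros H. decompose [or] H; subst; tauto.
Qed.

Lemma Gamma_coefficients N a b c d : Gamma N (zmat a b c d) -> (N | b)%Z /\ (N | c)%Z.
Proof.
  intros [a' [b' [c' [d' [H1 [[A1 [A2 [A3 A4]]] [E|E]]]]]]].
  - apply zmat_inj in E. destruct E as [_ [-> [-> _]]]. auto.
  - rewrite zmat_opp in E. apply zmat_inj in E. destruct E as [_ [-> [-> _]]]. rewrite !Z.divide_opp_r. auto.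
Qed.

Lemma Gamma4_even_or_odd A : Gamma 4 A -> even_or_odd A.
Proof.
  apply descent.
  - intros B [a [b [c [d [H1 [H2 [E|E]]]]]]]; subst B.
    + exists a, b, c, d. auto.
    + rewrite zmat_opp. do 4 eexists. split; [|reflexivity]. rewrite <- H1. ring.
  - intros X B HX HB. apply Gamma_mul; [now apply Gamma4_letter | assumption].
  - intros a b c d H1 HG Hc [q Hq]. apply Gamma_coefficients in HG. destruct HG as [_ [k Hk]].
    subst c. assert (k <> 0)%Z by lia. assert (q <> 0)%Z by lia. nia.
  - intros a b d _ HG. apply (Gamma_coefficients _ _ _ _ _ HG).
Qed.

(** * Ping-pong *)

(** Homogeneous coordinates on the real projective line, which make infinity an ordinary point. *)
Definition app1 (A : mat) (v : R * R) : R * R :=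
  (m11 A * fst v + m12 A * snd v, m21 A * fst v + m22 A * snd v).

Lemma app1_mul A B v : app1 (mmul A B) v = app1 A (app1 B v).
Proof. unfold app1; simpl. f_equal; ring. Qed.

Lemma app1_1 v : app1 mone v = v.
Proof. destruct v as [x y]. unfold app1, mone; cbn [m11 m12 m21 m22 fst snd]. f_equal; ring. Qed.

(* For [-1 <= m <= 14] the form is negative iff [2 x / y] lies in [(m, m + 1)];
   [m = -2] and [m = 15] stand for the unbounded intervals. *)
Definition sector (m : Z) (v : R * R) : R :=
  let (x, y) := v in
  if (m =? -2)%Z then y * (2 * x + y)
  else if (m =? 15)%Z then - ((2 * x - 15 * y) * y)
  else (2 * x - IZR m * y) * (2 * x - IZR (m + 1) * y).

Lemma sector_opp m x y : sector m (- x, - y) = sector m (x, y).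
Proof. unfold sector. destruct (m =? -2)%Z, (m =? 15)%Z; ring. Qed.

Lemma prod_sub_neg (p q t : R) : p < q -> (t - p) * (t - q) < 0 -> p < t < q.
Proof. intros H1 H2. destruct (Rle_dec t p); [nra|]. destruct (Rle_dec q t); nra. Qed.

Lemma sector_interval m v : (-2 <= m <= 15)%Z -> sector m v < 0 -> snd v <> 0 /\
  ((m <> -2)%Z -> IZR m < 2 * fst v / snd v) /\ ((m <> 15)%Z -> 2 * fst v / snd v < IZR (m + 1)).
Proof.
  destruct v as [x y]. intros Hm H. simpl fst; simpl snd.
  assert (y0 : y <> 0).
  { intros E. subst y. unfold sector in H. destruct (m =? -2)%Z, (m =? 15)%Z; nra. }
  split; auto. assert (y2 : 0 < y ^ 2) by now apply pow2_gt_0.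
  set (t := 2 * x / y).
  assert (Et : 2 * x = t * y) by (unfold t; field; auto).
  unfold sector in H. destruct (Z.eqb_spec m (-2)) as [E|E]; [|destruct (Z.eqb_spec m 15) as [E'|E']].
  - subst m. split; [tauto|]. intros _. rewrite Et in H. simpl. nra.
  - subst m. split; [|tauto]. intros _. rewrite Et in H. nra.
  - rewrite Et in H. replace ((t * y - IZR m * y) * (t * y - IZR (m + 1) * y)) with
      ((t - IZR m) * (t - IZR (m + 1)) * y ^ 2) in H by ring.
    assert (H' : (t - IZR m) * (t - IZR (m + 1)) < 0) by nra.
    apply prod_sub_neg in H'; [split; intros; apply H'|]. apply IZR_lt. lia.
Qed.

Lemma sector_disjoint m m' v : (-2 <= m <= 15)%Z -> (-2 <= m' <= 15)%Z -> m <> m' ->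
  sector m v < 0 -> 0 < sector m' v.
Proof.
  intros Hm Hm' Hne H. destruct (sector_interval m v Hm H) as [y0 [H1 H2]].
  destruct v as [x y]. simpl fst in *; simpl snd in *.
  assert (y2 : 0 < y ^ 2) by now apply pow2_gt_0.
  set (t := 2 * x / y) in *.
  assert (Et : 2 * x = t * y) by (unfold t; field; auto).
  unfold sector. rewrite Et.
  destruct (Z.eqb_spec m' (-2)) as [E|E]; [|destruct (Z.eqb_spec m' 15) as [E'|E']].
  - subst m'. specialize (H1 ltac:(lia)). assert (-1 <= IZR m) by (apply IZR_le; lia).
    replace (y * (t * y + y)) with ((t + 1) * y ^ 2) by ring. apply Rmult_lt_0_compat; lra.
  - subst m'. specialize (H2 ltac:(lia)). assert (IZR (m + 1) <= 15) by (apply IZR_le; lia).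
    replace (- ((t * y - 15 * y) * y)) with ((15 - t) * y ^ 2) by ring. apply Rmult_lt_0_compat; lra.
  - replace ((t * y - IZR m' * y) * (t * y - IZR (m' + 1) * y)) with
      ((t - IZR m') * (t - IZR (m' + 1)) * y ^ 2) by ring.
    apply Rmult_lt_0_compat; auto. rewrite plus_IZR in *.
    destruct (Z_lt_ge_dec m m') as [h|h].
    + specialize (H2 ltac:(lia)). assert (IZR (m + 1) <= IZR m') by (apply IZR_le; lia).
      rewrite plus_IZR in *. nra.
    + specialize (H1 ltac:(lia)). assert (IZR (m' + 1) <= IZR m) by (apply IZR_le; lia).
      rewrite plus_IZR in *. nra.
Qed.

(** For a letter with first column [(a, c)] and [c] nonzero, the entry is the integer part of
    [2 a / c], where [a / c] is the image of infinity. [T_0] and its inverse fix infinity and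
    receive the unbounded intervals. Each of the 18 intervals occurs once. *)
Definition attracting (x : nat * bool) : Z :=
  if snd x then nth (fst x) [15; 7; 9; 11; 13; 8; 10; 12; 14]%Z 0%Z
  else nth (fst x) [-2; 0; 2; 4; 6; -1; 1; 3; 5]%Z 0%Z.

Definition repelling (x : nat * bool) : Z := attracting (fst x, negb (snd x)).

Lemma attracting_range x : (fst x < 9)%nat -> (-2 <= attracting x <= 15)%Z.
Proof.
  destruct x as [i b]. simpl fst. intros H.
  do 9 (destruct i as [|i]; [destruct b; unfold attracting; simpl; lia|]). lia.
Qed.

Lemma attracting_inj x y : (fst x < 9)%nat -> (fst y < 9)%nat -> attracting x = attracting y -> x = y.
Proof.
  destruct x as [i b], y as [j c]. simpl fst. intros Hi Hj.
  do 9 (destruct i as [|i]; [do 9 (destruct j as [|j]; [destruct b, c; unfold attracting; simpl; congruence|]); lia|]). lia.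
Qed.

(** A letter carries the endpoints of its repelling interval to those of its attracting one, so the
    two forms are proportional. The factor -1 says that the exterior of the first goes into the
    second. *)
Lemma sector_letter x v : (fst x < 9)%nat ->
  sector (attracting x) (app1 (eval_letter T_gens x) v) = - sector (repelling x) v.
Proof.
  destruct x as [i b], v as [p q]. simpl fst. intros H.
  do 9 (destruct i as [|i]; [destruct b; unfold repelling, attracting, eval_letter, T_gens, app1, sector,
     V0, V1, V2, V3, V4, zmat, mmul, minv; simpl; ring|]). lia.
Qed.

Definition last_repelling (w : word) : Z := repelling (last w (O, true)).

(** Before each letter acts, the point lies in the attracting interval of the letter to its right,
    or in the starting sector [k]. In a reduced word this is never the repelling interval of the
    acting letter. *)
Lemma ping_pong (w : word) k v : w <> [] -> (forall x, In x w -> (fst x < 9)%nat) -> reduced w ->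
  (-2 <= k <= 15)%Z -> sector k v < 0 -> k <> last_repelling w ->
  sector (attracting (hd (O, true) w)) (app1 (eval_word T_gens w) v) < 0.
Proof.
  intros Hne Hlt Hred Hk Hv. induction w as [|x w IH]; [congruence|].
  assert (Hx : (fst x < 9)%nat) by (apply Hlt; now left).
  assert (Hrx : (-2 <= repelling x <= 15)%Z) by now apply attracting_range.
  intros Hlast. simpl hd. change (eval_word T_gens (x :: w)) with (mmul (eval_letter T_gens x) (eval_word T_gens w)).
  rewrite app1_mul, sector_letter by assumption.
  enough (0 < sector (repelling x) (app1 (eval_word T_gens w) v)) by lra.
  destruct w as [|y w].
  - change (eval_word T_gens []) with mone. rewrite app1_1. now apply sector_disjoint with k.
  - destruct Hred as [Hxy Hred].
    assert (Hy : (fst y < 9)%nat) by (apply Hlt; simpl; tauto).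
    apply sector_disjoint with (attracting y); auto; [now apply attracting_range| |].
    + intros E. apply Hxy. apply attracting_inj in E; auto.
    + apply IH; auto; [discriminate|]. intros z Hz. apply Hlt. now right.
Qed.

Lemma T_gens_free (w : word) : w <> [] -> (forall x, In x w -> (fst x < length T_gens)%nat) -> reduced w ->
  ~ psl_eq (eval_word T_gens w) mone.
Proof.
  intros Hne Hlt Hred HE. change (length T_gens) with 9%nat in Hlt.
  assert (Hhd : (fst (hd (O, true) w) < 9)%nat).
  { apply Hlt. destruct w; [congruence|now left]. }
  set (a := attracting (hd (O, true) w)). assert (Ha : (-2 <= a <= 15)%Z) by now apply attracting_range.
  (* Only two sectors are excluded, so one of three candidates is free. *)
  assert (Hk : exists k, (-1 <= k <= 1)%Z /\ k <> last_repelling w /\ k <> a).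
  { destruct (Z.eq_dec (-1) (last_repelling w)), (Z.eq_dec (-1) a), (Z.eq_dec 0 (last_repelling w)), (Z.eq_dec 0 a);
    first [exists (-1)%Z; lia | exists 0%Z; lia | exists 1%Z; lia]. }
  destruct Hk as [k [Hk [Hk1 Hk2]]].
  (* The midpoint of the interval numbered [k]. The word moves it to the different sector [a], which
     the identity cannot do. *)
  set (v := (2 * IZR k + 1, 4)).
  assert (Hv : sector k v < 0).
  { unfold v, sector. destruct (Z.eqb_spec k (-2)); [lia|]. destruct (Z.eqb_spec k 15); [lia|].
    rewrite plus_IZR. match goal with |- ?x < 0 => replace x with (-4) by ring end. lra. }
  assert (P := ping_pong w k v Hne Hlt Hred ltac:(lia) Hv Hk1). fold a in P.
  assert (Q := sector_disjoint k a v ltac:(lia) Ha Hk2 Hv).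
  assert (E : sector a (app1 (eval_word T_gens w) v) = sector a v); [|lra].
  destruct HE as [E|E]; rewrite E; unfold v.
  - now rewrite app1_1.
  - rewrite <- sector_opp. f_equal. unfold app1, mopp, mone; cbn [m11 m12 m21 m22 fst snd]. f_equal; ring.
Qed.

(** * Lower left entries and translations in [Aut chi] *)

(** With [T] the translation by 1 and [S] the inversion, [A] is [T^a S T^d] for [c = 1] and
    [T^a1 S T^(-2) S T^d1] for [c = 2], where [a = 2 a1 + 1] and [d = 2 d1 + 1]. As translations
    preserve [|u|], fixing [u] would give [|u| = |(1 - u) / (1 + u)|] or [|u| = 1 / |u|], both false
    at the point of [uq_small]. *)
Lemma Aut_chi_cusp a b c d : (a * d - b * c = 1)%Z -> Aut chi (zmat a b c d) -> c <> 0%Z -> ~ (c | 2)%Z.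
Proof.
  assert (Main : forall a b c d, (a * d - b * c = 1)%Z -> Aut chi (zmat a b c d) -> (c = 1 \/ c = 2)%Z -> False).
  { clear. intros a b c d Hd HA Hc.
    pose proof (Aut_chi_uq _ HA) as Hu. clear HA.
    destruct uq_small as [tau0 [H0 Hsmall]].
    destruct Hc as [Hc|Hc]; subst c.
    - assert (b = a * d - 1)%Z by lia. subst b. clear Hd.
      set (tau := (tau0 + IZR (- d))%C). assert (Ht : upper tau) by now apply upper_shift.
      specialize (Hu tau Ht).
      assert (E : moebius (zmat a (a * d - 1) 1 d) tau = (Sact tau0 + IZR a)%C).
      { unfold moebius, tau, Sact; simpl. rewrite minus_IZR, mult_IZR, opp_IZR, RtoC_minus, RtoC_mult, RtoC_opp.
        assert (t0 := upper_neq0 _ H0).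
        field. exact t0. }
      rewrite E in Hu. apply (f_equal Cmod) in Hu. unfold tau in Hu.
      rewrite !Cmod_uq_shift, uq_S in Hu by (try apply upper_S; assumption).
      destruct (uq_neq tau0 H0) as [_ [H1 _]]. rewrite Cmod_div in Hu by assumption.
      set (u := uq tau0) in *.
      assert (T1 := Cmod_triangle (1 - u) u). replace (1 - u + u)%C with (RtoC 1) in T1 by ring. rewrite Cmod_1 in T1.
      assert (T2 := Cmod_triangle 1 u). rewrite Cmod_1 in T2.
      assert (P : 0 < Cmod (1 + u)) by now apply Cmod_gt_0.
      assert (X : Cmod (1 - u) = Cmod u * Cmod (1 + u)) by (rewrite <- Hu; field; lra). nra.
    - assert (exists a1 d1, a = 2 * a1 + 1 /\ d = 2 * d1 + 1)%Z as [a1 [d1 [Ea Ed]]].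
      { assert (Z.odd (a * d) = true).
        { replace (a * d)%Z with (1 + 2 * b)%Z by lia. now rewrite Z.odd_add_mul_2. }
        rewrite Z.odd_mul in H. apply andb_prop in H. destruct H as [Oa Od].
        apply Z.odd_spec in Oa, Od. destruct Oa as [a1 Ha], Od as [d1 Hd1]. exists a1, d1. auto. }
      assert (b = 2 * a1 * d1 + a1 + d1)%Z by lia. subst a d b. clear Hd.
      set (tau := (tau0 + IZR (- d1))%C). assert (Ht : upper tau) by now apply upper_shift.
      specialize (Hu tau Ht).
      set (s1 := (Sact tau0 + IZR (-2))%C).
      assert (U0 : upper (Sact tau0)) by now apply upper_S.
      assert (U1 : upper s1) by (unfold s1; now apply upper_shift).
      assert (E : moebius (zmat (2 * a1 + 1) (2 * a1 * d1 + a1 + d1) 2 (2 * d1 + 1)) tau = (Sact s1 + IZR a1)%C).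
      { assert (t0 := upper_neq0 _ H0). assert (n1 := upper_neq0 _ U1).
        assert (D := linear_neq0 2 1 tau0 H0 ltac:(lra)).
        unfold moebius, tau, zmat; cbn [m11 m12 m21 m22]. rewrite !plus_IZR, !mult_IZR, opp_IZR, !RtoC_plus, !RtoC_mult, RtoC_opp.
        unfold Sact, s1, Sact in *. field. repeat split; auto.
        - intros X. apply D. transitivity (- (RtoC (-1) + RtoC (-2) * tau0))%C; [ring|].
          transitivity (- (0))%C; [now rewrite <- X | ring].
        - intros X. apply D. rewrite <- X. ring. }
      assert (E2 : uq s1 = ((uq tau0 - 1) / (1 + uq tau0))%C).
      { unfold s1. assert (U2 : upper (Sact tau0 + IZR (-2))%C) by exact U1.
        transitivity (- uq (Sact tau0))%C.
        - replace (Sact tau0) with (Sact tau0 + IZR (-2) + 1 + 1)%C at 2.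
          + rewrite !uq_T by (repeat apply upper_shift; assumption).
            transitivity (- (Ci * Ci) * uq (Sact tau0 + IZR (-2)))%C; [rewrite Ci2; ring|ring].
          + ring.
        - rewrite uq_S by assumption. field. now apply (uq_neq tau0 H0). }
      assert (E3 : uq (Sact s1) = (/ uq tau0)%C).
      { rewrite uq_S, E2 by assumption. destruct (uq_neq tau0 H0) as [N0 [N1 _]].
        field. repeat split; auto.
        intros X. apply N0. transitivity ((1 + uq tau0 + (uq tau0 - 1)) / 2)%C; [field|].
        match type of X with ?x = _ => transitivity (x / 2)%C; [field | rewrite X; field] end. }
      rewrite E in Hu. apply (f_equal Cmod) in Hu. unfold tau in Hu.
      rewrite !Cmod_uq_shift, E3 in Hu by (try apply upper_S; assumption).
      destruct (uq_neq tau0 H0) as [N0 _]. rewrite Cmod_inv in Hu by assumption.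
      assert (X : Cmod (uq tau0) * Cmod (uq tau0) = 1) by (rewrite <- Hu at 1; apply Rinv_l; lra). nra. }
  intros Hd HA Hc Hk.
  assert (H1 := Z.divide_pos_le c 2 ltac:(lia) Hk).
  assert (H2 := Z.divide_pos_le (- c) 2 ltac:(lia) (proj2 (Z.divide_opp_l c 2) Hk)).
  destruct (Z_lt_ge_dec 0 c) as [h|h].
  - apply (Main a b c d Hd HA). lia.
  - apply (Main (- a) (- b) (- c) (- d))%Z; [lia| |lia].
    rewrite <- zmat_opp. eapply Aut_sign; [|exact HA]. right. now rewrite mopp_mopp.
Qed.

Lemma Aut_chi_translation a b d : (a * d = 1)%Z -> Aut chi (zmat a b 0 d) -> (4 | b)%Z.
Proof.
  intros ad HA. pose proof (Aut_chi_uq _ HA) as Hu. clear HA.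
  destruct (Z.eq_mul_1 a d ad) as [Ea|Ea]; subst a.
  - replace d with 1%Z in * by lia. apply translation_fixing_uq. intros tau Ht.
    rewrite <- (Hu tau Ht). change (zmat 1 b 0 1) with (Tmat b). now rewrite moebius_Tmat.
  - replace d with (-1)%Z in * by lia. apply Z.divide_opp_r. apply translation_fixing_uq. intros tau Ht.
    rewrite <- (Hu tau Ht). f_equal. unfold moebius; simpl. rewrite opp_IZR, RtoC_opp. field.
Qed.

Lemma flips_det phi A : flips phi (moebius A) -> det A = 1 -> flips phi (moebius (minv A)).
Proof.
  intros H HA tau Ht. assert (HA' : det (minv A) = 1) by now rewrite det_minv.
  assert (U := moebius_upper _ tau HA' Ht). split; auto.
  destruct (H _ U) as [_ [H1 H2]].
  rewrite <- moebius_mul, mmul_minv_r, moebius_1 in H1, H2 by assumption.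
  split; [now symmetry|]. rewrite H2. ring.
Qed.

Lemma flips_letter phi X : is_burnside_phi phi -> In X V_letters -> flips phi (moebius X).
Proof.
  intros Hphi H.
  assert (F := conj (flips_V0 phi Hphi) (conj (flips_V1 phi Hphi) (conj (flips_V2 phi Hphi) (conj (flips_V3 phi Hphi) (flips_V4 phi Hphi))))).
  assert (D : det V0 = 1 /\ det V1 = 1 /\ det V2 = 1 /\ det V3 = 1 /\ det V4 = 1).
  { repeat split; apply V_letters_det; simpl; tauto. }
  simpl in H. decompose [or] H; subst; try tauto; apply flips_det; tauto.
Qed.

(** * Generators and index of the uniformizing group *)

Section Main.
Variable phi : C -> C.
Hypothesis Hphi : is_burnside_phi phi.

Lemma Aut_chi_letter X : In X V_letters -> Aut chi X.
Proof.
  intros H. apply uq_Aut_chi; [now apply V_letters_det|]. intros tau Ht.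
  now apply (flips_letter phi X Hphi H).
Qed.

Lemma Aut_phi_letter2 X Y : In X V_letters -> In Y V_letters -> Aut phi (mmul X Y).
Proof.
  intros HX HY. split; [rewrite det_mul, !V_letters_det by assumption; ring|]. intros tau Ht.
  rewrite moebius_mul by (try apply V_letters_det; assumption).
  destruct (flips_letter phi Y Hphi HY tau Ht) as [U [_ E]].
  destruct (flips_letter phi X Hphi HX _ U) as [_ [_ E']]. rewrite E', E. ring.
Qed.

Lemma V0_not_Aut_phi : ~ Aut phi V0.
Proof.
  intros [_ H]. pose proof upper_Ci as Ui.
  destruct (flips_V0 phi Hphi Ci Ui) as [_ [_ E]]. rewrite (H Ci Ui) in E.
  now apply (phi_neq0 phi Hphi Ci Ui), C_eq_opp.
Qed.

Lemma Aut_chi_even_or_odd A : Aut chi A -> even_or_odd A.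
Proof.
  apply descent.
  - exact Aut_chi_SL2Z.
  - intros X B HX HB. apply Aut_mul; [now apply Aut_chi_letter | assumption].
  - exact Aut_chi_cusp.
  - exact Aut_chi_translation.
Qed.

Lemma T_gens_letters A : In A T_gens -> exists X Y, In X V_letters /\ In Y V_letters /\ A = mmul X Y.
Proof.
  intros H. unfold T_gens in H. simpl in H.
  decompose [or] H; subst; try contradiction; do 2 eexists; (split; [|split; [|reflexivity]]); simpl; tauto.
Qed.

Lemma generated_uniformizing A : generated T_gens A -> uniformizing_group phi A.
Proof.
  intros H. induction H as [|A HA|A B _ [IA1 IA2] _ [IB1 IB2]|A _ [IA1 IA2]|A B E _ [IA1 IA2]].
  - split; apply Aut_1.
  - destruct (T_gens_letters A HA) as [X [Y [HX [HY E]]]]. subst A. split.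
    + apply Aut_mul; now apply Aut_chi_letter.
    + now apply Aut_phi_letter2.
  - split; now apply Aut_mul.
  - split; now apply Aut_inv.
  - split; now apply (Aut_sign _ A B).
Qed.

Lemma odd_not_uniformizing A : generated T_gens (mmul V0 A) -> ~ uniformizing_group phi A.
Proof.
  intros H [_ HA]. apply V0_not_Aut_phi.
  apply generated_uniformizing in H. destruct H as [_ H].
  replace V0 with (mmul (mmul V0 A) (minv A)).
  - apply Aut_mul; [assumption | now apply Aut_inv].
  - rewrite <- mmul_assoc, mmul_minv_r by apply HA. apply mmul_1_r.
Qed.

Lemma uniformizing_generated : generates T_gens (uniformizing_group phi).
Proof.
  intros A. split; [|apply generated_uniformizing]. intros HA.
  destruct (Aut_chi_even_or_odd A (proj1 HA)) as [H|H]; [assumption|].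
  exfalso. now apply (odd_not_uniformizing A).
Qed.

Lemma generated_Gamma4 A : generated T_gens A -> Gamma 4 A.
Proof.
  intros H. induction H as [|A HA|A B _ IA _ IB|A _ IA|A B E _ IA].
  - apply Gamma_1.
  - destruct (T_gens_letters A HA) as [X [Y [HX [HY E]]]]. subst A. apply Gamma_mul; now apply Gamma4_letter.
  - now apply Gamma_mul.
  - now apply Gamma_inv.
  - now apply (Gamma_sign _ A B).
Qed.

Lemma uniformizing_index : subgroup_of_index 2 (uniformizing_group phi) (Gamma 4).
Proof.
  assert (V0l : In V0 V_letters) by (simpl; tauto).
  split; [intros A HA; now apply generated_Gamma4, uniformizing_generated|].
  exists [mone; V0]. split; [reflexivity|]. split; [|split].
  - intros A [<-|[<-|[]]]; [apply Gamma_1 | now apply Gamma4_letter].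
  - intros A HA. destruct (Gamma4_even_or_odd A HA) as [H|H].
    + exists mone. split; [now left|]. replace (mmul (minv mone) A) with A by mat_ring.
      now apply generated_uniformizing.
    + exists V0. split; [simpl; tauto|]. apply generated_uniformizing.
      (* An even product, since [V0^-1 A = (V0 V0)^-1 (V0 A)]. *)
      replace (mmul (minv V0) A) with (mmul (minv (mmul V0 V0)) (mmul V0 A)).
      * apply gen_mul; [|assumption]. apply gen_inv. now apply generated_V0_letter.
      * rewrite minv_mul, mmul_assoc, <- (mmul_assoc (minv V0)), mmul_minv_l, mmul_1_r by now apply V_letters_det.
        reflexivity.
  - intros i j Hi Hj H. simpl in Hi, Hj.
    destruct i as [|[|i]], j as [|[|j]]; try lia; try reflexivity; exfalso; apply V0_not_Aut_phi; simpl in H; destruct H as [_ H].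
    + replace V0 with (mmul (minv mone) V0) by mat_ring. assumption.
    + replace V0 with (minv (mmul (minv V0) mone)) by mat_ring. now apply Aut_inv.
Qed.
End Main.

Lemma T_gens_matrices : Forall2 psl_eq T_gens T_matrices.
Proof.
  unfold T_gens, T_matrices, V0, V1, V2, V3, V4.
  rewrite !zmat_inv, !zmat_mul.
  repeat (apply Forall2_cons; [first [left; reflexivity | right; rewrite zmat_opp; reflexivity]|]).
  apply Forall2_nil.
Qed.

Theorem mainTheorem2 :
  forall phi : C -> C,
    is_burnside_phi phi ->
    free_of_rank 9 (uniformizing_group phi) /\
    subgroup_of_index 2 (uniformizing_group phi) (Gamma 4) /\
    generates T_gens (uniformizing_group phi) /\
    Forall2 psl_eq T_gens T_matrices.
Proof.
  intros phi Hphi. split; [|split; [|split]].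
  - exists T_gens. split; [reflexivity|]. split.
    + now apply uniformizing_generated.
    + exact T_gens_free.
  - now apply uniformizing_index.
  - now apply uniformizing_generated.
  - exact T_gens_matrices.
Qed.
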